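(* For all $x\in\mathscr F_{q,c}^0(AK)$ and $X\in U_q^+(\mathfrak b_{\mathbb R})$ one has $x\lhd X=x\blacktriangleleft X$, where $\lhd$ is the translation action and $\blacktriangleleft$ the adjoint action (a priori the right hand side lies in $\mathscr F_q^0(AK)_{\mathrm{ext}}\supseteq\mathscr F_{q,c}^0(AK)$).
   Context: LIE DATA. $\mathfrak g$ complex semisimple Lie algebra with Cartan subalgebra $\mathfrak h$, simple roots $\alpha_r$ ($r\in I$), positive roots $\Delta^+$, $\rho=\frac12\sum_{\alpha\in\Delta^+}\alpha$, weight lattice $P$, dominant weights $P^+$, fundamental weights $\varpi_r$, simple reflections $s_r$, longest Weyl group element $w_0=s_{r_1}\cdots s_{r_M}$ (fixed reduced expression); $(\cdot,\cdot)$ is the multiple of the Killing-induced form on $\mathfrak h^*$ with shortest roots of length $\sqrt2$; $\check\alpha=2\alpha/(\alpha,\alpha)$. $0<q<1$, $q_r=q^{(\alpha_r,\alpha_r)/2}$, $[n]_q=(q^{-n}-q^n)/(q^{-1}-q)$. $U_q(\mathfrak g)$: generators $K_\omega$ ($\omega\in P$), $E_r,F_r$; relations $K_0=1$, $K_\omega K_\chi=K_{\omega+\chi}$, $K_\omega E_r=q^{(\omega,\alpha_r)}E_rK_\omega$, $K_\omega F_r=q^{-(\omega,\alpha_r)}F_rK_\omega$, quantum Serre relations, $E_rF_s-F_sE_r=\delta_{rs}(K_{\alpha_r}-K_{\alpha_r}^{-1})/(q_r-q_r^{-1})$; coproduct $\hat\Delta(K_\omega)=K_\omega\otimes K_\omega$,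 $\hat\Delta(E_r)=E_r\otimes K_{\alpha_r}+1\otimes E_r$, $\hat\Delta(F_r)=F_r\otimes1+K_{\alpha_r}^{-1}\otimes F_r$; antipode $\hat S$. $U_q(\mathfrak k)$: same with $K_\omega^*=K_\omega$, $E_r^*=F_rK_{\alpha_r}$. $U_q(\mathfrak b)$ (resp. $U_q(\mathfrak b^-)$): Hopf subalgebra generated by $K_\omega,E_r$ (resp. $K_\omega,F_r$); in $U_q(\mathfrak b^-)$ write $L_\omega$ for $K_\omega$. $U_q^+(\mathfrak b_{\mathbb R})$: Hopf $*$-algebra generated by copies of the Hopf algebras $U_q(\mathfrak b)$, $U_q(\mathfrak b^-)$ with $K_\omega^*=L_\omega$, $E_r^*=F_rL_{\alpha_r}$, $K_\omega L_\chi=L_\chi K_\omega$, $K_\omega F_r=q^{-(\omega,\alpha_r)}F_rK_\omega$, $L_\omega E_r=q^{(\omega,\alpha_r)}E_rL_\omega$, $E_rF_s-F_sE_r=\delta_{rs}(K_{\alpha_r}-L_{\alpha_r}^{-1})/(q_r-q_r^{-1})$. $U_q^0(\mathfrak b_{\mathbb R})$: $*$-algebra generated by copies of the algebras $U_q(\mathfrak b)$, $U_q(\mathfrak b^-)$ with $K_\omega^*=L_\omega$, $E_r^*=F_rL_{\alpha_r}$, $K_\omega L_\chi=q^{-2(\omega,\chi)}L_\chi K_\omega$, $L_\omega E_r=q^{(\omega,\alpha_r)}E_rL_\omega$, $K_\omega F_r=q^{(\omega,\alpha_r)}F_rK_\omega$, $E_rF_s-F_sE_r=-\delta_{rs}L_{\alpha_r}^{-1}/(q_r-q_r^{-1})$;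 its right coaction $\alpha:U_q^0(\mathfrak b_{\mathbb R})\to U_q^0(\mathfrak b_{\mathbb R})\otimes U_q^+(\mathfrak b_{\mathbb R})$ restricts to $\hat\Delta$ on $U_q(\mathfrak b)$ and $U_q(\mathfrak b^-)$. With $A=U_q^0(\mathfrak b_{\mathbb R})$ and $H=U_q^+(\mathfrak b_{\mathbb R})$ the map $\mathrm{can}:A\otimes A\to A\otimes H$, $x\otimes y\mapsto(x\otimes1)\alpha(y)$ is bijective (Galois object); write $\mathrm{can}^{-1}(1\otimes h)=h^{[1]}\otimes h^{[2]}$. $\mathrm{Pol}_q(K)$: for $\varpi\in P^+$, $V_\varpi$ is the irreducible Hilbert space $*$-representation of $U_q(\mathfrak k)$ with unit highest weight vector $\xi_\varpi$ of weight $\varpi$; $K_\omega\xi=q^{(\omega,\mathrm{wt}(\xi))}\xi$. $\mathrm{Pol}_q(K)$ is spanned by $U_\varpi(\xi,\eta)(x)=\langle\xi,x\eta\rangle$ (linear in the second variable), Hopf $*$-algebra dual to $U_q(\mathfrak k)$ with $\Delta(U_\varpi(\xi,\eta))=\sum_iU_\varpi(\xi,e_i)\otimes U_\varpi(e_i,\eta)$, $U_\varpi(\xi,\eta)^*(x)=\langle\eta,\hat S(x)\xi\rangle$, $\mathrm{lwt}(U_\varpi(\xi,\eta))=\mathrm{wt}(\xi)$, $\mathrm{rwt}(U_\varpi(\xi,\eta))=\mathrm{wt}(\eta)$. Lusztig operators: $T_r\xi=\sum_{-a+b-c=(\mathrm{wt}(\xi),\check\alpha_r)}\frac{(-1)^bq_r^{b-ac}}{[a]_{q_r}![b]_{q_r}![c]_{q_r}!}E_r^aF_r^bE_r^c\xi$,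 $T_{w_0}=T_{r_1}\cdots T_{r_M}$, $\eta_{w_0\varpi}=q^{-(\rho,\varpi)}T_{w_0}\xi_\varpi$ (unit lowest weight vector), $b_\varpi=U_\varpi(\xi_\varpi,\eta_{w_0\varpi})$. $\mathrm{Pol}_q(K)_{\mathrm{ext}}$ is the $*$-algebra generated by $\mathrm{Pol}_q(K)$, central $u_\omega$ ($\omega\in P$) with $u_\omega^*=u_{-\omega}$, $u_0=1$, $u_\omega u_\chi=u_{\omega+\chi}$, and self-adjoint $|b|_\omega$ with $|b|_0=1$, $|b|_\omega|b|_\chi=|b|_{\omega+\chi}$, $|b|_\omega x=q^{(\omega,\mathrm{lwt}(x)-w_0\mathrm{rwt}(x))}x|b|_\omega$ for $x\in\mathrm{Pol}_q(K)$, and $b_\varpi=u_\varpi|b|_\varpi$ for $\varpi\in P^+$. Gradings extend by $\mathrm{lwt}(|b|_\omega)=\mathrm{rwt}(|b|_\omega)=0$, $\mathrm{lwt}(u_\omega)=\omega$, $\mathrm{rwt}(u_\omega)=w_0\omega$. AMPLIFICATIONS. $\mathrm{Fun}(P,\mathbb C)$: functions on $P$; $\mathrm{Fun}_c$: finite support; $f_\omega(\chi)=f(\chi-\omega)$. $\mathscr F_q^0(AK)$, $\mathscr F_q^0(AK)_{\mathrm{ext}}$ are the $*$-algebras generated by $\mathrm{Fun}(P,\mathbb C)$ and $\mathrm{Pol}_q(K)$, resp. $\mathrm{Pol}_q(K)_{\mathrm{ext}}$, with relations $fx=xf_{\mathrm{lwt}(x)}$; $\mathscr F^0_{q,c}(AK)$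 is the span of $xf$, $x\in\mathrm{Pol}_q(K)$, $f\in\mathrm{Fun}_c(P,\mathbb C)$. TRANSLATION ACTION. Let $\pi_{\mathfrak k}:U_q^+(\mathfrak b_{\mathbb R})\to U_q(\mathfrak k)$, $E_r,F_r,K_\omega,L_\omega\mapsto E_r,F_r,K_\omega,K_\omega$, and $\pi_{\mathfrak a}:U_q^+(\mathfrak b_{\mathbb R})\to\mathbb C[P]$ (group algebra with generators $U_\omega$), $E_r,F_r\mapsto0$, $K_\omega\mapsto U_\omega$, $L_\omega\mapsto U_{-\omega}$. If $\pi_{\mathfrak k}(X_{(1)})\otimes\pi_{\mathfrak a}(X_{(2)})=\sum_iY_i\otimes U_{\omega_i}$, then for $x\in\mathrm{Pol}_q(K)$, $f\in\mathrm{Fun}(P,\mathbb C)$: $(xf)\lhd X=\sum_i(Y_i,x_{(1)})x_{(2)}f_{-\omega_i}$. (This is $(X\otimes\mathrm{id})\gamma(xf)$ for the coaction $\gamma(xf)=\Delta(x)\Delta(f)$, $\Delta(f)(\omega,\chi)=f(\omega+\chi)$.) ADJOINT ACTION. Put $z_\omega(\chi)=q^{(\omega,\chi)}$, $k_\omega=q^{-\frac12(\omega,\omega)}z_\omega u_{-\omega}$, $l_\omega=q^{-\frac12(\omega,\omega)}u_\omega z_\omega$, $e_r=(1-q_r^2)^{-1}b_{\varpi_r}^{-1}(b_{\varpi_r}\lhd E_r)$, $f_r=e_r^*l_{\alpha_r}^{-1}$, and let $\pi:U_q^0(\mathfrak b_{\mathbb R})\to\mathscr F_q^0(AK)_{\mathrm{ext}}$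 be the $*$-homomorphism $K_\omega\mapsto k_\omega$, $L_\omega\mapsto l_\omega$, $E_r\mapsto e_r$, $F_r\mapsto f_r$. Then $x\blacktriangleleft h=\pi(h^{[1]})x\pi(h^{[2]})$ for $x\in\mathscr F_q^0(AK)_{\mathrm{ext}}$, $h\in U_q^+(\mathfrak b_{\mathbb R})$; for $h\in U_q(\mathfrak b)\cup U_q(\mathfrak b^-)$ this equals $\pi(\hat S(h_{(1)}))x\pi(h_{(2)})$. *)

(* Defs.v *)
From HB Require Import structures.
From mathcomp Require Import all_boot all_order all_algebra.
From mathcomp Require Import complex.
From mathcomp Require Import boolp classical_sets reals exp.

Set Implicit Arguments.
Unset Strict Implicit.
Unset Printing Implicit Defensive.

Import Order.TTheory GRing.Theory Num.Theory.
Local Open Scope ring_scope.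
Local Open Scope quotient_scope.

Reserved Notation "c %:S" (format "c %:S").

(* MathComp's algType demands 1 != 0, which is not known beforehand for an
   algebra given by generators and relations.  A unital algebra over C is
   therefore a ring, possibly zero, with a unital ring morphism from C to its
   centre; the product of the vector x by the scalar c is c%:S * x. *)
HB.mixin Record isPzAlg (C : comPzRingType) A of GRing.PzRing A := {
  scal : C -> A;
  scal1 : scal 1 = 1;
  scalD : {morph scal : a b / a + b};
  scalM : {morph scal : a b / a * b};
  scalC : forall (c : C) (x : A), scal c * x = x * scal c
}.

#[short(type="pzAlgType")]
HB.structure Definition PzAlg (C : comPzRingType) :=
  {A of isPzAlg C A & GRing.PzRing A}.

Notation "c %:S" := (scal c) : ring_scope.

HB.mixin Record isStarAlg (C : numClosedFieldType) A of PzAlg C A := {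
  star : A -> A;
  starK : involutive star;
  starD : {morph star : x y / x + y};
  starM : forall x y, star (x * y) = star y * star x;
  star_scal : forall c : C, star c%:S = (Num.conj c)%:S
}.

#[short(type="starAlgType")]
HB.structure Definition StarAlg (C : numClosedFieldType) :=
  {A of isStarAlg C A & PzAlg C A}.

HB.instance Definition _ (C : comPzRingType) :=
  isPzAlg.Build C C^o (erefl : id 1 = 1 :> C^o) (fun _ _ => erefl)
    (fun _ _ => erefl) (fun c x => mulrC (c : C) x).

Section AlgHom.
Variable C : numClosedFieldType.

Definition linear_map (A B : pzAlgType C) (f : A -> B) : Prop :=
  {morph f : x y / x + y} /\ forall (c : C) x, f (c%:S * x) = c%:S * f x.

Definition alg_hom (A B : pzAlgType C) (f : A -> B) : Prop :=
  [/\ {morph f : x y / x + y}, {morph f : x y / x * y}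
    & forall c : C, f c%:S = c%:S].

Definition star_hom (A B : starAlgType C) (f : A -> B) : Prop :=
  alg_hom f /\ {morph f : x / star x}.

(* Junk value 0 when [x] is not invertible. *)
Definition alg_inv (A : pzAlgType C) (x : A) : A :=
  xget 0 [set y : A | x * y = 1 /\ y * x = 1]%classic.

End AlgHom.

Inductive sterm (C G : Type) : Type :=
| TGen of G
| TCst of C
| TAdd of sterm C G & sterm C G
| TMul of sterm C G & sterm C G
| TStar of sterm C G.

Arguments TGen {C G} _.
Arguments TCst {C G} _.

HB.instance Definition _ C G := gen_eqMixin (sterm C G).
HB.instance Definition _ C G := gen_choiceMixin (sterm C G).

Declare Scope sterm_scope.
Delimit Scope sterm_scope with T.
Bind Scope sterm_scope with sterm.
Notation "c %:S" := (TCst c%R) : sterm_scope.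
Notation "0" := (TCst 0%R) : sterm_scope.
Notation "1" := (TCst 1%R) : sterm_scope.
Notation "x + y" := (TAdd x y) : sterm_scope.
Notation "x * y" := (TMul x y) : sterm_scope.
Notation "x ^+ k" := (iterop k (@TMul _ _) x (TCst 1%R)) : sterm_scope.
Notation "x ^*" := (TStar x) : sterm_scope.

Section Presented.
Variables (C : numClosedFieldType) (G : Type).
Notation term := (sterm C G).
Variable rel : term -> term -> Prop.

Local Open Scope sterm_scope.

(* The smallest congruence containing [rel] whose quotient is a unital
   star-algebra. *)
Inductive scong : term -> term -> Prop :=
| sc_rel s t : rel s t -> scong s t
| sc_refl s : scong s s
| sc_sym s t : scong s t -> scong t s
| sc_trans s t u : scong s t -> scong t u -> scong s u
| sc_add s s' t t' : scong s s' -> scong t t' -> scong (s + t) (s' + t')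
| sc_mul s s' t t' : scong s s' -> scong t t' -> scong (s * t) (s' * t')
| sc_star s s' : scong s s' -> scong (s^*) (s'^*)
| sc_addA s t u : scong (s + (t + u)) (s + t + u)
| sc_addC s t : scong (s + t) (t + s)
| sc_add0 s : scong (0 + s) s
| sc_addN s : scong ((- 1)%:S * s + s) 0
| sc_mulA s t u : scong (s * (t * u)) (s * t * u)
| sc_mul1l s : scong (1 * s) s
| sc_mul1r s : scong (s * 1) s
| sc_mulDl s t u : scong ((s + t) * u) (s * u + t * u)
| sc_mulDr s t u : scong (s * (t + u)) (s * t + s * u)
| sc_scalD a b : scong (a + b)%:S (a%:S + b%:S)
| sc_scalM a b : scong (a * b)%:S (a%:S * b%:S)
| sc_scalC c s : scong (c%:S * s) (s * c%:S)
| sc_starK s : scong (s^*^*) s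
| sc_starD s t : scong ((s + t)^*) (s^* + t^*)
| sc_starM s t : scong ((s * t)^*) (t^* * s^*)
| sc_star_scal c : scong (c%:S^*) (Num.conj c)%:S.

Local Close Scope sterm_scope.

Definition scongb (s t : term) : bool := `[< scong s t >].

Lemma scongb_refl : reflexive scongb.
Proof. by move=> s; apply/asboolP; exact: sc_refl. Qed.

Lemma scongb_sym : symmetric scongb.
Proof. by move=> s t; apply/asboolP/asboolP; exact: sc_sym. Qed.

Lemma scongb_trans : transitive scongb.
Proof.
move=> t s u /asboolP st /asboolP tu; apply/asboolP.
exact: sc_trans st tu.
Qed.

Canonical scong_equiv := EquivRel scongb scongb_refl scongb_sym scongb_trans.

Definition presented := {eq_quot scong_equiv}.
HB.instance Definition _ := Choice.on presented.
HB.instance Definition _ := EqQuotient.on presented.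

Definition pclass (t : term) : presented := \pi_presented t.

Definition pgen (g : G) : presented := pclass (TGen g).

Lemma pclass_eq s t : scong s t <-> pclass s = pclass t.
Proof.
split=> [st|/eqmodP /asboolP //].
by apply/eqmodP/asboolP.
Qed.

Lemma pclassK (x : presented) : pclass (repr x) = x.
Proof. exact: reprK. Qed.

Lemma repr_pclass t : scong (repr (pclass t)) t.
Proof. by apply/pclass_eq; rewrite pclassK. Qed.

Lemma pclassP (P : presented -> Prop) : (forall t, P (pclass t)) -> forall x, P x.
Proof. by move=> Pt x; rewrite -(pclassK x). Qed.

Definition padd (x y : presented) := pclass (repr x + repr y)%T.
Definition pmul (x y : presented) := pclass (repr x * repr y)%T.
Definition pstar (x : presented) := pclass ((repr x)^*)%T.
Definition pscal (c : C) : presented := pclass (c%:S)%T.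
Definition popp (x : presented) := pmul (pscal (-1)) x.

Lemma paddE s t : padd (pclass s) (pclass t) = pclass (s + t)%T.
Proof. by apply/pclass_eq/sc_add; exact: repr_pclass. Qed.
Lemma pmulE s t : pmul (pclass s) (pclass t) = pclass (s * t)%T.
Proof. by apply/pclass_eq/sc_mul; exact: repr_pclass. Qed.
Lemma pstarE t : pstar (pclass t) = pclass (t^*)%T.
Proof. by apply/pclass_eq/sc_star; exact: repr_pclass. Qed.

Let pE := (paddE, pmulE, pstarE).

Lemma paddA : associative padd.
Proof. by do 3!elim/pclassP => ?; rewrite !pE; apply/pclass_eq; exact: sc_addA. Qed.
Lemma paddC : commutative padd.
Proof. by do 2!elim/pclassP => ?; rewrite !pE; apply/pclass_eq; exact: sc_addC. Qed.
Lemma padd0 : left_id (pscal 0) padd.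
Proof. by elim/pclassP => ?; rewrite !pE; apply/pclass_eq; exact: sc_add0. Qed.
Lemma paddN : left_inverse (pscal 0) popp padd.
Proof. by elim/pclassP => ?; rewrite /popp /pscal !pE; apply/pclass_eq; exact: sc_addN. Qed.

HB.instance Definition _ :=
  GRing.isZmodule.Build presented paddA paddC padd0 paddN.

Lemma pmulA : associative pmul.
Proof. by do 3!elim/pclassP => ?; rewrite !pE; apply/pclass_eq; exact: sc_mulA. Qed.
Lemma pmul1l : left_id (pscal 1) pmul.
Proof. by elim/pclassP => ?; rewrite !pE; apply/pclass_eq; exact: sc_mul1l. Qed.
Lemma pmul1r : right_id (pscal 1) pmul.
Proof. by elim/pclassP => ?; rewrite !pE; apply/pclass_eq; exact: sc_mul1r. Qed.
Lemma pmulDl : left_distributive pmul padd.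
Proof. by do 3!elim/pclassP => ?; rewrite !pE; apply/pclass_eq; exact: sc_mulDl. Qed.
Lemma pmulDr : right_distributive pmul padd.
Proof. by do 3!elim/pclassP => ?; rewrite !pE; apply/pclass_eq; exact: sc_mulDr. Qed.

HB.instance Definition _ :=
  GRing.Zmodule_isPzRing.Build presented pmulA pmul1l pmul1r pmulDl pmulDr.

Lemma pscalD : {morph pscal : a b / a + b >-> padd a b}.
Proof. by move=> a b; rewrite pE; apply/pclass_eq; exact: sc_scalD. Qed.
Lemma pscalM : {morph pscal : a b / a * b >-> pmul a b}.
Proof. by move=> a b; rewrite pE; apply/pclass_eq; exact: sc_scalM. Qed.
Lemma pscalC c x : pmul (pscal c) x = pmul x (pscal c).
Proof. by elim/pclassP: x => ?; rewrite !pE; apply/pclass_eq; exact: sc_scalC. Qed.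

HB.instance Definition _ :=
  isPzAlg.Build C presented erefl pscalD pscalM pscalC.

Lemma pstarK : involutive pstar.
Proof. by elim/pclassP => ?; rewrite !pE; apply/pclass_eq; exact: sc_starK. Qed.
Lemma pstarD : {morph pstar : x y / padd x y}.
Proof. by do 2!elim/pclassP => ?; rewrite !pE; apply/pclass_eq; exact: sc_starD. Qed.
Lemma pstarM x y : pstar (pmul x y) = pmul (pstar y) (pstar x).
Proof.
by elim/pclassP: x => ?; elim/pclassP: y => ?; rewrite !pE; apply/pclass_eq;
  exact: sc_starM.
Qed.
Lemma pstar_scal c : pstar (pscal c) = pscal (Num.conj c).
Proof. by rewrite pE; apply/pclass_eq; exact: sc_star_scal. Qed.

HB.instance Definition _ :=
  isStarAlg.Build C presented pstarK pstarD pstarM pstar_scal.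

End Presented.

Section Tensor.
Variables (C : numClosedFieldType) (A B : pzAlgType C).

(* The list [:: (a1, b1); ...; (ak, bk)] stands for the tensor
   a1 (x) b1 + ... + ak (x) bk. *)
Inductive tcong : seq (A * B) -> seq (A * B) -> Prop :=
| tc_refl s : tcong s s
| tc_sym s t : tcong s t -> tcong t s
| tc_trans s t u : tcong s t -> tcong t u -> tcong s u
| tc_cat s s' t t' : tcong s s' -> tcong t t' -> tcong (s ++ t) (s' ++ t')
| tc_catC s t : tcong (s ++ t) (t ++ s)
| tc_0 b : tcong [:: (0, b)] [::]
| tc_Dl a a' b : tcong [:: (a + a', b)] [:: (a, b); (a', b)]
| tc_Dr a b b' : tcong [:: (a, b + b')] [:: (a, b); (a, b')]
| tc_scal (c : C) a b : tcong [:: (c%:S * a, b)] [:: (a, c%:S * b)].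

Definition tcongb s t : bool := `[< tcong s t >].

Lemma tcongb_refl : reflexive tcongb.
Proof. by move=> s; apply/asboolP; exact: tc_refl. Qed.
Lemma tcongb_sym : symmetric tcongb.
Proof. by move=> s t; apply/asboolP/asboolP; exact: tc_sym. Qed.
Lemma tcongb_trans : transitive tcongb.
Proof.
move=> t s u /asboolP st /asboolP tu; apply/asboolP.
exact: tc_trans st tu.
Qed.

Canonical tcong_equiv := EquivRel tcongb tcongb_refl tcongb_sym tcongb_trans.

Definition tens := {eq_quot tcong_equiv}.
HB.instance Definition _ := Choice.on tens.
HB.instance Definition _ := EqQuotient.on tens.

Definition tclass (s : seq (A * B)) : tens := \pi_tens s.

Definition pure (a : A) (b : B) : tens := tclass [:: (a, b)].

Lemma tclass_eq s t : tcong s t <-> tclass s = tclass t.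
Proof.
split=> [st|/eqmodP /asboolP //].
by apply/eqmodP/asboolP.
Qed.

Lemma tclassK (x : tens) : tclass (repr x) = x.
Proof. exact: reprK. Qed.

Lemma repr_tclass s : tcong (repr (tclass s)) s.
Proof. by apply/tclass_eq; rewrite tclassK. Qed.

Lemma tclassP (P : tens -> Prop) : (forall s, P (tclass s)) -> forall x, P x.
Proof. by move=> Ps x; rewrite -(tclassK x). Qed.

Definition sopp (s : seq (A * B)) := [seq (- p.1, p.2) | p <- s].

Lemma tcong_sopp s t : tcong s t -> tcong (sopp s) (sopp t).
Proof.
elim=> {s t}
  [s|s t _ IH|s t u _ IH1 _ IH2|s s' t t' _ IH1 _ IH2|s t|b|a a' b|a b b'|c a b].
- exact: tc_refl.
- exact: tc_sym.
- exact: tc_trans IH1 IH2.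
- by rewrite /sopp !map_cat; exact: tc_cat.
- by rewrite /sopp !map_cat; exact: tc_catC.
- by rewrite /sopp /= oppr0; exact: tc_0.
- by rewrite /sopp /= opprD; exact: tc_Dl.
- exact: tc_Dr.
- by rewrite /sopp /= -mulrN; exact: tc_scal.
Qed.

Definition tadd (x y : tens) := tclass (repr x ++ repr y).
Definition topp (x : tens) := tclass (sopp (repr x)).

Lemma taddE s t : tadd (tclass s) (tclass t) = tclass (s ++ t).
Proof. by apply/tclass_eq/tc_cat; exact: repr_tclass. Qed.
Lemma toppE s : topp (tclass s) = tclass (sopp s).
Proof. by apply/tclass_eq/tcong_sopp; exact: repr_tclass. Qed.

Lemma taddA : associative tadd.
Proof. by do 3!elim/tclassP => ?; rewrite !taddE catA. Qed.
Lemma taddC : commutative tadd.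
Proof. by do 2!elim/tclassP => ?; rewrite !taddE; apply/tclass_eq; exact: tc_catC. Qed.
Lemma tadd0 : left_id (tclass [::]) tadd.
Proof. by elim/tclassP => ?; rewrite !taddE. Qed.

Lemma tclass_cons p s : tclass (p :: s) = tadd (pure p.1 p.2) (tclass s).
Proof. by rewrite taddE -surjective_pairing. Qed.

Lemma taddN : left_inverse (tclass [::]) topp tadd.
Proof.
have pN a b : tadd (pure (- a) b) (pure a b) = tclass [::].
  rewrite taddE; apply/tclass_eq; apply: tc_trans (tc_0 b).
  by rewrite -(addNr a); exact/tc_sym/tc_Dl.
elim/tclassP => s; rewrite toppE.
elim: s => [|p s IH]; first by rewrite taddE.
rewrite /sopp /= -/(sopp _) !tclass_cons /=.
rewrite [tadd (pure (- p.1) _) _]taddC -taddA [tadd (pure (- p.1) _) _]taddA.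
by rewrite pN tadd0 IH.
Qed.

HB.instance Definition _ := GRing.isZmodule.Build tens taddA taddC tadd0 taddN.

Lemma pureDl a a' b : pure (a + a') b = pure a b + pure a' b.
Proof. by rewrite /GRing.add /= taddE; apply/tclass_eq; exact: tc_Dl. Qed.
Lemma pureDr a b b' : pure a (b + b') = pure a b + pure a b'.
Proof. by rewrite /GRing.add /= taddE; apply/tclass_eq; exact: tc_Dr. Qed.
Lemma pure_scal (c : C) a b : pure (c%:S * a) b = pure a (c%:S * b).
Proof. by apply/tclass_eq; exact: tc_scal. Qed.
Lemma pure0l b : pure 0 b = 0.
Proof. by apply/tclass_eq; exact: tc_0. Qed.

Lemma tclassE s : tclass s = \sum_(p <- s) pure p.1 p.2.
Proof.
elim: s => [|p s IH]; first by rewrite big_nil.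
by rewrite tclass_cons IH big_cons.
Qed.

Lemma tens_ind (P : tens -> Prop) :
  (forall a b, P (pure a b)) -> P 0 -> (forall x y, P x -> P y -> P (x + y)) ->
  forall x, P x.
Proof.
move=> Pp P0 PD; elim/tclassP => s; rewrite tclassE.
by elim: s => [|p s IH]; rewrite ?big_nil // big_cons; apply: PD.
Qed.

(* The additive map with a (x) b |-> f a b; meaningful for bilinear f. *)
Definition tlift (V : zmodType) (f : A -> B -> V) (x : tens) : V :=
  \sum_(p <- repr x) f p.1 p.2.

Section Lift.
Variables (V : zmodType) (f : A -> B -> V).
Hypothesis flD : forall b, {morph f^~ b : a a' / a + a'}.
Hypothesis frD : forall a, {morph f a : b b' / b + b'}.
Hypothesis fZ : forall (c : C) a b, f (c%:S * a) b = f a (c%:S * b).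

Lemma tlift_tclass s : tlift f (tclass s) = \sum_(p <- s) f p.1 p.2.
Proof.
have fl0 b : f 0 b = 0.
  by have := flD b 0 0; rewrite addr0 -{1}[f 0 b]addr0 => /addrI.
rewrite /tlift; move: (repr _) (repr_tclass s) => t.
elim=> {s t} // [s t u _ -> _ -> //|s s' t t' _ IH1 _ IH2|s t|b|a a' b|a b b'|c a b].
- by rewrite !big_cat /= IH1 IH2.
- by rewrite !big_cat /= addrC.
- by rewrite big_seq1 big_nil.
- by rewrite !big_cons !big_nil /= !addr0 flD.
- by rewrite !big_cons !big_nil /= !addr0 frD.
- by rewrite !big_seq1 /= fZ.
Qed.

Lemma tlift_pure a b : tlift f (pure a b) = f a b.
Proof. by rewrite /pure tlift_tclass big_seq1. Qed.

Lemma tliftD : {morph tlift f : x y / x + y}.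
Proof.
elim/tclassP => s; elim/tclassP => t.
by rewrite [in LHS]/GRing.add /= taddE !tlift_tclass big_cat.
Qed.

Lemma tlift0 : tlift f 0 = 0.
Proof. by have := tliftD 0 0; rewrite addr0 -{1}[tlift f 0]addr0 => /addrI. Qed.

End Lift.
End Tensor.

Section TensorAlgebra.
Variables (C : numClosedFieldType) (A B : pzAlgType C).
Notation T := (tens A B).

Let m1 (a : A) (b : B) : A -> B -> T := fun a' b' => pure (a * a') (b * b').

Definition tmul (x y : T) : T := tlift (fun a b => tlift (m1 a b) y) x.

Let m1l a b b' : {morph (m1 a b)^~ b' : u v / u + v}.
Proof. by move=> u v; rewrite /m1 mulrDr pureDl. Qed.
Let m1r a b a' : {morph m1 a b a' : u v / u + v}.
Proof. by move=> u v; rewrite /m1 mulrDr pureDr. Qed.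
Let m1Z a b (c : C) a' b' : m1 a b (c%:S * a') b' = m1 a b a' (c%:S * b').
Proof. by rewrite /m1 !mulrA -!scalC -!mulrA pure_scal. Qed.

Let m2l y b : {morph (fun a => tlift (m1 a b) y) : u v / u + v}.
Proof.
move=> u v; elim/tens_ind: y => [a' b'||y y' IH IH'].
- by rewrite !tlift_pure // /m1 mulrDl pureDl.
- by rewrite !tlift0 // addr0.
- by rewrite !tliftD // IH IH' addrACA.
Qed.
Let m2r y a : {morph (fun b => tlift (m1 a b) y) : u v / u + v}.
Proof.
move=> u v; elim/tens_ind: y => [a' b'||y y' IH IH'].
- by rewrite !tlift_pure // /m1 mulrDl pureDr.
- by rewrite !tlift0 // addr0.
- by rewrite !tliftD // IH IH' addrACA.
Qed.
Let m2Z y (c : C) a b : tlift (m1 (c%:S * a) b) y = tlift (m1 a (c%:S * b)) y.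
Proof.
elim/tens_ind: y => [a' b'||y y' IH IH'].
- by rewrite !tlift_pure // /m1 -!mulrA pure_scal.
- by rewrite !tlift0.
- by rewrite !tliftD // IH IH'.
Qed.

Lemma tmul_purel a b y : tmul (pure a b) y = tlift (m1 a b) y.
Proof. by rewrite /tmul (tlift_pure (m2l y) (m2r y) (m2Z y)). Qed.

Lemma tmul_pure a b a' b' : tmul (pure a b) (pure a' b') = pure (a * a') (b * b').
Proof. by rewrite tmul_purel tlift_pure. Qed.

Lemma tmulDl : left_distributive tmul +%R.
Proof. by move=> x y z; rewrite /tmul (tliftD (m2l z) (m2r z) (m2Z z)). Qed.
Lemma tmul0l y : tmul 0 y = 0.
Proof. exact: tlift0 (m2l y) (m2r y) (m2Z y). Qed.

Lemma tmulDr : right_distributive tmul +%R.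
Proof.
move=> x y z; elim/tens_ind: x => [a b||x x' IH IH'].
- by rewrite !tmul_purel tliftD.
- by rewrite !tmul0l addr0.
- by rewrite !tmulDl IH IH' addrACA.
Qed.
Lemma tmul0r x : tmul x 0 = 0.
Proof. by have := tmulDr x 0 0; rewrite addr0 -{1}[tmul x 0]addr0 => /addrI. Qed.

Lemma tmulA : associative tmul.
Proof.
move=> x y z.
elim/tens_ind: x => [a b||x x' IH IH']; last first.
- by rewrite !tmulDl IH IH'.
- by rewrite !tmul0l.
elim/tens_ind: y => [a' b'||y y' IH IH']; last first.
- by rewrite tmulDl !tmulDr tmulDl IH IH'.
- by rewrite tmul0l !tmul0r tmul0l.
elim/tens_ind: z => [a'' b''||z z' IH IH']; last first.
- by rewrite !tmulDr IH IH'.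
- by rewrite !tmul0r.
by rewrite !tmul_pure !mulrA.
Qed.
Lemma tmul1l : left_id (pure 1 1) tmul.
Proof.
elim/tens_ind => [a b||x y IH IH']; first by rewrite tmul_pure !mul1r.
- exact: tmul0r.
- by rewrite tmulDr IH IH'.
Qed.
Lemma tmul1r : right_id (pure 1 1) tmul.
Proof.
elim/tens_ind => [a b||x y IH IH']; first by rewrite tmul_pure !mulr1.
- exact: tmul0l.
- by rewrite tmulDl IH IH'.
Qed.

HB.instance Definition _ :=
  GRing.Zmodule_isPzRing.Build T tmulA tmul1l tmul1r tmulDl tmulDr.

Definition tscal (c : C) : T := pure c%:S 1.

Lemma tscal1 : tscal 1 = 1.
Proof. by rewrite /tscal scal1. Qed.
Lemma tscalD : {morph tscal : a b / a + b}.
Proof. by move=> a b; rewrite /tscal scalD pureDl. Qed.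
Lemma tscalM : {morph tscal : a b / a * b}.
Proof. by move=> a b; rewrite [RHS]tmul_pure /tscal scalM mulr1. Qed.
Lemma tscalC c x : tscal c * x = x * tscal c.
Proof.
elim/tens_ind: x => [a b||x y IH IH'].
- by rewrite [LHS]tmul_pure [RHS]tmul_pure mul1r mulr1 scalC.
- by rewrite mulr0 mul0r.
- by rewrite mulrDl mulrDr IH IH'.
Qed.

HB.instance Definition _ := isPzAlg.Build C T tscal1 tscalD tscalM tscalC.

End TensorAlgebra.

Notation "x - y" := (TAdd x (TMul (TCst (-1)%R) y)) : sterm_scope.

(* A weight w is encoded by its coordinates w 0 r = (w, coroot of alpha_r) in
   the basis of fundamental weights. *)
Definition weight (n : nat) := 'rV[int]_n.

Section Weyl.
Variables (n : nat) (A : 'M[int]_n).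

Definition simple_root (r : 'I_n) : weight n := \row_s A s r.

Definition simple_refl (r : 'I_n) (w : weight n) : weight n :=
  w - w 0 r *: simple_root r.

(* The word [:: r1; ...; rk] acts as s_r1 ... s_rk. *)
Definition weyl (s : seq 'I_n) (w : weight n) : weight n := foldr simple_refl w s.

Definition is_root (b : weight n) : Prop :=
  exists s r, b = weyl s (simple_root r).

Definition is_posroot (b : weight n) : Prop :=
  is_root b /\ exists c : 'I_n -> nat, b = \sum_r simple_root r *+ c r.

Definition reduced (s : seq 'I_n) : Prop :=
  forall t, weyl t =1 weyl s -> (size s <= size t)%N.

Definition reduced_longest (s : seq 'I_n) : Prop :=
  reduced s /\ forall t, reduced t -> (size t <= size s)%N.

(* A is the Cartan matrix, A r s = (coroot of alpha_r, alpha_s), of a complex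
   semisimple Lie algebra. *)
Definition is_cartan_matrix : Prop :=
  [/\ forall r, A r r = 2,
      forall r s, r != s -> A r s <= 0
    & exists2 d : 'I_n -> rat, forall r, 0 < d r &
        (forall r s, d r * (A r s)%:~R = d s * (A s r)%:~R) /\
        forall x : 'I_n -> rat, (exists r, x r != 0) ->
          0 < \sum_r \sum_s d r * (A r s)%:~R * x r * x s].

Definition ratw (w : weight n) : 'rV[rat]_n := map_mx intr w.

Definition form_of (B : 'M[rat]_n) (x y : 'rV[rat]_n) : rat :=
  (x *m B *m y^T) 0 0.

(* Matrix of the Killing form of the Cartan subalgebra in the basis of simple
   coroots: (h, h') |-> sum over all roots b of b(h) b(h').  Its inverse is the
   matrix of the induced form on the dual in the basis of fundamental weights. *)
Definition killing (posroots : seq (weight n)) : 'M[rat]_n :=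
  \sum_(b <- posroots) 2 *: ((ratw b)^T *m ratw b).

End Weyl.

Record lie_datum := LieDatum {
  rank : nat;
  cartan : 'M[int]_rank;
  cartanP : is_cartan_matrix cartan;
  posroots : seq (weight rank);
  posroots_uniq : uniq posroots;
  posrootsP : forall b, b \in posroots <-> is_posroot cartan b;
  form : 'M[rat]_rank;
  form_killing : exists c : rat, form = c *: invmx (killing posroots);
  form_short : forall b, b \in posroots -> 2 <= form_of form (ratw b) (ratw b);
  form_norm : posroots != [::] ->
    exists2 b, b \in posroots & form_of form (ratw b) (ratw b) = 2;
  w0word : seq 'I_rank;
  w0wordP : reduced_longest cartan w0word
}.

Section LieData.
Variable g : lie_datum.

Definition wt := weight (rank g).
Definition node := 'I_(rank g).

Definition ip (w x : wt) : rat := form_of (form g) (ratw w) (ratw x).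

Definition alpha (r : node) : wt := simple_root (cartan g) r.

Definition w0 (w : wt) : wt := weyl (cartan g) (w0word g) w.

Definition rho : 'rV[rat]_(rank g) := 2^-1 *: \sum_(b <- posroots g) ratw b.

Definition dominant (w : wt) : bool := [forall r, 0 <= w 0 r].

Definition domwt := {w : wt | dominant w}.

Definition fund (r : node) : wt := delta_mx 0 r.

Lemma fund_dominant r : dominant (fund r).
Proof. by apply/forallP => s; rewrite mxE; case: (_ && _). Qed.

Definition fundw (r : node) : domwt := exist _ (fund r) (fund_dominant r).

End LieData.

Section Quantum.
Variables (R : realType) (q : R) (g : lie_datum).
Notation C := R[i].
Notation P := (wt g).
Notation I := (node g).

Definition toC (x : R) : C := (x%:C)%C.

Definition qpow (x : rat) : C := toC (q `^ ratr x).

Definition qr (r : I) : R := q `^ ratr (ip (alpha r) (alpha r) / 2).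

Definition qint (p : R) (k : nat) : R := (p ^- k - p ^+ k) / (p^-1 - p).
Definition qfact (p : R) (k : nat) : R := \prod_(1 <= i < k.+1) qint p i.
Definition qbin (p : R) (m k : nat) : R :=
  qfact p m / (qfact p k * qfact p (m - k)).

Definition serre (G : Type) (X : I -> sterm C G) (r s : I) : sterm C G :=
  let m := `|1 - cartan g r s|%N in
  \big[@TAdd C G/0%T]_(k < m.+1)
    ((toC ((-1) ^+ k * qbin (qr r) m k))%:S * (X r ^+ (m - k) * X s * X r ^+ k))%T.

Definition ef_coef (r s : I) : C := toC ((r == s)%:R / (qr r - (qr r)^-1)).

Inductive Ugen := UK of P | UE of I | UF of I.

Section UqkRel.
Notation K w := (TGen (UK w)).
Notation E r := (TGen (UE r)).
Notation F r := (TGen (UF r)).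
Local Open Scope sterm_scope.

Inductive Uqk_rel : sterm C Ugen -> sterm C Ugen -> Prop :=
| U_K0 : Uqk_rel (K 0%R) 1
| U_KK w x : Uqk_rel (K w * K x) (K (w + x)%R)
| U_KE w r : Uqk_rel (K w * E r) ((qpow (ip w (alpha r)))%:S * (E r * K w))
| U_KF w r : Uqk_rel (K w * F r) ((qpow (- ip w (alpha r)))%:S * (F r * K w))
| U_serreE r s : r != s -> Uqk_rel (serre (fun t => E t) r s) 0
| U_serreF r s : r != s -> Uqk_rel (serre (fun t => F t) r s) 0
| U_EF r s : Uqk_rel (E r * F s - F s * E r)
    ((ef_coef r s)%:S * (K (alpha r) - K (- alpha r)%R))
| U_Kstar w : Uqk_rel ((K w)^*) (K w)
| U_Estar r : Uqk_rel ((E r)^*) (F r * K (alpha r)).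

End UqkRel.

Definition Uqk := presented Uqk_rel.
HB.instance Definition _ := StarAlg.on Uqk.

Definition KU (w : P) : Uqk := pgen _ (UK w).
Definition EU (r : I) : Uqk := pgen _ (UE r).
Definition FU (r : I) : Uqk := pgen _ (UF r).

Record Uqk_hopf := UqkHopf {
  copU : Uqk -> tens Uqk Uqk;
  copU_hom : alg_hom copU;
  copU_K : forall w, copU (KU w) = pure (KU w) (KU w);
  copU_E : forall r, copU (EU r) = pure (EU r) (KU (alpha r)) + pure 1 (EU r);
  copU_F : forall r, copU (FU r) = pure (FU r) 1 + pure (KU (- alpha r)) (FU r);
  epsU : Uqk -> C^o;
  epsU_linear : linear_map epsU;
  epsU_l : forall x, tlift (fun a b => (epsU a)%:S * b) (copU x) = x;
  epsU_r : forall x, tlift (fun a b => (epsU b)%:S * a) (copU x) = x;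
  antU : Uqk -> Uqk;
  antU_linear : linear_map antU;
  antU_l : forall x, tlift (fun a b => antU a * b) (copU x) = (epsU x)%:S;
  antU_r : forall x, tlift (fun a b => a * antU b) (copU x) = (epsU x)%:S
}.

Inductive Bgen := BK of P | BL of P | BE of I | BF of I.

Section BorelRel.
Notation K w := (TGen (BK w)).
Notation L w := (TGen (BL w)).
Notation E r := (TGen (BE r)).
Notation F r := (TGen (BF r)).
Local Open Scope sterm_scope.

(* The relations of U_q(b) and U_q(b^-), and the cross relations common to
   U_q^+(b_R) and U_q^0(b_R). *)
Inductive borel_rel : sterm C Bgen -> sterm C Bgen -> Prop :=
| B_K0 : borel_rel (K 0%R) 1
| B_KK w x : borel_rel (K w * K x) (K (w + x)%R)
| B_KE w r : borel_rel (K w * E r) ((qpow (ip w (alpha r)))%:S * (E r * K w))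
| B_serreE r s : r != s -> borel_rel (serre (fun t => E t) r s) 0
| B_L0 : borel_rel (L 0%R) 1
| B_LL w x : borel_rel (L w * L x) (L (w + x)%R)
| B_LF w r : borel_rel (L w * F r) ((qpow (- ip w (alpha r)))%:S * (F r * L w))
| B_serreF r s : r != s -> borel_rel (serre (fun t => F t) r s) 0
| B_Kstar w : borel_rel ((K w)^*) (L w)
| B_Estar r : borel_rel ((E r)^*) (F r * L (alpha r))
| B_LE w r : borel_rel (L w * E r) ((qpow (ip w (alpha r)))%:S * (E r * L w)).

Inductive Up_rel : sterm C Bgen -> sterm C Bgen -> Prop :=
| Up_borel s t : borel_rel s t -> Up_rel s t
| Up_KL w x : Up_rel (K w * L x) (L x * K w)
| Up_KF w r : Up_rel (K w * F r) ((qpow (- ip w (alpha r)))%:S * (F r * K w))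
| Up_EF r s : Up_rel (E r * F s - F s * E r)
    ((ef_coef r s)%:S * (K (alpha r) - L (- alpha r)%R)).

Inductive U0_rel : sterm C Bgen -> sterm C Bgen -> Prop :=
| U0_borel s t : borel_rel s t -> U0_rel s t
| U0_KL w x : U0_rel (K w * L x) ((qpow (- (2 * ip w x)))%:S * (L x * K w))
| U0_KF w r : U0_rel (K w * F r) ((qpow (ip w (alpha r)))%:S * (F r * K w))
| U0_EF r s : U0_rel (E r * F s - F s * E r)
    ((- ef_coef r s)%:S * L (- alpha r)%R).

End BorelRel.

Definition Up := presented Up_rel.
HB.instance Definition _ := StarAlg.on Up.

Definition KP (w : P) : Up := pgen _ (BK w).
Definition LP (w : P) : Up := pgen _ (BL w).
Definition EP (r : I) : Up := pgen _ (BE r).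
Definition FP (r : I) : Up := pgen _ (BF r).

Definition U0 := presented U0_rel.
HB.instance Definition _ := StarAlg.on U0.

Definition K0 (w : P) : U0 := pgen _ (BK w).
Definition L0 (w : P) : U0 := pgen _ (BL w).
Definition E0 (r : I) : U0 := pgen _ (BE r).
Definition F0 (r : I) : U0 := pgen _ (BF r).

Definition is_copUp (D : Up -> tens Up Up) : Prop :=
  [/\ alg_hom D,
      forall w, D (KP w) = pure (KP w) (KP w) /\ D (LP w) = pure (LP w) (LP w),
      forall r, D (EP r) = pure (EP r) (KP (alpha r)) + pure 1 (EP r)
    & forall r, D (FP r) = pure (FP r) 1 + pure (LP (- alpha r)) (FP r)].

Definition is_coaction (a : U0 -> tens U0 Up) : Prop :=
  [/\ alg_hom a,
      forall w, a (K0 w) = pure (K0 w) (KP w) /\ a (L0 w) = pure (L0 w) (LP w),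
      forall r, a (E0 r) = pure (E0 r) (KP (alpha r)) + pure 1 (EP r)
    & forall r, a (F0 r) = pure (F0 r) 1 + pure (L0 (- alpha r)) (FP r)].

Definition can (a : U0 -> tens U0 Up) (t : tens U0 U0) : tens U0 Up :=
  tlift (fun x y => pure x 1 * a y) t.

Section GroupAlgebraRel.
Notation U w := (TGen w).
Local Open Scope sterm_scope.

Inductive CP_rel : sterm C P -> sterm C P -> Prop :=
| CP_0 : CP_rel (U 0%R) 1
| CP_M w x : CP_rel (U w * U x) (U (w + x)%R)
| CP_star w : CP_rel ((U w)^*) (U (- w)%R).

End GroupAlgebraRel.

Definition CP := presented CP_rel.
HB.instance Definition _ := StarAlg.on CP.

Definition UCP (w : P) : CP := pgen _ w.

Definition is_pik (p : Up -> Uqk) : Prop :=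
  [/\ alg_hom p, forall w, p (KP w) = KU w, forall w, p (LP w) = KU w,
      forall r, p (EP r) = EU r & forall r, p (FP r) = FU r].

Definition is_pia (p : Up -> CP) : Prop :=
  [/\ alg_hom p, forall w, p (KP w) = UCP w, forall w, p (LP w) = UCP (- w),
      forall r, p (EP r) = 0 & forall r, p (FP r) = 0].

Definition dot (d : nat) (u v : 'cV[C]_d) : C := ((map_mx Num.conj u)^T *m v) 0 0.

(* A finite-dimensional Hilbert space is C^d with the inner product [dot]. *)
Record hwrep (w : P) := HWRep {
  hdim : nat;
  hact : Uqk -> 'M[C]_hdim;
  hactD : {morph hact : x y / x + y};
  hactM : forall x y, hact (x * y) = hact x *m hact y;
  hact_scal : forall c : C, hact c%:S = c%:M;
  hact_star : forall x, hact (star x) = (map_mx Num.conj (hact x))^T;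
  hirr : forall W : set 'cV[C]_hdim,
    W 0 -> (forall u v, W u -> W v -> W (u + v)) ->
    (forall (c : C) u, W u -> W (c *: u)) ->
    (forall x u, W u -> W (hact x *m u)) ->
    (forall u, W u -> u = 0) \/ (forall u, W u);
  hvec : 'cV[C]_hdim;
  hvec_unit : dot hvec hvec = 1;
  hvec_wt : forall x, hact (KU x) *m hvec = qpow (ip x w) *: hvec;
  hvec_hw : forall r, hact (EU r) *m hvec = 0
}.

Definition has_wt (w : P) (V : hwrep w) (v : 'cV[C]_(hdim V)) (m : P) : Prop :=
  forall x, hact V (KU x) *m v = qpow (ip x m) *: v.

Section PolqK.
Variables (V : forall w : domwt g, hwrep (val w)) (HU : Uqk_hopf).

(* [coef xi eta] is the matrix coefficient U_w(xi, eta) and [pair] the pairing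
   with U_q(k), through which the elements are functionals on U_q(k). *)
Record PolqK := MkPolqK {
  polA :> starAlgType C;
  pair : polA -> Uqk -> C;
  pairD : forall x y X, pair (x + y) X = pair x X + pair y X;
  pair_scal : forall (c : C) x X, pair (c%:S * x) X = c * pair x X;
  pair_inj : forall x y, (forall X, pair x X = pair y X) -> x = y;
  coef : forall w : domwt g, 'cV[C]_(hdim (V w)) -> 'cV[C]_(hdim (V w)) -> polA;
  pair_coef : forall w xi eta X,
    pair (@coef w xi eta) X = dot xi (hact (V w) X *m eta);
  pol_span : forall x : polA, exists (k : nat) (w : 'I_k -> domwt g)
    (xi eta : forall i, 'cV[C]_(hdim (V (w i)))),
    x = \sum_i coef (xi i) (eta i);
  pair1 : forall X, pair 1 X = epsU HU X;
  pairM : forall x y X,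
    pair (x * y) X = tlift (fun a b => pair x a * pair y b : C^o) (copU HU X);
  pair_star : forall w xi eta X,
    pair (star (@coef w xi eta)) X = dot eta (hact (V w) (antU HU X) *m xi);
  copP : polA -> tens polA polA;
  copP_linear : linear_map copP;
  copP_coef : forall w xi eta, copP (@coef w xi eta) =
    \sum_i pure (coef xi (delta_mx i 0)) (coef (delta_mx i 0) eta)
}.

(* On vectors of weight m, T_r is the sum over all a, b, c with
   - a + b - c = (m, coroot of alpha_r); since E_r and F_r shift the weight,
   their powers of exponent dim V_w vanish on V_w. *)
Definition is_lusztig (T : forall w : domwt g, I -> 'M[C]_(hdim (V w))) : Prop :=
  forall w r m (v : 'cV[C]_(hdim (V w))), has_wt v m ->
    T w r *m v =
      \sum_(a < hdim (V w)) \sum_(b < hdim (V w))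
        \sum_(c < hdim (V w) | (- a%:Z + b%:Z - c%:Z == m 0 r))
        toC ((-1) ^+ b * qr r ^ (b%:Z - (a * c)%N%:Z) /
             (qfact (qr r) a * qfact (qr r) b * qfact (qr r) c)) *:
        (hact (V w) (EU r ^+ a * FU r ^+ b * EU r ^+ c) *m v).

Variable T : forall w : domwt g, I -> 'M[C]_(hdim (V w)).

Definition eta_w0 (w : domwt g) : 'cV[C]_(hdim (V w)) :=
  qpow (- form_of (form g) (@rho g) (ratw (val w))) *:
    foldr (fun r v => T w r *m v) (hvec (V w)) (w0word g).

Variable Pol : PolqK.

Definition bw (w : domwt g) : Pol := coef Pol (hvec (V w)) (eta_w0 w).

Inductive ext_gen := XPol of Pol | Xu of P | Xb of P.

Section ExtRel.
Notation X x := (TGen (XPol x)).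
Notation u w := (TGen (Xu w)).
Notation b w := (TGen (Xb w)).
Local Open Scope sterm_scope.

Inductive ext_rel : sterm C ext_gen -> sterm C ext_gen -> Prop :=
| ext_add (x y : Pol) : ext_rel (X (x + y)%R) (X x + X y)
| ext_mul (x y : Pol) : ext_rel (X (x * y)%R) (X x * X y)
| ext_scal (c : C) : ext_rel (X (c%:S)%R) (c%:S)
| ext_star (x : Pol) : ext_rel (X (star x)) ((X x)^*)
| ext_u0 : ext_rel (u 0%R) 1
| ext_uM w x : ext_rel (u w * u x) (u (w + x)%R)
| ext_ustar w : ext_rel ((u w)^*) (u (- w)%R)
| ext_ucentral w y : ext_rel (u w * TGen y) (TGen y * u w)
| ext_b0 : ext_rel (b 0%R) 1
| ext_bM w x : ext_rel (b w * b x) (b (w + x)%R)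
| ext_bstar w : ext_rel ((b w)^*) (b w)
| ext_bcomm w v (xi eta : 'cV[C]_(hdim (V v))) l m : has_wt xi l -> has_wt eta m ->
    ext_rel (b w * X (coef Pol xi eta))
      ((qpow (ip w (l - @w0 g m)))%:S * (X (coef Pol xi eta) * b w))
| ext_polar (w : domwt g) : ext_rel (X (bw w)) (u (val w) * b (val w)).

End ExtRel.

Definition Polext := presented ext_rel.
HB.instance Definition _ := StarAlg.on Polext.

Definition shift (w : P) (f : P -> C) : P -> C := fun x => f (x - w).

Inductive AK_gen := GFun of P -> C | GExt of Polext.

Section AKRel.
Notation f_ h := (TGen (GFun h)).
Notation X x := (TGen (GExt x)).
Local Open Scope sterm_scope.

Inductive AK_rel : sterm C AK_gen -> sterm C AK_gen -> Prop :=
| AK_fadd f h : AK_rel (f_ (fun x => f x + h x)%R) (f_ f + f_ h)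
| AK_fmul f h : AK_rel (f_ (fun x => f x * h x)%R) (f_ f * f_ h)
| AK_fscal c : AK_rel (f_ (fun _ => c)) (c%:S)
| AK_fstar f : AK_rel (f_ (fun x => Num.conj (f x))) ((f_ f)^*)
| AK_xadd (x y : Polext) : AK_rel (X (x + y)%R) (X x + X y)
| AK_xmul (x y : Polext) : AK_rel (X (x * y)%R) (X x * X y)
| AK_xscal (c : C) : AK_rel (X (c%:S)%R) (c%:S)
| AK_xstar (x : Polext) : AK_rel (X (star x)) ((X x)^*)
| AK_pol f v (xi eta : 'cV[C]_(hdim (V v))) l : has_wt xi l ->
    AK_rel (f_ f * X (pgen _ (XPol (coef Pol xi eta))))
           (X (pgen _ (XPol (coef Pol xi eta))) * f_ (shift l f))
| AK_u f w : AK_rel (f_ f * X (pgen _ (Xu w))) (X (pgen _ (Xu w)) * f_ (shift w f))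
| AK_b f w : AK_rel (f_ f * X (pgen _ (Xb w))) (X (pgen _ (Xb w)) * f_ f).

End AKRel.

Definition FAKext := presented AK_rel.
HB.instance Definition _ := StarAlg.on FAKext.

Definition jfun (f : P -> C) : FAKext := pgen _ (GFun f).
Definition ju (w : P) : FAKext := pgen _ (GExt (pgen _ (Xu w))).
Definition jpol (x : Pol) : FAKext := pgen _ (GExt (pgen _ (XPol x))).

Definition fin_supp (f : P -> C) : Prop :=
  exists l : seq P, forall x, f x != 0 -> x \in l.

(* F_q^0(AK) is identified with the span of the x f in F_q^0(AK)_ext, for x in
   Pol_q(K) and f in Fun(P, C). *)
Definition in_FAKc (y : FAKext) : Prop :=
  exists (k : nat) (x : 'I_k -> Pol) (f : 'I_k -> P -> C),
    (forall i, fin_supp (f i)) /\ y = \sum_i jpol (x i) * jfun (f i).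

(* tr is linear on F_q^0(AK), where tr (x f) X = sum_i (Y_i, x_(1)) x_(2) f_(- w_i)
   whenever pi_k(X_(1)) (x) pi_a(X_(2)) = sum_i Y_i (x) U_(w_i); its values outside
   F_q^0(AK) are immaterial. *)
Definition is_translation (D : Up -> tens Up Up) (pik : Up -> Uqk) (pia : Up -> CP)
    (tr : FAKext -> Up -> FAKext) : Prop :=
  forall (X : Up) (Y : seq (Uqk * P)),
    tlift (fun a b => pure (pik a) (pia b)) (D X)
      = \sum_(y <- Y) pure y.1 (UCP y.2) ->
  forall (k : nat) (x : 'I_k -> Pol) (f : 'I_k -> P -> C),
    tr (\sum_i jpol (x i) * jfun (f i)) X
      = \sum_i \sum_(y <- Y)
          jpol (tlift (fun a b => (pair a y.1)%:S * b) (copP (x i)))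
          * jfun (shift (- y.2) (f i)).

Variable tr : FAKext -> Up -> FAKext.

Definition zw (w : P) : P -> C := fun x => qpow (ip w x).

Definition kw (w : P) : FAKext :=
  (qpow (- (ip w w / 2)))%:S * jfun (zw w) * ju (- w).
Definition lw (w : P) : FAKext :=
  (qpow (- (ip w w / 2)))%:S * ju w * jfun (zw w).
Definition er (r : I) : FAKext :=
  (toC (1 - qr r ^+ 2)^-1)%:S * alg_inv (jpol (bw (fundw r)))
  * tr (jpol (bw (fundw r))) (EP r).
Definition fr (r : I) : FAKext := star (er r) * alg_inv (lw (alpha r)).

Definition is_pi (p : U0 -> FAKext) : Prop :=
  [/\ star_hom p, forall w, p (K0 w) = kw w, forall w, p (L0 w) = lw w,
      forall r, p (E0 r) = er r & forall r, p (F0 r) = fr r].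

(* With caninv the inverse of can, h^[1] (x) h^[2] is caninv (1 (x) h). *)
Definition adjoint (p : U0 -> FAKext) (caninv : tens U0 Up -> tens U0 U0)
    (x : FAKext) (h : Up) : FAKext :=
  tlift (fun a b => p a * x * p b) (caninv (pure 1 h)).

End PolqK.
End Quantum.

(* Main.v *)
(* The translation action <| and the adjoint action are both right actions of
   U_q^+(b_R) -- the second one because (hk)^[1] (x) (hk)^[2] is equal to
   k^[1] h^[1] (x) h^[2] k^[2] -- so they need only be compared on generators and
   on U(xi, eta) f with xi a weight vector.  For K_w and L_w this is a direct
   computation, and F_r follows from E_r by applying the involution.  For E_r, writing b = b_{w_r}, the claim reads
     x e_r - q^(alpha_r, wt xi) e_r x = x <| E_r,  e_r ~ b^-1 (b <| E_r),
   and it is obtained by applying <| E_r to a commutation relation b x = x' b in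
   Pol_q(K), where x' is x rescaled by a power of q.

   The commutation relation must be proved in Pol_q(K) itself, whose map to the
   extended algebra is not known to be injective.  It replaces the R-matrix: an
   element y of Pol_q(K) with y <| F_r = 0 and y <| K = q^(...) y is of the form
   U(xi_w, rho), because in a unitary representation a highest weight vector is
   determined by its weight up to isomorphism.  Applied to
   S(x_1) U(xi_w, b) K x_2 this gives
     U(xi_w, b) x = sum_a x_a U(xi_w, rho_a),
   and descending from xi_w with the E_r^* shows rho_a to be a multiple of b when
   b is the lowest weight vector.  That w_0 w is the lowest weight of V_w follows
   from the exchange condition and from the invariance of the weights of V_w under
   the Weyl group. *)
Require Import Defs.
From mathcomp Require Import all_boot all_order all_algebra.
From mathcomp Require Import complex.
From mathcomp Require Import boolp classical_sets reals exp.
From mathcomp Require Import ring lra zify.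

Set Implicit Arguments.
Unset Strict Implicit.
Unset Printing Implicit Defensive.

Import Order.TTheory GRing.Theory Num.Theory.
Local Open Scope ring_scope.

(** * Roots, the Weyl group and the invariant form *)

(** Behind the relation b x = x' b stands the fact that b pairs a highest with a lowest weight
    vector, on each of which an R-matrix would contribute its Cartan part alone. The two ends need
    different arguments: the highest one is a statement about functionals and leaves vectors rho_a
    undetermined; the lowest one is settled by evaluating at the unit of U_q(k), where the unwanted
    terms vanish for reasons of weight.

    The constant 1 - q_r^2 in e_r comes from applying <| E_r to that relation: commuting E_r^* with
    K_{varpi_r}, and letting K_{alpha_r} act on b, each give one factor q^{(varpi_r, alpha_r)} =
    q_r.

    The map [tr] is specified only on those X for which pi_k(X_(1)) (x) pi_a(X_(2)) is written as an
    explicit sum. One induction on X therefore builds such a sum together with the formula for the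
    adjoint action. The effect of the counit and of the antipode on generators is likewise deduced,
    from the unit law and from the inverse of a matrix of coefficients. *)

Section FormOf.
Variables (n : nat) (B : 'M[rat]_n).
Implicit Types x y z : 'rV[rat]_n.

Lemma form_ofDl x y z : form_of B (x + y) z = form_of B x z + form_of B y z.
Proof. by rewrite /form_of !mulmxDl mxE. Qed.
Lemma form_ofDr x y z : form_of B z (x + y) = form_of B z x + form_of B z y.
Proof. by rewrite /form_of linearD mulmxDr mxE. Qed.
Lemma form_ofZl a x z : form_of B (a *: x) z = a * form_of B x z.
Proof. by rewrite /form_of -!scalemxAl mxE. Qed.
Lemma form_ofZr a x z : form_of B z (a *: x) = a * form_of B z x.
Proof. by rewrite /form_of linearZ /= -!scalemxAr mxE. Qed.
Lemma form_ofNl x z : form_of B (- x) z = - form_of B x z.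
Proof. by rewrite -scaleN1r form_ofZl mulN1r. Qed.
Lemma form_ofNr x z : form_of B z (- x) = - form_of B z x.
Proof. by rewrite -scaleN1r form_ofZr mulN1r. Qed.
Lemma form_ofC x y : B^T = B -> form_of B x y = form_of B y x.
Proof.
move=> Bs; rewrite /form_of -[in RHS](trmxK (y *m B *m x^T)) [RHS]mxE.
by rewrite !trmx_mul trmxK Bs mulmxA.
Qed.
Lemma form_ofE x y : form_of B x y = \sum_r \sum_s x 0 r * B r s * y 0 s.
Proof.
rewrite /form_of mxE exchange_big /=; apply: eq_bigr => s _.
by rewrite !mxE mulr_suml.
Qed.
Lemma form_of_delta_l r x : form_of B (delta_mx 0 r) x = \sum_s B r s * x 0 s.
Proof.
rewrite form_ofE (bigD1 r) //= [X in _ + X]big1 ?addr0 => [|i ir].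
  by apply: eq_bigr => s _; rewrite mxE !eqxx mul1r.
by rewrite big1 // => s _; rewrite mxE (negPf ir) andbF !mul0r.
Qed.
End FormOf.

Lemma ratwD n (x y : weight n) : ratw (x + y) = ratw x + ratw y.
Proof. by rewrite /ratw map_mxD. Qed.
Lemma ratwN n (x : weight n) : ratw (- x) = - ratw x.
Proof. by rewrite /ratw map_mxN. Qed.
Lemma ratwZ n a (x : weight n) : ratw (a *: x) = a%:~R *: ratw x.
Proof. by rewrite /ratw map_mxZ. Qed.

(** * Signs of the roots of a Cartan matrix *)

Section RootSystem.
Variables (n : nat) (A : 'M[int]_n).
Hypothesis cartanA : is_cartan_matrix A.

(** The cone Q^+. Multiplication by [A^T] turns coordinates in the simple roots into coordinates in
    the fundamental weights. *)
Definition in_posQ (b : weight n) : Prop :=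
  exists2 c : 'rV[int]_n, (forall r, 0 <= c 0 r) & b = c *m A^T.

Lemma simple_rootE r : simple_root A r = delta_mx 0 r *m A^T.
Proof. by rewrite -rowE; apply/rowP=> s; rewrite !mxE. Qed.

Lemma simple_refl_comb t (c : 'rV[int]_n) :
  simple_refl A t (c *m A^T) = (c - (c *m A^T) 0 t *: delta_mx 0 t) *m A^T.
Proof. by rewrite /simple_refl simple_rootE mulmxBl -scalemxAl. Qed.

Lemma simple_reflD t : {morph simple_refl A t : x y / x + y}.
Proof. by move=> x y; rewrite /simple_refl mxE scalerDl opprD addrACA. Qed.

Lemma simple_refl0 t : simple_refl A t 0 = 0.
Proof. by rewrite /simple_refl mxE scale0r subr0. Qed.

Lemma simple_reflZ t a x : simple_refl A t (a *: x) = a *: simple_refl A t x.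
Proof. by rewrite /simple_refl mxE -scalerA scalerBr. Qed.

Lemma simple_reflK t : involutive (simple_refl A t).
Proof.
case: cartanA => A2 _ _ x; apply/rowP=> s.
by rewrite /simple_refl !mxE A2; ring.
Qed.

Lemma simple_refl_root t : simple_refl A t (simple_root A t) = - simple_root A t.
Proof.
case: cartanA => A2 _ _.
by rewrite /simple_refl mxE A2; apply/rowP=> s; rewrite !mxE; ring.
Qed.

Lemma weyl_cons r s x : weyl A (r :: s) x = simple_refl A r (weyl A s x).
Proof. by []. Qed.
Lemma weylD s : {morph weyl A s : x y / x + y}.
Proof. by elim: s => // r s IH x y; rewrite !weyl_cons IH simple_reflD. Qed.
Lemma weyl0 s : weyl A s 0 = 0.
Proof. by elim: s => // r s IH; rewrite weyl_cons IH simple_refl0. Qed.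
Lemma weylN s x : weyl A s (- x) = - weyl A s x.
Proof. by apply/eqP; rewrite -addr_eq0 -weylD addNr weyl0. Qed.
Lemma weylZ s a x : weyl A s (a *: x) = a *: weyl A s x.
Proof. by elim: s => // r s IH; rewrite !weyl_cons IH simple_reflZ. Qed.
Lemma weyl_cat s t x : weyl A (s ++ t) x = weyl A s (weyl A t x).
Proof. by rewrite /weyl foldr_cat. Qed.
Lemma weyl_rcons s r x : weyl A (rcons s r) x = weyl A s (simple_refl A r x).
Proof. by rewrite -cats1 weyl_cat. Qed.
Lemma weyl_revK s : cancel (weyl A (rev s)) (weyl A s).
Proof.
elim: s => [|r s IH] x //.
by rewrite rev_cons weyl_rcons weyl_cons IH simple_reflK.
Qed.
Lemma weylK s : cancel (weyl A s) (weyl A (rev s)).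
Proof. by move=> x; have := weyl_revK (rev s) x; rewrite revK. Qed.

Lemma weyl_comb s (c : 'rV[int]_n) : exists c' : 'rV[int]_n,
  weyl A s (c *m A^T) = c' *m A^T.
Proof.
elim: s => [|r s [c' IH]]; first by exists c.
by rewrite weyl_cons IH simple_refl_comb; eexists.
Qed.

Lemma cartan_pd : exists2 d : 'I_n -> rat, forall r, 0 < d r &
  exists M : 'M[rat]_n, [/\ forall r s, M r s = d r * (A r s)%:~R, M^T = M
   & forall x, x != 0 -> 0 < form_of M x x].
Proof.
case: cartanA => _ _ [d d0 [ds pd]]; exists d => //.
exists (\matrix_(r, s) (d r * (A r s)%:~R)); split.
- by move=> r s; rewrite mxE.
- by apply/matrixP=> r s; rewrite !mxE ds.
move=> x x0; rewrite form_ofE.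
rewrite (eq_bigr (fun r => \sum_s d r * (A r s)%:~R * x 0 r * x 0 s)).
  apply: pd; apply/existsP; apply: contraNT x0; rewrite negb_exists.
  by move=> /forallP x0; apply/eqP/rowP=> r; rewrite mxE; apply/eqP/negPn.
by move=> r _; apply: eq_bigr => s _; rewrite mxE; ring.
Qed.

(** A vector in the kernel is isotropic for the symmetrized Cartan matrix, which is positive
    definite. *)
Lemma cartan_inj (x : 'rV[rat]_n) : x *m (map_mx intr A)^T = 0 -> x = 0.
Proof.
move=> xA; apply/eqP/negPn/negP=> x0.
have [d d0 [M [ME _ pd]]] := cartan_pd.
have := pd _ x0; rewrite form_ofE big1 ?ltxx // => r _.
have/rowP/(_ r) := xA; rewrite !mxE => xAr.
rewrite (eq_bigr (fun s => x 0 r * d r * (x 0 s * (map_mx intr A)^T s r))).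
  by rewrite -mulr_sumr xAr mulr0.
by move=> s _; rewrite ME !mxE; ring.
Qed.

Lemma comb_inj (c c' : 'rV[int]_n) : c *m A^T = c' *m A^T -> c = c'.
Proof.
move=> cc'.
have h : ratw (c - c') *m (map_mx intr A)^T = 0.
  by rewrite map_trmx -map_mxM mulmxBl cc' subrr map_mx0.
have /rowP h' := cartan_inj h; apply/rowP=> r.
have := h' r; rewrite !mxE => /eqP; rewrite intr_eq0 subr_eq0 => /eqP//.
Qed.

Lemma in_posQD x y : in_posQ x -> in_posQ y -> in_posQ (x + y).
Proof.
move=> [c c0 ->] [c' c'0 ->]; exists (c + c'); last by rewrite mulmxDl.
by move=> r; rewrite mxE addr_ge0.
Qed.

Lemma in_posQ0 : in_posQ 0.
Proof. by exists 0; rewrite ?mul0mx // => r; rewrite mxE. Qed.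

Lemma in_posQ_root r : in_posQ (simple_root A r).
Proof.
by exists (delta_mx 0 r); rewrite ?simple_rootE // => s; rewrite mxE; case: (_ && _).
Qed.

Lemma in_posQ_anti x : in_posQ x -> in_posQ (- x) -> x = 0.
Proof.
move=> [c c0 ->] [c' c'0]; rewrite -mulNmx => /comb_inj /rowP h.
suff -> : c = 0 by rewrite mul0mx.
apply/rowP=> r; have := h r; rewrite !mxE => e.
by apply/eqP; rewrite eq_le c0 andbT -oppr_ge0 e.
Qed.

Lemma in_posQ_sum (f : weight n -> weight n) x :
  f 0 = 0 -> {morph f : x y / x + y} -> (forall a x, f (a *: x) = a *: f x) ->
  (forall r, in_posQ (f (simple_root A r))) -> in_posQ x -> in_posQ (f x).
Proof.
move=> f0 fD fZ fr [c c0 ->].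
have -> : c *m A^T = \sum_r c 0 r *: simple_root A r.
  rewrite mulmx_sum_row; apply: eq_bigr => r _.
  by rewrite simple_rootE -rowE.
rewrite (big_morph f fD f0).
elim/big_rec: _ => [|r y _ yQ]; first exact: in_posQ0.
apply: in_posQD yQ; rewrite fZ; have := c0 r; case: (c 0 r) => // k _.
elim: k => [|k IH]; first by rewrite scale0r; exact: in_posQ0.
by rewrite -[k.+1]addn1 PoszD scalerDl scale1r; apply: in_posQD.
Qed.

(* With [d] the symmetrizer, the coefficients [c] of a root in the orbit of
   alpha_r satisfy c_s d_s / d_r in Z, so the norm of the positive and of the
   negative part of [c] is a multiple of the norm 2 d_r of the root itself. *)
Section RootSign.
Variables (d : 'I_n -> rat) (M : 'M[rat]_n).
Hypothesis d_gt0 : forall r, 0 < d r.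
Hypothesis ME : forall r s, M r s = d r * (A r s)%:~R.
Hypothesis Msym : M^T = M.
Hypothesis Mpd : forall x, x != 0 -> 0 < form_of M x x.

Definition root_lattice r0 (c : 'rV[int]_n) : Prop :=
  exists e : 'rV[int]_n, forall s, (c 0 s)%:~R * d s = (e 0 s)%:~R * d r0.

Lemma dA_sym r s : d r * (A r s)%:~R = d s * (A s r)%:~R.
Proof. by rewrite -!ME -[in LHS]Msym mxE. Qed.

(** For a root [c] the vector [e] consists of the coordinates of its coroot in the simple coroots;
    it transforms by the dual reflection, which is where the witness comes from. *)
Lemma root_lattice_refl r0 t c : root_lattice r0 c ->
  root_lattice r0 (c - (c *m A^T) 0 t *: delta_mx 0 t).
Proof.
move=> [e ce]; exists (e - (\sum_s e 0 s * A s t) *: delta_mx 0 t) => s.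
rewrite !mxE eqxx /=; have [->{s}|_] := eqVneq s t; last first.
  by rewrite !mulr0 !subr0.
rewrite !mulr1 !rmorphB !mulrBl ce; congr (_ - _).
rewrite !rmorph_sum !mulr_suml; apply: eq_bigr => u _.
rewrite !mxE !rmorphM /= -mulrA [(A t u)%:~R * _]mulrC dA_sym mulrA ce.
by rewrite -!mulrA [d r0 * _]mulrC.
Qed.

Lemma form_refl t (c : 'rV[int]_n) :
  let c' := c - (c *m A^T) 0 t *: delta_mx 0 t in
  form_of M (ratw c') (ratw c') = form_of M (ratw c) (ratw c).
Proof.
move=> c'; rewrite {}/c' ratwD ratwN ratwZ; set x := _%:~R.
have -> : ratw (delta_mx 0 t : weight n) = delta_mx 0 t by rewrite /ratw map_delta_mx.
have h : form_of M (delta_mx 0 t) (ratw c) = d t * x.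
  rewrite form_of_delta_l /x mxE rmorph_sum mulr_sumr; apply: eq_bigr => s _.
  by rewrite ME !mxE !rmorphM /=; ring.
have h2 : form_of M (delta_mx 0 t) (delta_mx 0 t) = 2 * d t.
  rewrite form_of_delta_l (bigD1 t) //= big1 ?addr0; last first.
    by move=> s st; rewrite mxE (negPf st) andbF mulr0.
  by rewrite mxE !eqxx mulr1 ME; case: cartanA => -> _ _; rewrite mulrC.
rewrite !(form_ofDl, form_ofDr, form_ofNl, form_ofNr, form_ofZl, form_ofZr).
by rewrite (form_ofC (ratw c) (delta_mx 0 t) Msym) h h2; ring.
Qed.

Lemma sum_sym_even (f : 'I_n -> 'I_n -> int) :
  (forall r s, f r s = f s r) -> (forall r, exists k : int, f r r = 2 * k) ->
  exists k : int, \sum_r \sum_s f r s = 2 * k.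
Proof.
move=> fs fd.
have [k kE] := choice fd.
exists (\sum_r k r + \sum_(r < n) \sum_(s < n | (r < s)%N) f r s).
rewrite mulrDr mulr_sumr -(eq_bigr _ (fun r _ => kE r)).
have -> : \sum_r \sum_s f r s = \sum_(r < n) (f r r + \sum_(s < n | (r < s)%N) f r s
     + \sum_(s < n | (s < r)%N) f r s).
  apply: eq_bigr => r _; rewrite (bigD1 r) //= -addrA; congr (_ + _).
  rewrite (bigID (fun s : 'I_n => (r < s)%N)) /=; congr (_ + _); apply: eq_bigl => s.
    by rewrite -val_eqE /= neq_ltn; case: ltngtP.
  by rewrite -val_eqE /= neq_ltn -leqNgt; case: ltngtP.
rewrite !big_split /= -addrA; congr (_ + _).
rewrite [X in _ + X = _](exchange_big_dep xpredT) //= mulr_natl mulr2n.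
congr (_ + _).
by apply: eq_bigr => r _; apply: eq_bigr => s _; rewrite fs.
Qed.

Lemma root_lattice_norm r0 c : root_lattice r0 c -> c != 0 ->
  2 * d r0 <= form_of M (ratw c) (ratw c).
Proof.
move=> [e ce] c0.
have cs s : (c 0 s)%:~R = (e 0 s)%:~R * d r0 / d s.
  by rewrite -ce mulfK // gt_eqF.
(* The norm is d_{r0} times the sum of these integers. They form a symmetric matrix whose diagonal
   is even because A_rr = 2, so the sum is even, and positivity makes it at least 2. *)
pose f r s : int := e 0 r * A r s * c 0 s.
have fE r s : (f r s)%:~R * d r0 = (ratw c) 0 r * M r s * (ratw c) 0 s.
  rewrite /f !mxE !rmorphM /= ME mulrA ce; ring.
have fs r s : f r s = f s r.
  apply: (@intr_inj rat); apply: (mulIf (lt0r_neq0 (d_gt0 r0))).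
  rewrite !fE -[in LHS]Msym !mxE; ring.
have [k kE] : exists k, \sum_r \sum_s f r s = 2 * k.
  apply: sum_sym_even => // r; exists (e 0 r * c 0 r).
  by rewrite /f; case: cartanA => -> _ _; ring.
have nE : form_of M (ratw c) (ratw c) = (2 * k)%:~R * d r0.
  rewrite form_ofE -kE rmorph_sum mulr_suml; apply: eq_bigr => r _.
  by rewrite rmorph_sum mulr_suml; apply: eq_bigr => s _; rewrite fE.
have : 0 < form_of M (ratw c) (ratw c).
  apply: Mpd; apply: contraNneq c0 => /rowP c0; apply/eqP/rowP=> r.
  by have := c0 r; rewrite !mxE => /eqP; rewrite intr_eq0 => /eqP.
rewrite nE pmulr_lgt0 // ltr0z => k0.
rewrite ler_pM2r // -[2 in X in X <= _]/(2%:~R) ler_int; lia.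
Qed.

(** If the positive part [cp] and the negative part [cm] were both nonzero, each would have norm at
    least 2 d_{r0}. Their supports are disjoint and the off-diagonal Cartan entries are nonpositive,
    so the cross term only adds to the norm of [cp - cm], which would reach 4 d_{r0}. *)
Lemma root_sign_coef r0 (c : 'rV[int]_n) : root_lattice r0 c ->
  form_of M (ratw c) (ratw c) = 2 * d r0 ->
  (forall r, 0 <= c 0 r) \/ (forall r, c 0 r <= 0).
Proof.
move=> [e ce] cn.
pose cp : 'rV[int]_n := \row_r (if 0 <= c 0 r then c 0 r else 0).
pose cm : 'rV[int]_n := \row_r (if 0 <= c 0 r then 0 else - c 0 r).
have cE : c = cp - cm.
  by apply/rowP=> r; rewrite !mxE; case: ifP => _; rewrite ?subr0 ?sub0r ?opprK.
have lp : root_lattice r0 cp.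
  exists (\row_r (if 0 <= c 0 r then e 0 r else 0)) => s.
  by rewrite !mxE; case: ifP => _ //; rewrite !mul0r.
have lm : root_lattice r0 cm.
  exists (\row_r (if 0 <= c 0 r then 0 else - e 0 r)) => s.
  by rewrite !mxE; case: ifP => _; rewrite ?mul0r // !rmorphN !mulNr ce.
have [cm0|cm0] := eqVneq cm 0.
  left=> r; move: cm0 => /rowP/(_ r); rewrite !mxE; case: ifP => // /negbT.
  rewrite -ltNge => cr /eqP; rewrite oppr_eq0 => /eqP cr0.
  by rewrite cr0 ltxx in cr.
have [cp0|cp0] := eqVneq cp 0.
  right=> r; move: cp0 => /rowP/(_ r); rewrite !mxE; case: ifP => [_ -> //|/negbT].
  by rewrite -ltNge => /ltW.
have np := root_lattice_norm lp cp0.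
have nm := root_lattice_norm lm cm0.
have npm : form_of M (ratw cp) (ratw cm) <= 0.
  rewrite form_ofE; apply: sumr_le0 => r _; apply: sumr_le0 => s _.
  rewrite !mxE; case: ifP => [cr|_]; last by rewrite mul0r mul0r.
  case: ifP => [_|/negbT]; first by rewrite mulr0.
  rewrite -ltNge => cs.
  have rs : r != s by apply: contraTneq cs => <-; rewrite -leNgt.
  rewrite ME -mulrA mulr_ge0_le0 ?ler0z // mulr_le0_ge0 ?ler0z ?oppr_ge0 ?(ltW cs) //.
  by rewrite mulr_ge0_le0 ?(ltW (d_gt0 r)) // lerz0; case: cartanA => _ /(_ _ _ rs).
have d0 := d_gt0 r0; move: cn; rewrite cE ratwD ratwN.
rewrite !(form_ofDl, form_ofDr, form_ofNl, form_ofNr).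
rewrite (form_ofC (ratw cm) (ratw cp) Msym); lra.
Qed.

End RootSign.

Lemma root_sign s r :
  in_posQ (weyl A s (simple_root A r)) \/ in_posQ (- weyl A s (simple_root A r)).
Proof.
have [d d0 [M [ME Ms Mpd]]] := cartan_pd.
have [c [-> lc nc]] : exists c, [/\ weyl A s (simple_root A r) = c *m A^T,
    root_lattice d r c & form_of M (ratw c) (ratw c) = 2 * d r].
  elim: s => [|t s [c [IH lc nc]]].
    exists (delta_mx 0 r); split; first exact: simple_rootE.
      exists (delta_mx 0 r) => s; rewrite mxE; have [->//|_] := eqVneq s r.
      by rewrite andbF !mul0r.
    rewrite /ratw map_delta_mx form_of_delta_l (bigD1 r) //= big1 ?addr0.
      by rewrite mxE !eqxx mulr1 ME; case: cartanA => -> _ _; rewrite mulrC.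
    by move=> s sr; rewrite mxE (negPf sr) andbF mulr0.
  exists (c - (c *m A^T) 0 t *: delta_mx 0 t); split.
  - by rewrite weyl_cons IH simple_refl_comb.
  - exact: root_lattice_refl lc.
  - by rewrite (form_refl ME Ms).
have [c0|c0] := root_sign_coef d0 ME Ms Mpd lc nc; first by left; exists c.
by right; exists (- c); rewrite ?mulNmx // => t; rewrite mxE oppr_ge0.
Qed.

Lemma simple_root_neq0 r : simple_root A r != 0.
Proof.
apply/eqP=> /rowP/(_ r); rewrite !mxE; case: cartanA => -> _ _ //.
Qed.

(* A positive root other than alpha_t has a positive coefficient elsewhere,
   which s_t does not change. *)
Lemma simple_refl_pos t b : is_root A b ->
  in_posQ b -> in_posQ (- simple_refl A t b) -> b = simple_root A t.
Proof.
move=> [s [r rb]] [c c0 bE] [c' c'0].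
rewrite bE simple_refl_comb -mulNmx => /comb_inj /rowP h.
have ct u : u != t -> c 0 u = 0.
  move=> ut; have := h u; have := c'0 u; rewrite !mxE eqxx (negPf ut) /=.
  by rewrite mulr0 subr0 => + e; rewrite -e oppr_ge0 => cu; apply/eqP; rewrite eq_le cu c0.
have cE : c = c 0 t *: delta_mx 0 t.
  apply/rowP=> u; rewrite !mxE eqxx /=; have [->|/ct ->] := eqVneq u t.
    by rewrite mulr1.
  by rewrite mulr0.
have bt : b = c 0 t *: simple_root A t by rewrite bE {1}cE -scalemxAl -simple_rootE.
(* Moving b = c_t alpha_t back to alpha_r by the inverse Weyl element exhibits alpha_r as c_t times
   an integral combination of simple roots; hence c_t divides 1. *)
have [c1 c1E] := weyl_comb (rev s) (delta_mx 0 t).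
have : delta_mx 0 r = c 0 t *: c1.
  apply: comb_inj; rewrite -simple_rootE -scalemxAl -c1E -simple_rootE -weylZ -bt.
  by rewrite rb weylK.
move=> /rowP/(_ r); rewrite !mxE !eqxx /= => e1.
have c1' : c 0 t = 1 by have := c0 t; move: (c 0 t) (c1 0 r) e1 => x y;
  case: (lerP y 0) => y0; case: (lerP x 1) => x1; nia.
by rewrite -bE bt c1' scale1r.
Qed.

Lemma posrootP b : is_posroot A b <-> is_root A b /\ in_posQ b.
Proof.
split=> [] [rb h]; split=> //; case: h => c.
  move=> ->; exists (\row_r (c r)%:Z); first by move=> r; rewrite mxE.
  rewrite mulmx_sum_row; apply: eq_bigr => r _.
  by rewrite mxE simple_rootE -rowE -scaler_nat natz.
move=> c0 ->; exists (fun r => absz (c 0 r)).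
rewrite mulmx_sum_row; apply: eq_bigr => r _.
by rewrite simple_rootE -rowE -scaler_nat natz gez0_abs.
Qed.

Lemma simple_refl_posroot t b : is_posroot A b -> b != simple_root A t ->
  is_posroot A (simple_refl A t b) /\ simple_refl A t b != simple_root A t.
Proof.
move=> /posrootP[rb pb] bt.
have rb' : is_root A (simple_refl A t b).
  by case: rb => s [r ->]; exists (t :: s), r.
have pb' : in_posQ (simple_refl A t b).
  have := rb'; case=> s [r E]; case: (root_sign s r); rewrite -E // => h.
  by rewrite (simple_refl_pos rb pb h) eqxx in bt.
split; first exact/posrootP.
apply/eqP=> e; have := simple_reflK t b; rewrite e simple_refl_root => E.
have : b = 0.
  by apply: in_posQ_anti => //; rewrite -E opprK; exact: in_posQ_root.
move=> b0; move: pb'; rewrite b0 simple_refl0 => _.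
by move: E; rewrite b0 => /eqP; rewrite oppr_eq0 (negPf (simple_root_neq0 t)).
Qed.

End RootSystem.

(** * Weyl invariance of the form, the exchange condition and w_0 *)

Section LieDatumTheory.
Variable g : lie_datum.
Notation A := (cartan g).
Notation n := (rank g).
Local Notation cA := (cartanP g).
Notation P := (wt g).
Notation I := (node g).
Notation posQ := (in_posQ A).

Let K := killing (posroots g).

Lemma simple_root_posroot (r : I) : alpha r \in posroots g.
Proof.
apply/posrootsP/posrootP.
split; last exact: in_posQ_root.
by exists [::], r.
Qed.

(** s_t permutes the positive roots other than alpha_t and negates alpha_t. Applied to the summands
    of the Killing form, this yields its invariance. *)
Lemma sum_posroots_refl (V : nmodType) (f : P -> V) (t : I) :
  (forall b, f (- b) = f b) ->
  \sum_(b <- posroots g) f (simple_refl A t b) = \sum_(b <- posroots g) f b.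
Proof.
move=> fN; pose s := rem (alpha t) (posroots g).
have us : uniq s by rewrite rem_uniq // posroots_uniq.
have sE b : (b \in s) = (b != alpha t) && (b \in posroots g).
  by rewrite mem_rem_uniq ?posroots_uniq.
have ss b : b \in s -> simple_refl A t b \in s.
  rewrite !sE => /andP[bt /posrootsP rb].
  have [rb' bt'] := simple_refl_posroot cA rb bt.
  by rewrite bt'; apply/posrootsP.
have pe := perm_to_rem (simple_root_posroot t).
rewrite !(perm_big _ pe) /= !big_cons -/s; congr (_ + _).
  by rewrite (simple_refl_root cA) fN.
rewrite -(big_map (simple_refl A t) xpredT) /=; apply: perm_big.
apply: uniq_perm => //.
  by rewrite map_inj_uniq //; exact: (can_inj (simple_reflK cA t)).
move=> b; apply/mapP/idP => [[b' /ss b's ->//]|/ss bs].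
by exists (simple_refl A t b); rewrite ?(simple_reflK cA).
Qed.

(** The matrix of s_t, acting from the right on rows of coordinates in the fundamental weights. *)
Let S (t : I) : 'M[rat]_n := 1%:M - delta_mx t (0 : 'I_1) *m ratw (alpha t).

Let ratw_refl t (w : P) : ratw (simple_refl A t w) = ratw w *m S t.
Proof.
rewrite /simple_refl ratwD ratwN ratwZ /S mulmxBr mulmx1 mulmxA; congr (_ - _).
apply/rowP=> s; rewrite !mxE big_ord1 !mxE; congr (_ * _).
rewrite (bigD1 t) //= big1 ?addr0 => [|u ut]; rewrite !mxE ?eqxx ?mulr1 //.
by rewrite (negPf ut) mulr0.
Qed.

Let K_refl t : (S t)^T *m K *m S t = K.
Proof.
pose f (b : P) := 2 *: ((ratw b)^T *m ratw b).
rewrite /K /killing -/f -[RHS](@sum_posroots_refl _ f t); last first.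
  by move=> b; rewrite /f ratwN [(- _)^T]linearN /= mulNmx mulmxN opprK.
rewrite mulmx_sumr mulmx_suml; apply: eq_bigr => b _.
by rewrite /f ratw_refl trmx_mul -scalemxAr -scalemxAl !mulmxA.
Qed.

Let A_unit : map_mx intr A \in @unitmx rat n.
Proof.
rewrite -unitmx_tr -row_free_unit; apply: inj_row_free => x.
by move/(cartan_inj cA).
Qed.

Let K_sym : K^T = K.
Proof.
rewrite /K /killing linear_sum; apply: eq_bigr => b _.
by rewrite linearZ /= trmx_mul trmxK.
Qed.

(** The form is twice a sum of squares of values of the positive roots, so a vector in its kernel is
    annihilated by all simple roots, and these are linearly independent. *)
Let K_unit : K \in unitmx.
Proof.
rewrite -row_free_unit; apply: inj_row_free => x xK.
have : \sum_(b <- posroots g) ((x *m (ratw b)^T) 0 0) ^+ 2 = 0.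
  have : (x *m K *m x^T) 0 0 = 0 by rewrite xK mul0mx mxE.
  rewrite /K /killing mulmx_sumr mulmx_suml summxE => E.
  apply: (mulfI (_ : (2 : rat) != 0)) => //; rewrite mulr0 mulr_sumr -[RHS]E.
  apply: eq_bigr => b _; rewrite -scalemxAr -scalemxAl [RHS]mxE; congr (_ * _).
  rewrite expr2 mulmxA -(mulmxA (x *m (ratw b)^T)) [RHS]mxE big_ord1; congr (_ * _).
  by rewrite -[in RHS](trmxK (ratw b *m _)) [RHS]mxE trmx_mul trmxK.
move/eqP; rewrite psumr_eq0; last by move=> b _; exact: sqr_ge0.
move/allP=> h; suff : x *m map_mx intr A = 0.
  by move=> /(congr1 (mulmx^~ (invmx (map_mx intr A)))); rewrite mulmxK // mul0mx.
apply/rowP=> r; have := h _ (simple_root_posroot r).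
rewrite /= expf_eq0 /= => /eqP; rewrite !mxE => e; rewrite -[RHS]e.
by apply: eq_bigr => s _; rewrite !mxE.
Qed.

(** Invariance of K says that S^T and K S K^-1 have product 1. Square matrices that are inverse on
    one side are so on the other, and exchanging the factors gives the invariance of the form on the
    dual. *)
Let S_invK t : S t *m invmx K *m (S t)^T = invmx K.
Proof.
have h : (S t)^T *m (K *m S t *m invmx K) = 1%:M.
  by rewrite !mulmxA K_refl mulmxV.
have := mulmx1C h; rewrite -!mulmxA => /(congr1 (mulmx (invmx K))).
by rewrite mulKmx // mulmx1 !mulmxA.
Qed.

Lemma ip_sym (w x : P) : ip w x = ip x w.
Proof.
apply: form_ofC; case: (form_killing g) => c ->.
by rewrite linearZ /= trmx_inv -/K K_sym.
Qed.

Lemma ip_refl t (w x : P) : ip (simple_refl A t w) (simple_refl A t x) = ip w x.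
Proof.
rewrite /ip /form_of !ratw_refl trmx_mul; case: (form_killing g) => c ->.
rewrite -/K -!scalemxAr -!scalemxAl; apply: (congr1 (fun M : 'M[rat]_1 => M 0 0)).
congr (_ *: _).
by rewrite -[in RHS](S_invK t) !mulmxA.
Qed.

Lemma ip_weyl s (w x : P) : ip (weyl A s w) (weyl A s x) = ip w x.
Proof. by elim: s => // r s IH; rewrite !weyl_cons ip_refl. Qed.

Lemma ipDl (w x y : P) : ip (w + x) y = ip w y + ip x y.
Proof. by rewrite /ip ratwD form_ofDl. Qed.
Lemma ipDr (w x y : P) : ip y (w + x) = ip y w + ip y x.
Proof. by rewrite /ip ratwD form_ofDr. Qed.
Lemma ipNl (w x : P) : ip (- w) x = - ip w x.
Proof. by rewrite /ip ratwN form_ofNl. Qed.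
Lemma ipNr (w x : P) : ip w (- x) = - ip w x.
Proof. by rewrite /ip ratwN form_ofNr. Qed.
Lemma ipZl a (w x : P) : ip (a *: w) x = a%:~R * ip w x.
Proof. by rewrite /ip ratwZ form_ofZl. Qed.
Lemma ip_alpha_gt0 (r : I) : 0 < ip (alpha r) (alpha r).
Proof.
by have := form_short (simple_root_posroot r); apply: lt_le_trans.
Qed.

(** Since s_r negates alpha_r, invariance under s_r gives 2 (w, alpha_r) = w_r (alpha_r, alpha_r).
    This links the form, defined by way of the Killing form, to the coordinates of weights. *)
Lemma ip_alphaE (w : P) (r : I) :
  ip w (alpha r) = (w 0 r)%:~R * (ip (alpha r) (alpha r) / 2).
Proof.
have := ip_refl r w (alpha r).
rewrite {1}(simple_refl_root cA) /simple_refl ipNr ipDl ipNl ipZl; lra.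
Qed.

Lemma ip_fund_alpha (r : I) : ip (fund r) (alpha r) = ip (alpha r) (alpha r) / 2.
Proof. by rewrite ip_alphaE mxE !eqxx mul1r. Qed.

Lemma ip_eq0 (w : P) : (forall x, ip x w = 0) -> w = 0.
Proof.
move=> h; apply/rowP=> r; rewrite mxE; apply/eqP; rewrite -(intr_eq0 rat).
have := h (alpha r); rewrite ip_sym ip_alphaE => /eqP; rewrite mulf_eq0 => /orP[//|].
by rewrite gt_eqF // divr_gt0 ?ip_alpha_gt0.
Qed.

(** The letters of [s] are applied to alpha_r from the right. A letter r1 that first makes the image
    negative must meet it as alpha_{r1}; the word to its right then conjugates s_r into s_{r1}, so
    that r1 and the appended r cancel. *)
Lemma weyl_exchange (s : seq I) (r : I) : posQ (- weyl A s (alpha r)) ->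
  exists2 t, (size t < size s)%N & weyl A (rcons s r) =1 weyl A t.
Proof.
elim: s => [|r1 s IH] neg.
  have := in_posQ_anti cA (in_posQ_root A r) neg => /eqP.
  by rewrite (negPf (simple_root_neq0 cA r)).
have [pos|/IH[t st tE]] := root_sign cA s r; last first.
  exists (r1 :: t) => // x.
  by rewrite rcons_cons !weyl_cons tE.
have e : weyl A s (alpha r) = alpha r1.
  by apply: (simple_refl_pos cA) pos neg; exists s, r.
exists s => // x; rewrite rcons_cons weyl_cons weyl_rcons.
suff -> : weyl A s (simple_refl A r x) = simple_refl A r1 (weyl A s x).
  by rewrite (simple_reflK cA).
rewrite /simple_refl weylD weylN weylZ -/(alpha r) e; congr (_ - _ *: _).
have := ip_weyl s x (alpha r); rewrite e (ip_alphaE (weyl A s x)) (ip_alphaE x).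
have -> : ip (alpha r1) (alpha r1) = ip (alpha r) (alpha r) by rewrite -e ip_weyl.
have a0 := ip_alpha_gt0 r.
by move/(mulIf _) => h; apply: (@intr_inj rat); rewrite h // gt_eqF // divr_gt0.
Qed.

(** If w_0 alpha_r were positive, w_0 s_r would be reduced and longer than w_0: a word [t] for w_0
    s_r no longer than w_0 sends alpha_r to a negative root, so exchange yields a word for w_0
    shorter than [t], against reducedness. *)
Lemma w0_simple_root (r : I) : posQ (- w0 (alpha r)).
Proof.
have [pos|//] := root_sign cA (w0word g) r.
have [red max] := w0wordP g.
suff /max : reduced A (rcons (w0word g) r) by rewrite size_rcons ltnn.
move=> t tE; rewrite size_rcons leqNgt; apply/negP => st.
have [|t' st' t'E] := @weyl_exchange t r.
  by rewrite tE weyl_rcons (simple_refl_root cA) weylN opprK.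
have : weyl A t' =1 weyl A (w0word g).
  by move=> x; rewrite -t'E weyl_rcons tE weyl_rcons (simple_reflK cA).
move/red=> h; rewrite ltnS in st.
by have := leq_trans (leq_ltn_trans h st') st; rewrite ltnn.
Qed.

Lemma w0_posQ (x : P) : posQ x -> posQ (- w0 x).
Proof.
apply: (@in_posQ_sum _ A (fun y => - w0 y)).
- by rewrite /w0 weyl0 oppr0.
- by move=> u v; rewrite /w0 weylD opprD.
- by move=> a u; rewrite /w0 weylZ scalerN.
- exact: w0_simple_root.
Qed.

End LieDatumTheory.
(** * Unitary representations of U_q(k) *)

Section PzAlgTheory.
Variables (C : comPzRingType) (A : pzAlgType C).

Lemma scal0 : (0 : C)%:S = 0 :> A.
Proof. by apply: (@addrI _ (0 : C)%:S); rewrite -scalD !addr0. Qed.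

Lemma scalN (c : C) : (- c)%:S = - c%:S :> A.
Proof. by apply/eqP; rewrite -addr_eq0 -scalD addNr scal0. Qed.

Lemma scalAC (c : C) (x y : A) : x * (c%:S * y) = c%:S * (x * y).
Proof. by rewrite mulrA -scalC mulrA. Qed.

Lemma scalCA (c d : C) (x : A) : c%:S * (d%:S * x) = d%:S * (c%:S * x).
Proof. by rewrite !mulrA -!scalM mulrC. Qed.

Lemma scalMA (c d : C) (x : A) : c%:S * (d%:S * x) = (c * d)%:S * x.
Proof. by rewrite mulrA scalM. Qed.

End PzAlgTheory.

Section StarAlgTheory.
Variables (C : numClosedFieldType) (A : starAlgType C).

Lemma star0 : star (0 : A) = 0.
Proof. by apply: (@addrI _ (star (0 : A))); rewrite -starD !addr0. Qed.

Lemma starN (x : A) : star (- x) = - star x.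
Proof. by apply/eqP; rewrite -addr_eq0 -starD addNr star0. Qed.

End StarAlgTheory.

Section PresentedTheory.
Variables (C : numClosedFieldType) (G : Type).
Variable rel : sterm C G -> sterm C G -> Prop.
Implicit Types s t : sterm C G.

Lemma pclassD s t : pclass rel (TAdd s t) = pclass rel s + pclass rel t.
Proof. by rewrite -paddE. Qed.
Lemma pclassM s t : pclass rel (TMul s t) = pclass rel s * pclass rel t.
Proof. by rewrite -pmulE. Qed.
Lemma pclass_star s : pclass rel (TStar s) = star (pclass rel s).
Proof. by rewrite -pstarE. Qed.
Lemma pclass_scal c : pclass rel (TCst c) = c%:S.
Proof. by []. Qed.
Lemma pclassB s t :
  pclass rel (TAdd s (TMul (TCst (-1)) t)) = pclass rel s - pclass rel t.
Proof. by rewrite pclassD pclassM pclass_scal scalN scal1 mulN1r. Qed.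

Definition pclassE := (pclassB, pclassD, pclassM, pclass_star, pclass_scal).

Lemma pclass_rel s t : rel s t -> pclass rel s = pclass rel t.
Proof. by move=> st; apply/pclass_eq/sc_rel. Qed.

Lemma presented_ind (Q : presented rel -> Prop) :
  (forall g, Q (pgen rel g)) -> (forall g, Q (star (pgen rel g))) ->
  (forall c, Q c%:S) -> (forall x y, Q x -> Q y -> Q (x + y)) ->
  (forall x y, Q x -> Q y -> Q (x * y)) -> forall x, Q x.
Proof.
move=> Qg Qsg Qc QD QM; apply: pclassP => t.
suff [] : Q (pclass rel t) /\ Q (star (pclass rel t)) by [].
elim: t => [g|c|s [Qs Qs'] t [Qt Qt']|s [Qs Qs'] t [Qt Qt']|s [Qs Qs']].
- by split; [exact: Qg|exact: Qsg].
- by rewrite pclass_scal star_scal; split; exact: Qc.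
- by rewrite pclassD starD; split; apply: QD.
- by rewrite pclassM starM; split; apply: QM.
- by rewrite pclass_star starK.
Qed.

End PresentedTheory.

Section Dot.
Variable C : numClosedFieldType.
Implicit Types n : nat.

Definition adjmx m n (M : 'M[C]_(m, n)) : 'M[C]_(n, m) := (map_mx Num.conj M)^T.

Lemma adjmxM m n k (M : 'M[C]_(m, n)) (N : 'M_(n, k)) :
  adjmx (M *m N) = adjmx N *m adjmx M.
Proof. by rewrite /adjmx map_mxM trmx_mul. Qed.

Lemma adjmxK m n : cancel (@adjmx m n) (@adjmx n m).
Proof. by move=> M; apply/matrixP=> i j; rewrite !mxE conjCK. Qed.

End Dot.

Section Dot.
Variable R : realType.
Notation C := R[i].

Lemma dot_adjl m n (M : 'M[C]_(m, n)) (u : 'cV_m) (v : 'cV_n) :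
  dot (adjmx M *m u) v = dot u (M *m v).
Proof. by rewrite /dot -/(adjmx _) adjmxM adjmxK -mulmxA. Qed.

Variable n : nat.
Implicit Types u v w : 'cV[C]_n.

Lemma dotE u v : dot u v = \sum_i Num.conj (u i 0) * v i 0.
Proof. by rewrite /dot mxE; apply: eq_bigr => i _; rewrite !mxE. Qed.
Lemma dotDl u v w : dot (u + v) w = dot u w + dot v w.
Proof. by rewrite /dot map_mxD linearD /= mulmxDl mxE. Qed.
Lemma dotDr u v w : dot w (u + v) = dot w u + dot w v.
Proof. by rewrite /dot mulmxDr mxE. Qed.
Lemma dotZl a u v : dot (a *: u) v = Num.conj a * dot u v.
Proof. by rewrite /dot map_mxZ linearZ /= -scalemxAl mxE. Qed.
Lemma dotZr a u v : dot u (a *: v) = a * dot u v.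
Proof. by rewrite /dot -scalemxAr mxE. Qed.
Lemma dot0l u : dot 0 u = 0.
Proof. by rewrite -(scale0r u) dotZl rmorph0 mul0r. Qed.
Lemma dot0r u : dot u 0 = 0.
Proof. by rewrite -(scale0r u) dotZr mul0r. Qed.
Lemma dotNl u v : dot (- u) v = - dot u v.
Proof. by rewrite -scaleN1r dotZl rmorphN rmorph1 mulN1r. Qed.
Lemma dotNr u v : dot u (- v) = - dot u v.
Proof. by rewrite -scaleN1r dotZr mulN1r. Qed.
Lemma dot_suml I (s : seq I) (F : I -> 'cV[C]_n) v :
  dot (\sum_(i <- s) F i) v = \sum_(i <- s) dot (F i) v.
Proof. by apply: (big_morph (fun u => dot u v)); [move=> ? ?; rewrite dotDl|exact: dot0l]. Qed.
Lemma dot_sumr I (s : seq I) (F : I -> 'cV[C]_n) v :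
  dot v (\sum_(i <- s) F i) = \sum_(i <- s) dot v (F i).
Proof. by apply: (big_morph (dot v)); [move=> ? ?; rewrite dotDr|exact: dot0r]. Qed.
Lemma dot_delta_l i v : dot (delta_mx i 0) v = v i 0.
Proof.
rewrite dotE (bigD1 i) //= big1 ?addr0 => [|j ji]; rewrite !mxE ?eqxx.
  by rewrite rmorph1 mul1r.
by rewrite (negPf ji) rmorph0 mul0r.
Qed.
Lemma dot_eq0 u : dot u u = 0 -> u = 0.
Proof.
move/eqP; rewrite dotE psumr_eq0 => [/allP h|i _]; last by rewrite mulrC -normCK exprn_ge0.
apply/colP=> i; rewrite mxE; have := h i (mem_index_enum i).
by rewrite /= mulf_eq0 fmorph_eq0 orbb => /eqP.
Qed.
Lemma dot_ext u v : (forall w, dot w u = dot w v) -> u = v.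
Proof. by move=> h; apply/colP=> i; rewrite -!dot_delta_l h. Qed.
Lemma cV_sum_delta v : v = \sum_i v i 0 *: delta_mx i 0.
Proof.
apply/colP=> j; rewrite summxE (bigD1 j) //= big1 ?addr0 => [|i ij]; rewrite !mxE ?eqxx.
  by rewrite mulr1.
by rewrite eq_sym (negPf ij) mulr0.
Qed.

End Dot.

(** * Projections and spans in C^d *)

Section Subspace.
Variables (R : realType) (n : nat).
Notation C := R[i].

(** The orthogonal projection of [u] onto [N]. A subspace being a mere predicate, its basis is a
    matrix [B] of maximal rank with columns in [N]; the projection is then given by the inverse of
    the Gram matrix of [B]. *)
Lemma riesz_proj (N : 'cV[C]_n -> Prop) u : N 0 ->
  (forall v w, N v -> N w -> N (v + w)) -> (forall a v, N v -> N (a *: v)) ->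
  exists2 u', N u' & forall v, N v -> dot u' v = dot u v.
Proof.
move=> N0 ND NZ.
have Nsum m (F : 'I_m -> 'cV[C]_n) : (forall i, N (F i)) -> N (\sum_i F i).
  by move=> NF; elim/big_ind: _.
pose Q k := `[< exists2 B : 'M[C]_(n, k), (forall i, N (col i B)) & \rank B = k >].
have Q0 : exists k, Q k.
  by exists 0%N; apply/asboolP; exists 0; [case=> []|exact: mxrank0].
have Qn k : Q k -> (k <= n)%N.
  by move=> /asboolP[B _ <-]; rewrite rank_leq_row.
case: (ex_maxnP Q0 Qn) => k /asboolP[B NB rB] kmax.
have NBx (x : 'cV[C]_k) : N (B *m x).
  have -> : B *m x = \sum_i x i 0 *: col i B.
    apply/colP=> i; rewrite !mxE summxE; apply: eq_bigr => j _.
    by rewrite !mxE mulrC.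
  by apply: Nsum => i; apply: NZ.
have NB' v : N v -> exists x, v = B *m x.
  move=> Nv; have [/submxP[D vD]|nv] := boolP (v^T <= B^T)%MS.
    by exists D^T; rewrite -[v]trmxK vD trmx_mul trmxK.
  suff /kmax : Q (k + 1)%N by rewrite addn1 ltnn.
  apply/asboolP; exists (row_mx B v).
    move=> i; case: (splitP i) => j ij.
      have -> : i = lshift 1 j by apply: val_inj.
      by rewrite colKl.
    have -> : i = rshift k j by apply: val_inj.
    by rewrite colKr col_id.
  rewrite -mxrank_tr tr_row_mx -addsmxE; apply/eqP; rewrite eqn_leq.
  rewrite (leq_trans (mxrank_adds_leqif _ _)) /=; last first.
    by rewrite !mxrank_tr rB leq_add2l rank_leq_col.
  rewrite addn1 -[X in (X < _)%N]rB -[X in (X < _)%N]mxrank_tr ltn_neqAle.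
  rewrite (mxrankS (addsmxSl _ _)) andbT; apply: contra nv => /eqP e.
  have : (B^T + v^T <= B^T)%MS by rewrite -mxrank_leqif_sup ?addsmxSl // e.
  by apply: submx_trans; exact: addsmxSr.
pose G := adjmx B *m B.
have Gu : G \in unitmx.
  rewrite -unitmx_tr -row_free_unit; apply: inj_row_free => x xG.
  have Gx : G *m x^T = 0 by rewrite -[G]trmxK -trmx_mul xG trmx0.
  have : dot (B *m x^T) (B *m x^T) = 0.
    rewrite -dot_adjl mulmxA -/G; by rewrite Gx dot0l.
  move/dot_eq0 => Bx.
  have fB : row_free B^T by rewrite /row_free mxrank_tr rB.
  apply: (row_free_inj fB); rewrite mul0mx.
  by rewrite -[x]trmxK -trmx_mul Bx trmx0.
exists (B *m (invmx G *m (adjmx B *m u))) => [|v Nv]; first exact: NBx.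
have [x ->] := NB' v Nv.
rewrite -[LHS]dot_adjl -[RHS]dot_adjl; congr (dot _ _).
by rewrite mulmxA -/G mulKVmx.
Qed.

Inductive lspan (S : 'cV[C]_n -> Prop) : 'cV[C]_n -> Prop :=
| lspan0 : lspan S 0
| lspanS a u v : S u -> lspan S v -> lspan S (a *: u + v).

Lemma lspan_gen S u : S u -> lspan S u.
Proof. by move=> Su; rewrite -[u]addr0 -[u]scale1r; apply: lspanS Su (lspan0 S). Qed.
Lemma lspanD S u v : lspan S u -> lspan S v -> lspan S (u + v).
Proof.
by move=> + Sv; elim=> [|a x y Sx _ IH]; rewrite ?add0r // -addrA; apply: lspanS.
Qed.
Lemma lspanZ S a u : lspan S u -> lspan S (a *: u).
Proof.
elim=> [|b x y Sx _ IH]; first by rewrite scaler0; exact: lspan0.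
by rewrite scalerDr scalerA; apply: lspanS.
Qed.
Lemma lspan_mx (S : 'cV[C]_n -> Prop) (M : 'M[C]_n) u :
  (forall v, S v -> lspan S (M *m v)) -> lspan S u -> lspan S (M *m u).
Proof.
move=> h; elim=> [|b x y Sx _ IH]; first by rewrite mulmx0; exact: lspan0.
by rewrite mulmxDr -scalemxAr; apply: lspanD IH; apply: lspanZ; apply: h.
Qed.

End Subspace.
Section QPow.
Variables (R : realType) (q : R).
Hypothesis hq : 0 < q < 1.
Notation C := R[i].

Lemma qpow0 : qpow q 0 = 1.
Proof. by rewrite /qpow /toC rmorph0 powRr0 rmorph1. Qed.
Lemma qpowD x y : qpow q (x + y) = qpow q x * qpow q y.
Proof.
rewrite /qpow /toC rmorphD powRD ?rmorphM //.
by apply/implyP=> _; rewrite gt_eqF //; case/andP: hq.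
Qed.
Lemma qpowNM x : qpow q (- x) * qpow q x = 1.
Proof. by rewrite -qpowD addNr qpow0. Qed.
Lemma qpow_neq0 x : qpow q x != 0.
Proof.
by apply/eqP=> e; have /eqP := qpowNM x; rewrite e mulr0 eq_sym oner_eq0.
Qed.
Lemma qpowN x : qpow q (- x) = (qpow q x)^-1.
Proof. by rewrite -[LHS]mulr1 -(mulfV (qpow_neq0 x)) mulrA qpowNM mul1r. Qed.
Lemma qpow_conj x : Num.conj (qpow q x) = qpow q x.
Proof. by apply/CrealP; rewrite /qpow /toC complex_real. Qed.
Lemma qpow_inj : injective (qpow q).
Proof.
move=> x y; rewrite /qpow /toC => /complexI /(congr1 (@ln R)).
have lnq : ln q != 0 by rewrite lt_eqF // ln_lt0.
by rewrite !ln_powR => /(mulIf lnq)/fmorph_inj.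
Qed.
Lemma qpowM x k : qpow q (k%:R * x) = qpow q x ^+ k.
Proof.
elim: k => [|k IH]; first by rewrite mul0r qpow0.
by rewrite -natr1 mulrDl mul1r qpowD IH exprSr.
Qed.
Lemma qpow_expr_neq1 x k : x != 0 -> qpow q x ^+ k.+1 != 1.
Proof.
move=> x0; rewrite -qpowM -qpow0; apply: contra x0 => /eqP/qpow_inj/eqP.
by rewrite mulf_eq0 pnatr_eq0.
Qed.

End QPow.

Section UqkRelations.
Variables (R : realType) (q : R) (g : lie_datum).
Hypothesis hq : 0 < q < 1.
Notation C := R[i].
Notation P := (wt g).
Notation I := (node g).
Notation U := (Uqk q g).
Notation KU := (@KU R q g).
Notation EU := (@EU R q g).
Notation FU := (@FU R q g).

Lemma KU0 : KU 0 = 1.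
Proof. exact: pclass_rel (U_K0 _ _). Qed.
Lemma KUD w x : KU (w + x) = KU w * KU x.
Proof. by have := pclass_rel (U_KK q w x); rewrite !pclassE. Qed.
Lemma KUE w r : KU w * EU r = (qpow q (ip w (alpha r)))%:S * (EU r * KU w).
Proof. by have := pclass_rel (U_KE q w r); rewrite !pclassE. Qed.
Lemma KUF w r : KU w * FU r = (qpow q (- ip w (alpha r)))%:S * (FU r * KU w).
Proof. by have := pclass_rel (U_KF q w r); rewrite !pclassE. Qed.
Lemma EUF r s : EU r * FU s - FU s * EU r =
  (ef_coef q r s)%:S * (KU (alpha r) - KU (- alpha r)).
Proof. by have := pclass_rel (U_EF q r s); rewrite !pclassE. Qed.
Lemma KU_star w : star (KU w) = KU w.
Proof. by have := pclass_rel (U_Kstar q w); rewrite !pclassE. Qed.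
Lemma EU_star r : star (EU r) = FU r * KU (alpha r).
Proof. by have := pclass_rel (U_Estar q r); rewrite !pclassE. Qed.
Lemma KUN w : KU (- w) * KU w = 1.
Proof. by rewrite -KUD addNr KU0. Qed.
Lemma KUVN w : KU w * KU (- w) = 1.
Proof. by rewrite -KUD addrN KU0. Qed.
Lemma FU_star r : star (FU r) = KU (- alpha r) * EU r.
Proof.
have -> : FU r = star (EU r) * KU (- alpha r).
  by rewrite EU_star -mulrA KUVN mulr1.
by rewrite starM starK KU_star.
Qed.

End UqkRelations.

(** * Weight vectors and highest weight vectors in unitary representations *)

Section UnitaryRep.
Variables (R : realType) (q : R) (g : lie_datum).
Hypothesis hq : 0 < q < 1.
Notation C := R[i].
Notation P := (wt g).
Notation I := (node g).
Notation U := (Uqk q g).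
Notation KU := (@KU R q g).
Notation EU := (@EU R q g).
Notation FU := (@FU R q g).

(** In contrast to [hwrep], neither irreducibility nor a highest weight is part of the data, so
    direct sums are again of this kind. *)
Record urep := URep {
  udim : nat;
  uact : U -> 'M[C]_udim;
  uactD : {morph uact : x y / x + y};
  uactM : forall x y, uact (x * y) = uact x *m uact y;
  uact_scal : forall c : C, uact c%:S = c%:M;
  uact_star : forall x, uact (star x) = adjmx (uact x)
}.

Definition urep_of (w : P) (V : hwrep q w) : urep :=
  URep (@hactD _ _ _ _ V) (@hactM _ _ _ _ V) (@hact_scal _ _ _ _ V)
    (@hact_star _ _ _ _ V).

Section OneRep.
Variable V : urep.
Notation act := (uact V).
Notation vec := 'cV[C]_(udim V).
Implicit Types u v : vec.

Lemma uact0 : act 0 = 0.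
Proof. by apply: (@addrI _ (act 0)); rewrite -uactD !addr0. Qed.
Lemma uactN x : act (- x) = - act x.
Proof. by apply/eqP; rewrite -addr_eq0 -uactD addNr uact0. Qed.
Lemma uactB x y : act (x - y) = act x - act y.
Proof. by rewrite uactD uactN. Qed.
Lemma uact1 : act 1 = 1%:M.
Proof. by rewrite -(@scal1 C U) uact_scal. Qed.
Lemma uactZ c x : act (c%:S * x) = c *: act x.
Proof. by rewrite uactM uact_scal mul_scalar_mx. Qed.
Lemma uactMv x y u : act (x * y) *m u = act x *m (act y *m u).
Proof. by rewrite uactM mulmxA. Qed.
Lemma uactDv x y u : act (x + y) *m u = act x *m u + act y *m u.
Proof. by rewrite uactD mulmxDl. Qed.
Lemma uactBv x y u : act (x - y) *m u = act x *m u - act y *m u.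
Proof. by rewrite uactB mulmxBl. Qed.
Lemma uactZv c x u : act (c%:S * x) *m u = c *: (act x *m u).
Proof. by rewrite uactZ scalemxAl. Qed.
Lemma dot_star x u v : dot (act (star x) *m u) v = dot u (act x *m v).
Proof. by rewrite uact_star dot_adjl. Qed.
Lemma dot_starr x u v : dot u (act (star x) *m v) = dot (act x *m u) v.
Proof. by rewrite -dot_star starK. Qed.

Definition uwt u (m : P) : Prop := forall x, act (KU x) *m u = qpow q (ip x m) *: u.

Lemma uwt_E r u m : uwt u m -> uwt (act (EU r) *m u) (m + alpha r).
Proof.
move=> h x; rewrite -uactMv (KUE q x r) uactZv uactMv h -scalemxAr scalerA.
by rewrite ipDr addrC qpowD.
Qed.
Lemma uwt_F r u m : uwt u m -> uwt (act (FU r) *m u) (m - alpha r).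
Proof.
move=> h x; rewrite -uactMv (KUF q x r) uactZv uactMv h -scalemxAr scalerA.
by rewrite ipDr ipNr addrC qpowD.
Qed.
Lemma uwt_Z a u m : uwt u m -> uwt (a *: u) m.
Proof. by move=> h x; rewrite -scalemxAr h scalerA mulrC -scalerA. Qed.
Lemma uwt_D u v m : uwt u m -> uwt v m -> uwt (u + v) m.
Proof. by move=> h h' x; rewrite mulmxDr h h' scalerDr. Qed.
Lemma uwt_0 m : uwt 0 m.
Proof. by move=> x; rewrite mulmx0 scaler0. Qed.
Lemma uwt_K x u m : uwt u m -> uwt (act (KU x) *m u) m.
Proof. by move=> h; rewrite h; apply: uwt_Z. Qed.
Lemma uwt_G r u m : uwt u m -> uwt (act (star (EU r)) *m u) (m - alpha r).
Proof. by move=> h; rewrite EU_star uactMv; apply/uwt_F/uwt_K. Qed.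

(** The K_x are self-adjoint with real eigenvalues, and q^(x, m) for all x determines m because the
    form is nondegenerate. *)
Lemma uwt_orth u v m m' : uwt u m -> uwt v m' -> m != m' -> dot u v = 0.
Proof.
move=> um vm mm'; apply/eqP; apply: contraNT mm' => uv.
rewrite -subr_eq0; apply/eqP/(@ip_eq0 g) => x.
have := dot_star (KU x) u v; rewrite KU_star um vm dotZl dotZr qpow_conj.
move/(mulIf uv)/(qpow_inj hq) => e.
by rewrite ipDr ipNr e subrr.
Qed.

(** Words in the adjoints of the E_r rather than in the F_r: across the inner product the first
    letter becomes E_r, so every nonempty word on a highest weight vector is orthogonal to that
    vector. *)
Definition gword (s : seq I) u : vec := foldr (fun r v => act (star (EU r)) *m v) u s.
Definition gwords u : vec -> Prop := lspan (fun v => exists s, v = gword s u).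
Definition wsum (s : seq I) : P := \sum_(r <- s) alpha r.

Lemma wsum_posQ s : in_posQ (cartan g) (wsum s).
Proof.
rewrite /wsum; elim/big_rec: _ => [|r y _ yQ]; first exact: in_posQ0.
by apply: in_posQD yQ; exact: in_posQ_root.
Qed.

Lemma uwt_gword s u m : uwt u m -> uwt (gword s u) (m - wsum s).
Proof.
elim: s => [|r s IH] um; first by rewrite /wsum big_nil subr0.
rewrite /wsum big_cons opprD addrCA [X in uwt _ X]addrC.
exact: uwt_G (IH um).
Qed.

Definition uhw u (m : P) : Prop := uwt u m /\ forall r, act (EU r) *m u = 0.

Lemma EUG r t : EU t * star (EU r) =
  (qpow q (- ip (alpha r) (alpha t)))%:S * (star (EU r) * EU t)
  + (ef_coef q t r)%:S * ((KU (alpha t) - KU (- alpha t)) * KU (alpha r)).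
Proof.
have -> : star (EU r) * EU t =
    (qpow q (ip (alpha r) (alpha t)))%:S * (FU r * EU t * KU (alpha r)).
  by rewrite EU_star -!mulrA KUE scalAC.
rewrite scalMA qpowNM // scal1 mul1r EU_star.
by rewrite [RHS]addrC !mulrA -mulrDl -EUF subrK.
Qed.

(** Only E_t needs an argument: [EUG] moves it to the right through a word until it reaches [u],
    leaving shorter words multiplied by weight operators. *)
Lemma gwords_stable u m x v : uhw u m -> gwords u v -> gwords u (act x *m v).
Proof.
move=> [um ue].
have GK w v' : gwords u v' -> gwords u (act (KU w) *m v').
  apply: lspan_mx => _ [s ->]; rewrite (uwt_gword s um).
  by apply/lspanZ/lspan_gen; exists s.
have GG r v' : gwords u v' -> gwords u (act (star (EU r)) *m v').
  by apply: lspan_mx => _ [s ->]; apply: lspan_gen; exists (r :: s).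
have GE r v' : gwords u v' -> gwords u (act (EU r) *m v').
  apply: lspan_mx => _ [s ->]; elim: s => [|t s IH].
    by rewrite ue; exact: lspan0.
  rewrite /= -uactMv EUG uactDv !uactZv !uactMv uactBv.
  apply: lspanD; apply: lspanZ; first exact: GG.
  have h w : gwords u (act (KU w) *m (act (KU (alpha t)) *m gword s u)).
    by apply/GK/GK/lspan_gen; exists s.
  by rewrite -scaleN1r; apply: lspanD; [|apply: lspanZ]; apply: h.
have GF r v' : gwords u v' -> gwords u (act (FU r) *m v').
  have -> : FU r = star (EU r) * KU (- alpha r).
    by rewrite EU_star -mulrA KUVN mulr1.
  by move=> h; rewrite uactMv; apply/GG/GK.
elim/presented_ind: x v => [[w|r|r]|[w|r|r]|c|x y IHx IHy|x y IHx IHy] v h.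
- exact: GK.
- exact: GE.
- exact: GF.
- by rewrite -/(KU w) KU_star; apply: GK.
- exact: GG.
- by rewrite -/(FU r) FU_star uactMv; apply/GK/GE.
- by rewrite uact_scal mul_scalar_mx; apply: lspanZ.
- by rewrite uactDv; apply: lspanD; [apply: IHx|apply: IHy].
- by rewrite uactMv; apply/IHx/IHy.
Qed.

Lemma dot_gword_cons r s u m : uhw u m -> dot u (gword (r :: s) u) = 0.
Proof. by move=> [_ ue]; rewrite /= dot_starr ue dot0l. Qed.

End OneRep.
End UnitaryRep.

(* The sl2-string through [v]: from its top E^k v, of weight N = m + 2k, the
   vectors F^i E^k v do not vanish for i <= N. *)
Section Sl2.
Variables (C : numClosedFieldType) (n : nat) (E F K K' : 'M[C]_n) (a : C).
Hypothesis a0 : a != 0.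
Hypothesis a_root : forall k, a ^+ k.+1 != 1.
Hypothesis KE : K *m E = a ^+ 2 *: (E *m K).
Hypothesis KF : K *m F = a ^- 2 *: (F *m K).
Hypothesis KK' : K' *m K = 1%:M.
Hypothesis EF : E *m F - F *m E = (a - a^-1)^-1 *: (K - K').
Notation mpow M k v := (iter k (mulmx M) v).

Lemma sl2_ad : a - a^-1 != 0.
Proof.
rewrite subr_eq0; apply: contra (a_root 1) => /eqP e.
by rewrite expr2 {2}e mulfV.
Qed.

Lemma sl2_inv (v : 'cV[C]_n) b : b != 0 -> K *m v = b *: v -> K' *m v = b^-1 *: v.
Proof.
move=> b0 Kv; rewrite -[v in LHS]scale1r -(mulVf b0) -scalerA -scalemxAr -Kv.
by rewrite mulmxA KK' mul1mx.
Qed.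

Lemma sl2_K_E (v : 'cV[C]_n) b k : K *m v = b *: v ->
  K *m mpow E k v = (a ^+ (2 * k) * b) *: mpow E k v.
Proof.
move=> Kv; elim: k => [|k IH]; first by rewrite mul1r.
rewrite iterS mulmxA KE -scalemxAl -mulmxA IH -scalemxAr scalerA.
by rewrite mulnS exprD mulrA.
Qed.

Lemma sl2_K_F (v : 'cV[C]_n) b k : K *m v = b *: v ->
  K *m mpow F k v = (a ^- (2 * k) * b) *: mpow F k v.
Proof.
move=> Kv; elim: k => [|k IH]; first by rewrite invr1 mul1r.
rewrite iterS mulmxA KF -scalemxAl -mulmxA IH -scalemxAr scalerA.
by rewrite mulnS exprD [in RHS]invfM -mulrA.
Qed.

(** Otherwise the E^k v for k <= n would be n + 1 eigenvectors of K with pairwise distinct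
    eigenvalues a^(2k) b. *)
Lemma sl2_nilpotent (v : 'cV[C]_n) b : b != 0 -> K *m v = b *: v ->
  exists k, mpow E k v == 0.
Proof.
move=> b0 Kv; apply: contrapT => h.
have nz k : mpow E k v != 0 by apply/negP=> e; apply: h; exists k.
pose rs := [seq a ^+ (2 * k) * b | k <- iota 0 n.+1].
have urs : uniq rs.
  rewrite map_inj_uniq ?iota_uniq // => i j /(mulIf b0).
  wlog ij : i j / (i <= j)%N.
    by move=> w; case/orP: (leq_total i j) => ij e; [|symmetry]; apply: w.
  rewrite -(subnK ij) mulnDr exprD -{1}[_ ^+ (2 * i)]mul1r.
  move/(mulIf (expf_neq0 _ a0)) => e.
  case: (j - i)%N e => [|k] //; rewrite mulnS => /esym/eqP.
  by rewrite (negPf (a_root _)).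
have prs : all (root (char_poly K^T)) rs.
  apply/allP=> _ /mapP[k _ ->]; rewrite -eigenvalue_root_char.
  apply/eigenvalueP; exists (mpow E k v)^T.
    by rewrite -trmx_mul (sl2_K_E _ Kv) linearZ.
  by apply: contraNneq (nz k) => /(congr1 trmx); rewrite trmxK trmx0 => ->.
have := max_poly_roots (monic_neq0 (char_poly_monic K^T)) prs urs.
by rewrite size_map size_iota size_char_poly ltnn.
Qed.

Lemma sl2_reflect (v : 'cV[C]_n) m : v != 0 -> K *m v = a ^+ m *: v ->
  exists k, mpow F (m + k) (mpow E k v) != 0.
Proof.
move=> v0 Kv.
have [|k0 /eqP k0E k0min] := ex_minnP (@sl2_nilpotent v _ _ Kv).
  by rewrite expf_neq0.
case: k0 => [|k] in k0E k0min; first by move: v0; rewrite -[v]/(mpow E 0 v) k0E eqxx.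
have u0 : mpow E k v != 0 by apply/negP=> /k0min; rewrite ltnn.
exists k; set u := mpow E k v in u0 *.
have Eu : E *m u = 0 by [].
pose N := (m + 2 * k)%N.
have Ku : K *m u = a ^+ N *: u by rewrite (sl2_K_E _ Kv) -exprD addnC.
(* The product of quantum integers [i+1]_a [N-i]_a, nonzero for i < N since a is not a root of
   unity. *)
pose c i : C := (a ^+ i.+1 - a ^- i.+1) * (a ^+ N / a ^+ i - a ^+ i / a ^+ N)
  / (a - a^-1) ^+ 2.
have EFu i : E *m mpow F i.+1 u = c i *: mpow F i u.
  have stepE j : E *m mpow F j.+1 u = F *m (E *m mpow F j u)
      + ((a - a^-1)^-1 * (a ^- (2 * j) * a ^+ N - (a ^- (2 * j) * a ^+ N)^-1))
        *: mpow F j u.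
    rewrite iterS mulmxA -[E *m F](subrK (F *m E)) EF mulmxDl addrC -mulmxA.
    congr (_ + _); rewrite -scalemxAl mulmxBl (sl2_K_F _ Ku).
    rewrite (sl2_inv _ (sl2_K_F _ Ku)) ?mulf_neq0 ?invr_eq0 ?expf_neq0 //.
    by rewrite -scalerBl scalerA.
  elim: i => [|i IH]; rewrite stepE.
    rewrite /= Eu mulmx0 add0r; congr (_ *: _); rewrite /c muln0 !expr0 expr1.
    have ad' : a ^+ 2 - 1 != 0 by rewrite subr_eq0; exact: a_root.
    by field; rewrite a0 ad' expf_neq0.
  rewrite IH -scalemxAr -iterS -scalerDl; congr (_ *: _); rewrite /c.
  have := sl2_ad; set x := a ^+ i.+1; set y := a ^+ N.
  have x0 : x != 0 by rewrite expf_neq0.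
  have y0 : y != 0 by rewrite expf_neq0.
  have -> : a ^+ i = x / a by rewrite /x exprSr mulfK.
  have -> : a ^+ i.+2 = a * x by rewrite exprS.
  have -> : a ^+ (2 * i.+1) = x ^+ 2 by rewrite mulnC exprM.
  move=> ad; have ad' : a ^+ 2 - 1 != 0.
    by rewrite subr_eq0; exact: a_root.
  by field; rewrite a0 x0 y0 ad'.
have cn i : (i < N)%N -> c i != 0.
  move=> iN; rewrite /c !mulf_neq0 ?invr_eq0 ?expf_neq0 ?sl2_ad //.
    rewrite subr_eq0; apply: contra (a_root (i + i).+1) => /eqP e.
    by rewrite -addnS -addSn exprD {2}e mulfV // expf_neq0.
  rewrite subr_eq0 eqr_div ?expf_neq0 // -!exprD.
  apply: contra (a_root (2 * (N - i)).-1) => /eqP e.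
  have -> : (2 * (N - i)).-1.+1 = (N + N - (i + i))%N by lia.
  apply/eqP/(mulIf (expf_neq0 (i + i) a0)); rewrite mul1r -exprD subnK ?e //.
  lia.
suff h i : (i <= N)%N -> mpow F i u != 0 by apply: h; rewrite /N; lia.
elim: i => [//|i IH] iN; apply: contra (IH (ltnW iN)) => /eqP e.
have := EFu i; rewrite e mulmx0 => /esym/eqP.
by rewrite scaler_eq0 (negPf (cn _ iN)).
Qed.

End Sl2.

(** * The weights of V_varpi *)

Section HwRep.
Variables (R : realType) (q : R) (g : lie_datum).
Hypothesis hq : 0 < q < 1.
Notation C := R[i].
Notation P := (wt g).
Notation I := (node g).
Notation posQ := (in_posQ (cartan g)).
Variables (m : P) (V : hwrep q m).
Notation vec := 'cV[C]_(hdim V).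
Let W : urep q g := urep_of V.
Notation gword s := (@gword R q g W s).

Lemma hvec_uhw : @uhw R q g W (hvec V) m.
Proof. by split; [exact: hvec_wt|exact: hvec_hw]. Qed.

Lemma hwrep_span (v : vec) : @gwords R q g W (hvec V) v.
Proof.
have N0 : @gwords R q g W (hvec V) 0 by exact: lspan0.
pose Q := @gwords R q g W (hvec V).
have ND u w : Q u -> Q w -> Q (u + w) by apply: lspanD.
have NZ c u : Q u -> Q (c *: u) by apply: lspanZ.
have NU x u : Q u -> Q (hact V x *m u) by exact: (gwords_stable hq _ hvec_uhw).
have [h|//] := hirr N0 ND NZ NU.
have : Q (hvec V) by apply: lspan_gen; exists [::].
move/h => e; have := hvec_unit V; rewrite e dot0l => /eqP.
by rewrite eq_sym oner_eq0.
Qed.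

Lemma dot_gwords_ext (u v : vec) :
  (forall s, dot (gword s (hvec V)) u = dot (gword s (hvec V)) v) -> u = v.
Proof.
move=> h; apply: dot_ext => w; elim: (hwrep_span w) => [|a x y [s ->] _ IH].
  by rewrite !dot0l.
by rewrite !dotDl !dotZl h IH.
Qed.

(** A vector of any other weight is orthogonal to all words applied to the highest weight vector,
    and by irreducibility these span. *)
Lemma hwrep_wt_posQ (u : vec) l : u != 0 -> @uwt R q g W u l -> posQ (m - l).
Proof.
move=> u0 ul; apply: contrapT => np; move/eqP: u0; apply.
apply: dot_gwords_ext => s; rewrite dot0r.
apply: (uwt_orth hq (uwt_gword hq s (proj1 hvec_uhw)) ul).
apply/eqP=> e; apply: np; rewrite -e opprB addrCA subrr addr0.
exact: wsum_posQ.
Qed.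

Lemma qr_qpow (r : I) : toC (qr q r) = qpow q (ip (alpha r) (alpha r) / 2).
Proof. by []. Qed.

Lemma hwrep_wt_refl (r : I) (u : vec) l : u != 0 -> @uwt R q g W u l ->
  exists2 u' : vec, u' != 0 & @uwt R q g W u' (simple_refl (cartan g) r l).
Proof.
move=> u0 ul.
pose a := toC (qr q r).
pose E := uact W (EU q r); pose F := uact W (FU q r).
pose K := uact W (KU q (alpha r)); pose K' := uact W (KU q (- alpha r)).
have aa : ip (alpha r) (alpha r) / 2 != 0.
  by rewrite gt_eqF // divr_gt0 // ip_alpha_gt0.
have a0 : a != 0 by rewrite /a qr_qpow (qpow_neq0 hq).
have ar k : a ^+ k.+1 != 1 by rewrite /a qr_qpow (qpow_expr_neq1 hq).
have a2 : a ^+ 2 = qpow q (ip (alpha r) (alpha r)).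
  by rewrite /a qr_qpow -(qpowM hq) mulrC divfK.
have a2' : a ^- 2 = qpow q (- ip (alpha r) (alpha r)) by rewrite a2 (qpowN hq).
have KE : K *m E = a ^+ 2 *: (E *m K).
  by rewrite -!uactM KUE uactZ a2.
have KF : K *m F = a ^- 2 *: (F *m K).
  by rewrite -!uactM KUF uactZ a2'.
have K'E : K' *m E = a ^- 2 *: (E *m K').
  by rewrite -!uactM KUE uactZ ipNl a2'.
have K'F : K' *m F = a ^+ 2 *: (F *m K').
  by rewrite -!uactM KUF uactZ ipNl opprK a2.
have KK' : K *m K' = 1%:M by rewrite -uactM KUVN uact1.
have K'K : K' *m K = 1%:M by rewrite -uactM KUN uact1.
have ef : (ef_coef q r r) = (a - a^-1)^-1.
  by rewrite /ef_coef eqxx div1r /toC fmorphV rmorphB fmorphV.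
have EF : E *m F - F *m E = (a - a^-1)^-1 *: (K - K').
  by rewrite -!uactM -uactB EUF uactZ uactB ef.
have FE : F *m E - E *m F = (a - a^-1)^-1 *: (K' - K).
  by rewrite -opprB EF -scalerN opprB.
have Kl : K *m u = qpow q ((l 0 r)%:~R * (ip (alpha r) (alpha r) / 2)) *: u.
  by rewrite ul ip_sym ip_alphaE.
have K'l : K' *m u = qpow q (- ((l 0 r)%:~R * (ip (alpha r) (alpha r) / 2))) *: u.
  by rewrite ul ipNl ip_sym ip_alphaE.
have wE k (v : vec) l' : @uwt R q g W v l' ->
    @uwt R q g W (iter k (mulmx E) v) (l' + k%:Z *: alpha r).
  move=> vl; elim: k => [|k IH]; first by rewrite scale0r addr0.
  by rewrite iterS -[k.+1]addn1 PoszD scalerDl scale1r addrA; exact: uwt_E.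
have wF k (v : vec) l' : @uwt R q g W v l' ->
    @uwt R q g W (iter k (mulmx F) v) (l' - k%:Z *: alpha r).
  move=> vl; elim: k => [|k IH]; first by rewrite scale0r subr0.
  by rewrite iterS -[k.+1]addn1 PoszD scalerDl scale1r opprD addrA; exact: uwt_F.
rewrite /simple_refl -/(alpha r).
case: (l 0 r) Kl K'l => k Kl K'l.
  have [|j nz] := sl2_reflect a0 ar KE KF K'K EF u0 (m := k).
    by rewrite Kl (qpowM hq).
  exists (iter (k + j) (mulmx F) (iter j (mulmx E) u)) => //.
  have := wF (k + j)%N _ _ (wE j _ _ ul); congr (uwt _ _).
  by apply/rowP=> t; rewrite PoszD !mxE; ring.
(* The negative case, l_r = -(k+1): the sl2 relations are preserved, with the same a, when E and F
   as well as K and its inverse are exchanged. *)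
have [|j nz] := sl2_reflect a0 ar K'F K'E KK' FE u0 (m := k.+1).
  by rewrite K'l NegzE mulNr opprK (qpowM hq).
exists (iter (k.+1 + j) (mulmx E) (iter j (mulmx F) u)) => //.
have := wE (k.+1 + j)%N _ _ (wF j _ _ ul); congr (uwt _ _).
by apply/rowP=> t; rewrite PoszD NegzE !mxE; ring.
Qed.

Lemma hwrep_wt_weyl s (u : vec) l : u != 0 -> @uwt R q g W u l ->
  exists2 u' : vec, u' != 0 & @uwt R q g W u' (weyl (cartan g) s l).
Proof.
move=> u0 ul; elim: s => [|r s [v v0 vl]]; first by exists u.
exact: hwrep_wt_refl v0 vl.
Qed.

(** The inverse of w_0 maps l to another weight, which lies below m; applying w_0 reverses the
    order. *)
Lemma hwrep_lowest (u : vec) l : u != 0 -> @uwt R q g W u l -> posQ (l - w0 m).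
Proof.
move=> u0 ul; have [v v0 vl] := hwrep_wt_weyl (rev (w0word g)) u0 ul.
have := w0_posQ (hwrep_wt_posQ v0 vl).
rewrite /w0 weylD weylN weyl_revK ?opprB //; exact: cartanP.
Qed.

End HwRep.
(** * Commutation relations in Pol_q(K) *)

Section TensTheory.
Variables (C : numClosedFieldType) (A B : pzAlgType C).

Lemma tlift_sum (V : zmodType) (J : Type) (r : seq J) (f : J -> A -> B -> V) (t : tens A B) :
  \sum_(j <- r) tlift (f j) t = tlift (fun a b => \sum_(j <- r) f j a b) t.
Proof. by rewrite /tlift exchange_big. Qed.

Lemma tlift_morph (V W : zmodType) (phi : V -> W) (f : A -> B -> V) (t : tens A B) :
  phi 0 = 0 -> {morph phi : x y / x + y} ->
  phi (tlift f t) = tlift (fun a b => phi (f a b)) t.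
Proof. by move=> p0 pD; rewrite /tlift (big_morph phi pD p0). Qed.

Lemma eq_tlift (V : zmodType) (f h : A -> B -> V) (t : tens A B) :
  (forall a b, f a b = h a b) -> tlift f t = tlift h t.
Proof. by move=> fh; apply: eq_bigr => p _. Qed.

Variables (V : zmodType) (f : A -> B -> V).
Hypothesis flD : forall b, {morph f^~ b : a a' / a + a'}.
Hypothesis frD : forall a, {morph f a : b b' / b + b'}.
Hypothesis fZ : forall (c : C) a b, f (c%:S * a) b = f a (c%:S * b).

Lemma tlift_mul (t t' : tens A B) : tlift f (t * t') =
  tlift (fun a b => tlift (fun a' b' => f (a * a') (b * b')) t') t.
Proof.
have h1 a b : [/\ forall b', {morph (fun a' b' => f (a * a') (b * b'))^~ b' : x y / x + y},
    forall a', {morph (fun b' => f (a * a') (b * b')) : x y / x + y}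
  & forall (c : C) a' b', f (a * (c%:S * a')) (b * b') = f (a * a') (b * (c%:S * b'))].
  split=> [b' x y|a' x y|c a' b'] /=; rewrite ?mulrDr ?flD ?frD //.
  by rewrite !scalAC fZ.
have hl b : {morph (fun a => tlift (fun a' b' => f (a * a') (b * b')) t') : x y / x + y}.
  move=> x y; rewrite /tlift -big_split; apply: eq_bigr => p _.
  by rewrite mulrDl flD.
have hr a : {morph (fun b => tlift (fun a' b' => f (a * a') (b * b')) t') : x y / x + y}.
  move=> x y; rewrite /tlift -big_split; apply: eq_bigr => p _.
  by rewrite mulrDl frD.
have hZ (c : C) a b : tlift (fun a' b' => f (c%:S * a * a') (b * b')) t' =
    tlift (fun a' b' => f (a * a') (c%:S * b * b')) t'.
  by apply: eq_tlift => a' b'; rewrite -!mulrA fZ.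
elim/tens_ind: t => [a b||x y IH IH'].
- rewrite (tlift_pure hl hr hZ) /GRing.mul /= tmul_purel.
  have [h1l h1r h1Z] := h1 a b.
  elim/tens_ind: t' {hl hr hZ} => [a' b'||x y IH IH'].
  + have k1 b'' : {morph (fun a' => pure (a * a') (b * b'')) : x y / x + y}.
      by move=> x y; rewrite mulrDr pureDl.
    have k2 a'' : {morph (fun b' => pure (a * a'') (b * b')) : x y / x + y}.
      by move=> x y; rewrite mulrDr pureDr.
    have k3 (c : C) a'' b'' :
        pure (a * (c%:S * a'')) (b * b'') = pure (a * a'') (b * (c%:S * b'')).
      by rewrite !scalAC pure_scal.
    by rewrite (tlift_pure k1 k2 k3) !tlift_pure.
  + rewrite !tlift0 //.
    * by move=> b''  x y; rewrite mulrDr pureDl.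
    * by move=> a'' x y; rewrite mulrDr pureDr.
    * by move=> c a'' b''; rewrite !scalAC pure_scal.
  + rewrite !tliftD // ?IH ?IH' //.
    * by move=> b''  u v; rewrite mulrDr pureDl.
    * by move=> a'' u v; rewrite mulrDr pureDr.
    * by move=> c a'' b''; rewrite !scalAC pure_scal.
- by rewrite mul0r !tlift0.
- by rewrite mulrDl !tliftD // IH IH'.
Qed.

End TensTheory.

(** * The right action of U_q(k) on Pol_q(K) *)

Section PolTheory.
Variables (R : realType) (q : R) (g : lie_datum).
Hypothesis hq : 0 < q < 1.
Notation C := R[i].
Notation P := (wt g).
Notation I := (node g).
Notation U := (Uqk q g).
Notation KU := (@KU R q g).
Notation EU := (@EU R q g).
Notation FU := (@FU R q g).
Variables (HU : Uqk_hopf q g) (V : forall w : domwt g, hwrep q (val w)).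
Variable Pol : PolqK V HU.
Notation vec w := 'cV[C]_(hdim (V w)).
Notation hact w := (hact (V w)).
Implicit Types (x y : Pol) (X Y Z : U) (w : domwt g).

Lemma pair0 X : pair (0 : Pol) X = 0.
Proof. by apply: (@addrI _ (pair (0 : Pol) X)); rewrite -pairD !addr0. Qed.
Lemma pairN x X : pair (- x) X = - pair x X.
Proof. by apply/eqP; rewrite -addr_eq0 -pairD addNr pair0. Qed.
Lemma pair_sum J (r : seq J) (F : J -> Pol) X :
  pair (\sum_(j <- r) F j) X = \sum_(j <- r) pair (F j) X.
Proof. by apply: (big_morph (fun x => pair x X)); [move=> ? ?; exact: pairD|exact: pair0]. Qed.

Lemma coefDl w (u v z : vec w) : coef Pol (u + v) z = coef Pol u z + coef Pol v z.
Proof. by apply: pair_inj => X; rewrite pairD !pair_coef dotDl. Qed.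
Lemma coefZl w c (u v : vec w) : coef Pol (c *: u) v = (Num.conj c)%:S * coef Pol u v.
Proof. by apply: pair_inj => X; rewrite pair_scal !pair_coef dotZl. Qed.
Lemma coefZr w c (u v : vec w) : coef Pol u (c *: v) = c%:S * coef Pol u v.
Proof. by apply: pair_inj => X; rewrite pair_scal !pair_coef -scalemxAr dotZr. Qed.
Lemma coef0l w (u : vec w) : coef Pol 0 u = 0.
Proof. by apply: pair_inj => X; rewrite pair0 pair_coef dot0l. Qed.
Lemma coef_suml w J (r : seq J) (F : J -> vec w) v :
  coef Pol (\sum_(j <- r) F j) v = \sum_(j <- r) coef Pol (F j) v.
Proof.
by apply: pair_inj => X; rewrite pair_sum pair_coef dot_suml;
  apply: eq_bigr => j _; rewrite pair_coef.
Qed.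

Lemma pol_ind (Q : Pol -> Prop) : Q 0 -> (forall x y, Q x -> Q y -> Q (x + y)) ->
  (forall w (u v : vec w), Q (coef Pol u v)) -> forall x, Q x.
Proof.
move=> Q0 QD Qc x; have [k [w [u [v ->]]]] := pol_span x.
by elim/big_ind: _.
Qed.

Lemma pairDr x X Y : pair x (X + Y) = pair x X + pair x Y.
Proof.
elim/pol_ind: x => [|x y IHx IHy|w u v]; first by rewrite !pair0 addr0.
  by rewrite !pairD IHx IHy addrACA.
by rewrite !pair_coef hactD mulmxDl dotDr.
Qed.
Lemma pair_scalr x c X : pair x (c%:S * X) = c * pair x X.
Proof.
elim/pol_ind: x => [|x y IHx IHy|w u v]; first by rewrite !pair0 mulr0.
  by rewrite !pairD IHx IHy mulrDr.
by rewrite !pair_coef hactM hact_scal mul_scalar_mx -scalemxAl dotZr.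
Qed.
(** The part of the translation action that concerns Pol_q(K). On functionals it is multiplication
    of the argument by Y from the left ([pair_ract]), from which its properties are derived. *)
Definition ract (x : Pol) (Y : U) : Pol :=
  tlift (fun a b => (pair a Y)%:S * b) (copP x).

Let ract_lin Y :
  [/\ forall b : Pol, {morph (fun a : Pol => (pair a Y)%:S * b) : a a' / a + a'},
      forall a : Pol, {morph (fun b : Pol => (pair a Y)%:S * b) : b b' / b + b'}
    & forall (c : C) (a b : Pol),
        (pair (c%:S * a) Y)%:S * b = (pair a Y)%:S * (c%:S * b)].
Proof.
split=> [b a a'|a b b'|c a b].
- by rewrite pairD scalD mulrDl.
- by rewrite mulrDr.
- by rewrite pair_scal scalMA mulrC.
Qed.

Lemma ractD x y Y : ract (x + y) Y = ract x Y + ract y Y.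
Proof.
have [h1 h2 h3] := ract_lin Y; have [cD _] := copP_linear Pol.
by rewrite /ract cD tliftD.
Qed.

Lemma ract0 Y : ract 0 Y = 0.
Proof. by apply: (@addrI _ (ract 0 Y)); rewrite -ractD !addr0. Qed.

Lemma ract_sum J (r : seq J) (F : J -> Pol) Y :
  ract (\sum_(j <- r) F j) Y = \sum_(j <- r) ract (F j) Y.
Proof. by apply: (big_morph (fun x => ract x Y)); [move=> ? ?; exact: ractD|exact: ract0]. Qed.

Lemma pair_ract x Y Z : pair (ract x Y) Z = pair x (Y * Z).
Proof.
elim/pol_ind: x => [|x y IHx IHy|w u v].
- by rewrite ract0 !pair0.
- by rewrite ractD !pairD IHx IHy.
have [h1 h2 h3] := ract_lin Y.
rewrite /ract copP_coef (big_morph _ (tliftD h1 h2 h3) (tlift0 h1 h2 h3)) pair_sum.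
rewrite pair_coef hactM -mulmxA [in RHS](cV_sum_delta (hact w Z *m v)).
rewrite mulmx_sumr dot_sumr; apply: eq_bigr => i _.
rewrite tlift_pure // pair_scal !pair_coef dot_delta_l -scalemxAr dotZr.
by rewrite mulrC.
Qed.

Lemma ract_coef w (u v : vec w) Y :
  ract (coef Pol u v) Y = coef Pol (hact w (star Y) *m u) v.
Proof.
apply: pair_inj => Z; rewrite pair_ract !pair_coef.
by rewrite (@dot_star _ _ _ (urep_of (V w))) /= hactM mulmxA.
Qed.

Lemma ract_scal c x Y : ract (c%:S * x) Y = c%:S * ract x Y.
Proof. by apply: pair_inj => Z; rewrite pair_ract !pair_scal pair_ract. Qed.
Lemma ractDr x Y Z : ract x (Y + Z) = ract x Y + ract x Z.
Proof. by apply: pair_inj => T; rewrite pairD !pair_ract mulrDl pairDr. Qed.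
Lemma ract_scalr c x Y : ract x (c%:S * Y) = c%:S * ract x Y.
Proof. by apply: pair_inj => Z; rewrite pair_scal !pair_ract -mulrA pair_scalr. Qed.
Lemma ractM x Y Z : ract x (Y * Z) = ract (ract x Y) Z.
Proof. by apply: pair_inj => T; rewrite !pair_ract mulrA. Qed.
Lemma ract_1 x : ract x 1 = x.
Proof. by apply: pair_inj => T; rewrite !pair_ract mul1r. Qed.

Let pairM_lin x y :
  [/\ forall b : U, {morph (fun a : U => pair x a * pair y b) : a a' / a + a'},
      forall a : U, {morph (fun b : U => pair x a * pair y b) : b b' / b + b'}
    & forall (c : C) a b,
        pair x (c%:S * a) * pair y b = pair x a * pair y (c%:S * b)].
Proof.
split=> [b a a'|a b b'|c a b].
- by rewrite pairDr mulrDl.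
- by rewrite pairDr mulrDr.
- by rewrite !pair_scalr mulrCA mulrA.
Qed.

Lemma pairM_mul x y Y Z : pair (x * y) (Y * Z) =
  tlift (fun a b => tlift (fun a' b' => pair x (a * a') * pair y (b * b'))
                          (copU HU Z)) (copU HU Y).
Proof.
have [h1 h2 h3] := pairM_lin x y; case: (copU_hom HU) => _ cM _.
by rewrite pairM cM tlift_mul.
Qed.

Let pair_ract_tens x y Z (t : tens U U) :
  tlift (fun a b => tlift (fun a' b' => pair x (a * a') * pair y (b * b'))
     (copU HU Z)) t = pair (tlift (fun a b => ract x a * ract y b) t) Z.
Proof.
rewrite (tlift_morph (phi := fun z => pair z Z)) ?pair0 //; last by move=> ? ?; rewrite pairD.
apply: eq_tlift => a b; rewrite pairM.
by apply: eq_tlift => a' b'; rewrite !pair_ract.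
Qed.

Lemma ract_mul x y Y :
  ract (x * y) Y = tlift (fun a b => ract x a * ract y b) (copU HU Y).
Proof. by apply: pair_inj => Z; rewrite pair_ract pairM_mul pair_ract_tens. Qed.

Let ract_mul_lin x y :
  [/\ forall b : U, {morph (fun a : U => ract x a * ract y b) : a a' / a + a'},
      forall a : U, {morph (fun b : U => ract x a * ract y b) : b b' / b + b'}
    & forall (c : C) a b,
        ract x (c%:S * a) * ract y b = ract x a * ract y (c%:S * b)].
Proof.
split=> [b a a'|a b b'|c a b].
- by rewrite ractDr mulrDl.
- by rewrite ractDr mulrDr.
- by rewrite !ract_scalr scalAC mulrA.
Qed.

Lemma ract_mulK x y l : ract (x * y) (KU l) = ract x (KU l) * ract y (KU l).
Proof. by have [h1 h2 h3] := ract_mul_lin x y; rewrite ract_mul copU_K tlift_pure. Qed.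

Lemma ract_mulE x y r : ract (x * y) (EU r) =
  ract x (EU r) * ract y (KU (alpha r)) + x * ract y (EU r).
Proof.
have [h1 h2 h3] := ract_mul_lin x y.
by rewrite ract_mul copU_E tliftD // !tlift_pure // ract_1.
Qed.

Lemma ract_mulF x y r : ract (x * y) (FU r) =
  ract x (FU r) * y + ract x (KU (- alpha r)) * ract y (FU r).
Proof.
have [h1 h2 h3] := ract_mul_lin x y.
by rewrite ract_mul copU_F tliftD // !tlift_pure // ract_1.
Qed.

(** The same coproduct formula as in [ract_mulE], but with E_r acting on the right-hand vectors. *)
Lemma pairM_E w w' (u v : vec w) (u' v' : vec w') Z r :
  pair (coef Pol u v * coef Pol u' v') (Z * EU r) =
  pair (coef Pol u (hact w (EU r) *m v) * coef Pol u' (hact w' (KU (alpha r)) *m v')) Z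
  + pair (coef Pol u v * coef Pol u' (hact w' (EU r) *m v')) Z.
Proof.
have tl2 (f h : U -> U -> C) (t : tens U U) :
    tlift f t + tlift h t = tlift (fun a b => f a b + h a b) t.
  by rewrite /tlift -big_split.
rewrite pairM_mul !pairM tl2; apply: eq_tlift => c1 c2.
set x := coef Pol u v; set y := coef Pol u' v'.
have h1 b : {morph (fun a' => pair x (c1 * a') * pair y (c2 * b)) : a a' / a + a'}.
  by move=> a a'; rewrite mulrDr pairDr mulrDl.
have h2 a : {morph (fun b' => pair x (c1 * a) * pair y (c2 * b')) : b b' / b + b'}.
  by move=> b b'; rewrite mulrDr pairDr mulrDr.
have h3 (c : C) a b : pair x (c1 * (c%:S * a)) * pair y (c2 * b) =
    pair x (c1 * a) * pair y (c2 * (c%:S * b)).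
  by rewrite !scalAC !pair_scalr mulrCA mulrA.
rewrite copU_E tliftD // !tlift_pure //.
by rewrite !mulr1 /x /y !pair_coef !hactM !mulmxA.
Qed.

(** [Uqk_hopf] does not give the counit on generators. Here and in the next two lemmas it is
    recovered by applying the product rules to products with 1. *)
Lemma ract_1K l : ract 1 (KU l) = 1.
Proof.
have := ract_mulK (ract 1 (KU (- l))) 1 l.
by rewrite mulr1 -ractM KUN ract_1 mul1r => <-.
Qed.
Lemma ract_1E r : ract 1 (EU r) = 0.
Proof.
have := ract_mulE 1 1 r; rewrite mulr1 ract_1K mulr1 mul1r => e.
by apply: (@addrI _ (ract 1 (EU r))); rewrite -e addr0.
Qed.
Lemma ract_1F r : ract 1 (FU r) = 0.
Proof.
have := ract_mulF 1 1 r; rewrite !mulr1 ract_1K mul1r => e.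
by apply: (@addrI _ (ract 1 (FU r))); rewrite -e addr0.
Qed.

End PolTheory.

(** * Matrices of coefficients and their inverses *)

Section PolMatrix.
Variables (R : realType) (q : R) (g : lie_datum).
Hypothesis hq : 0 < q < 1.
Notation C := R[i].
Notation P := (wt g).
Notation I := (node g).
Notation U := (Uqk q g).
Notation KU := (@KU R q g).
Notation EU := (@EU R q g).
Notation FU := (@FU R q g).
Variables (HU : Uqk_hopf q g) (V : forall w : domwt g, hwrep q (val w)).
Variable Pol : PolqK V HU.
Notation vec w := 'cV[C]_(hdim (V w)).
Notation hact w := (hact (V w)).

Lemma hact0 w : hact w 0 = 0.
Proof. exact: (uact0 (urep_of (V w))). Qed.
Lemma hact1 w : hact w 1 = 1%:M.
Proof. exact: (uact1 (urep_of (V w))). Qed.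

Definition smx m n (M : 'M[C]_(m, n)) : 'M[Pol]_(m, n) := map_mx (fun c : C => c%:S) M.
Definition rmx m n (M : 'M[Pol]_(m, n)) (Y : U) : 'M[Pol]_(m, n) :=
  map_mx (fun x => ract x Y) M.

Lemma smxM m n k (M : 'M[C]_(m, n)) (N : 'M_(n, k)) : smx (M *m N) = smx M *m smx N.
Proof.
apply/matrixP=> i j; rewrite !mxE (big_morph _ (@scalD C Pol) (@scal0 C Pol)).
by apply: eq_bigr => l _; rewrite !mxE scalM.
Qed.
Lemma smx1 n : smx (1%:M : 'M_n) = 1%:M.
Proof.
by apply/matrixP=> i j; rewrite !mxE; case: (i == j); rewrite ?scal1 ?scal0.
Qed.
Lemma scalar_smx m n (x : Pol) (M : 'M[C]_(m, n)) : x%:M *m smx M = smx M *m x%:M.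
Proof.
apply/matrixP=> i j; rewrite !mxE (bigD1 i) //= big1 ?addr0 => [|l li].
  rewrite (bigD1 j) //= big1 ?addr0 => [|l lj].
    by rewrite !mxE !eqxx scalC.
  by rewrite !mxE (negPf lj) mulr0.
by rewrite !mxE eq_sym (negPf li) mul0r.
Qed.
Lemma scalar_mulmx n k (x : Pol) (M : 'M[Pol]_(n, k)) i j : (x%:M *m M) i j = x * M i j.
Proof.
rewrite !mxE (bigD1 i) //= big1 ?addr0 => [|l li]; first by rewrite !mxE eqxx.
by rewrite !mxE eq_sym (negPf li) mul0r.
Qed.

Lemma rmx_smxM m n k (M : 'M[C]_(m, n)) (N : 'M[Pol]_(n, k)) Y :
  rmx (smx M *m N) Y = smx M *m rmx N Y.
Proof.
apply/matrixP=> i j; rewrite !mxE ract_sum; apply: eq_bigr => l _.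
by rewrite !mxE ract_scal.
Qed.
Lemma rmx_scalar n (x : Pol) Y : rmx (x%:M : 'M_n) Y = (ract x Y)%:M.
Proof. by apply/matrixP=> i j; rewrite !mxE; case: (i == j); rewrite ?ract0. Qed.

Lemma rmx_mulK m n k (M : 'M[Pol]_(m, n)) (N : 'M_(n, k)) l :
  rmx (M *m N) (KU l) = rmx M (KU l) *m rmx N (KU l).
Proof.
apply/matrixP=> i j; rewrite !mxE ract_sum; apply: eq_bigr => t _.
by rewrite !mxE ract_mulK.
Qed.
Lemma rmx_mulE m n k (M : 'M[Pol]_(m, n)) (N : 'M_(n, k)) r :
  rmx (M *m N) (EU r) = rmx M (EU r) *m rmx N (KU (alpha r)) + M *m rmx N (EU r).
Proof.
apply/matrixP=> i j; rewrite !mxE ract_sum -big_split; apply: eq_bigr => t _.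
by rewrite !mxE ract_mulE.
Qed.
Lemma rmx_mulF m n k (M : 'M[Pol]_(m, n)) (N : 'M_(n, k)) r :
  rmx (M *m N) (FU r) = rmx M (FU r) *m N + rmx M (KU (- alpha r)) *m rmx N (FU r).
Proof.
apply/matrixP=> i j; rewrite !mxE ract_sum -big_split; apply: eq_bigr => t _.
by rewrite !mxE ract_mulF.
Qed.

Section Inverse.
Variable w : domwt g.
Notation n := (hdim (V w)).
Notation e i := (delta_mx i 0 : vec w).

Definition cmx (v : vec w) : 'cV[Pol]_n := \col_i coef Pol (e i) v.
Definition Xmx : 'M[Pol]_n := \matrix_(i, j) coef Pol (e i) (e j).
(** The antipode applied to the entries of [Xmx]: entry (i, j) is the functional sending X to entry
    (i, j) of the action of S(X). Hence it is the inverse of [Xmx]. *)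
Definition Smx : 'M[Pol]_n := \matrix_(i, j) star (coef Pol (e j) (e i)).

Lemma coef_expand (d v : vec w) : coef Pol d v = \sum_i (Num.conj (d i 0))%:S * coef Pol (e i) v.
Proof.
rewrite {1}(cV_sum_delta d) coef_suml; apply: eq_bigr => i _.
by rewrite coefZl.
Qed.

Lemma rmx_cmx v Y : rmx (cmx v) Y = smx (hact w Y) *m cmx v.
Proof.
apply/colP=> i; rewrite !mxE ract_coef coef_expand; apply: eq_bigr => j _.
by rewrite hact_star -colE !mxE conjCK.
Qed.

Lemma rmx_Xmx Y : rmx Xmx Y = smx (hact w Y) *m Xmx.
Proof.
apply/matrixP=> i j; have /colP/(_ i) := rmx_cmx (e j) Y; rewrite !mxE => ->.
by apply: eq_bigr => l _; rewrite !mxE.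
Qed.

Lemma antU_actl (Z : U) :
  tlift (fun a b => hact w (antU HU a) *m hact w b) (copU HU Z) = (epsU HU Z)%:M.
Proof.
rewrite -hact_scal -antU_l (tlift_morph (phi := hact w)).
- by apply: eq_tlift => a b; rewrite hactM.
- exact: hact0.
- exact: hactD.
Qed.
Lemma antU_actr (Z : U) :
  tlift (fun a b => hact w a *m hact w (antU HU b)) (copU HU Z) = (epsU HU Z)%:M.
Proof.
rewrite -hact_scal -antU_r (tlift_morph (phi := hact w)).
- by apply: eq_tlift => a b; rewrite hactM.
- exact: hact0.
- exact: hactD.
Qed.

Lemma pair_natr i j Z : pair (((i == j :> 'I_n)%:R : Pol)) Z = (epsU HU Z)%:M i j.
Proof. by rewrite mxE; case: (i == j); rewrite ?pair1 ?pair0. Qed.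

Lemma XSmx : Xmx *m Smx = 1%:M.
Proof.
apply/matrixP=> i k; rewrite !mxE; apply: pair_inj => Z.
rewrite pair_natr -antU_actr pair_sum.
rewrite (eq_bigr _ (fun j _ => pairM _ _ _)) tlift_sum.
rewrite (tlift_morph (phi := fun M : 'M[C]_n => M i k)) ?mxE //; last first.
  by move=> ? ?; rewrite mxE.
apply: eq_tlift => a b; rewrite mxE; apply: eq_bigr => j _.
by rewrite !mxE pair_coef pair_star !dot_delta_l -!colE !mxE.
Qed.

Lemma SXmx : Smx *m Xmx = 1%:M.
Proof.
apply/matrixP=> i k; rewrite !mxE; apply: pair_inj => Z.
rewrite pair_natr -antU_actl pair_sum.
rewrite (eq_bigr _ (fun j _ => pairM _ _ _)) tlift_sum.
rewrite (tlift_morph (phi := fun M : 'M[C]_n => M i k)) ?mxE //; last first.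
  by move=> ? ?; rewrite mxE.
apply: eq_tlift => a b; rewrite mxE; apply: eq_bigr => j _.
by rewrite !mxE pair_coef pair_star !dot_delta_l -!colE !mxE.
Qed.

Lemma Xmx_inj k (M N : 'M[Pol]_(n, k)) : Xmx *m M = Xmx *m N -> M = N.
Proof.
by move=> /(congr1 (mulmx Smx)); rewrite !mulmxA SXmx !mul1mx.
Qed.

Lemma rmx1E r : rmx (1%:M : 'M[Pol]_n) (EU r) = 0.
Proof. by rewrite rmx_scalar ract_1E; apply/matrixP=> i j; rewrite !mxE mul0rn. Qed.
Lemma rmx1F r : rmx (1%:M : 'M[Pol]_n) (FU r) = 0.
Proof. by rewrite rmx_scalar ract_1F; apply/matrixP=> i j; rewrite !mxE mul0rn. Qed.
Lemma rmx1K l : rmx (1%:M : 'M[Pol]_n) (KU l) = 1%:M.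
Proof. by rewrite rmx_scalar ract_1K. Qed.

Lemma smx_KVN l : smx (hact w (KU l)) *m smx (hact w (KU (- l))) = 1%:M.
Proof. by rewrite -smxM -hactM KUVN hact1 smx1. Qed.
Lemma smx_KN l : smx (hact w (KU (- l))) *m smx (hact w (KU l)) = 1%:M.
Proof. by rewrite -smxM -hactM KUN hact1 smx1. Qed.

(** This and the next two formulas come from acting on Xmx Smx = 1 by a generator and solving for
    the action on [Smx]. *)
Lemma rmx_SmxK l : rmx Smx (KU l) = Smx *m smx (hact w (KU (- l))).
Proof.
apply: Xmx_inj; rewrite mulmxA XSmx mul1mx.
have := rmx_mulK Xmx Smx l; rewrite XSmx rmx1K rmx_Xmx.
move/(congr1 (mulmx (smx (hact w (KU (- l)))))).
by rewrite mulmx1 !mulmxA smx_KN mul1mx.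
Qed.

Lemma rmx_SmxF r : rmx Smx (FU r) = - (Smx *m smx (hact w (KU (alpha r) * FU r))).
Proof.
apply: Xmx_inj; rewrite mulmxN mulmxA XSmx mul1mx.
have := rmx_mulF Xmx Smx r; rewrite XSmx rmx1F !rmx_Xmx -mulmxA XSmx mulmx1.
move/(congr1 (mulmx (smx (hact w (KU (alpha r)))))).
rewrite mulmx0 mulmxDr !mulmxA smx_KVN mul1mx -smxM -hactM => /eqP.
by rewrite eq_sym addr_eq0 -eqr_oppLR => /eqP <-.
Qed.

Lemma rmx_SmxE r : rmx Smx (EU r) = - (Smx *m smx (hact w (EU r * KU (- alpha r)))).
Proof.
apply: Xmx_inj; rewrite mulmxN mulmxA XSmx mul1mx.
have := rmx_mulE Xmx Smx r; rewrite XSmx rmx1E rmx_Xmx rmx_SmxK.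
rewrite -!mulmxA (mulmxA Xmx) XSmx mul1mx -smxM -hactM => /eqP.
by rewrite eq_sym addrC addr_eq0 => /eqP.
Qed.

End Inverse.
End PolMatrix.

(** * Direct sums and the uniqueness of highest weight modules *)

Section DirectSum.
Variables (R : realType) (q : R) (g : lie_datum).
Hypothesis hq : 0 < q < 1.
Notation C := R[i].
Notation P := (wt g).
Notation I := (node g).
Notation U := (Uqk q g).
Notation KU := (@KU R q g).
Notation EU := (@EU R q g).
Notation FU := (@FU R q g).

Lemma dot_col_mx n1 n2 (u1 v1 : 'cV[C]_n1) (u2 v2 : 'cV_n2) :
  dot (col_mx u1 u2) (col_mx v1 v2) = dot u1 v1 + dot u2 v2.
Proof. by rewrite /dot map_col_mx tr_col_mx mul_row_col mxE. Qed.

Lemma adj_block_mx n1 n2 (M : 'M[C]_n1) (N : 'M[C]_n2) :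
  adjmx (block_mx M 0 0 N) = block_mx (adjmx M) 0 0 (adjmx N).
Proof. by rewrite /adjmx map_block_mx tr_block_mx !map_mx0 !trmx0. Qed.

Section Sum.
Variables V W : urep q g.
Definition uact_sum (x : U) := block_mx (uact V x) 0 0 (uact W x).
Lemma uact_sumD : {morph uact_sum : x y / x + y}.
Proof. by move=> x y; rewrite /uact_sum add_block_mx !uactD !addr0. Qed.
Lemma uact_sumM x y : uact_sum (x * y) = uact_sum x *m uact_sum y.
Proof.
by rewrite /uact_sum mulmx_block !uactM !mulmx0 !mul0mx !addr0 !add0r.
Qed.
Lemma uact_sum_scal (c : C) : uact_sum c%:S = c%:M.
Proof. by rewrite /uact_sum !uact_scal -scalar_mx_block. Qed.
Lemma uact_sum_star x : uact_sum (star x) = adjmx (uact_sum x).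
Proof. by rewrite /uact_sum !uact_star adj_block_mx. Qed.
Definition usum : urep q g :=
  URep uact_sumD uact_sumM uact_sum_scal uact_sum_star.
Lemma uact_sum_col x (u : 'cV[C]_(udim V)) (v : 'cV[C]_(udim W)) :
  (uact usum x : 'M[C]_(udim V + udim W)) *m col_mx u v = col_mx (uact V x *m u) (uact W x *m v).
Proof. by rewrite /= mul_block_col !mul0mx addr0 add0r. Qed.
End Sum.

Definition uact_zero (x : U) : 'M[C]_0 := 0.
Lemma uact_zero_prop : [/\ {morph uact_zero : x y / x + y},
  forall x y, uact_zero (x * y) = uact_zero x *m uact_zero y,
  forall c : C, uact_zero c%:S = c%:M
  & forall x, uact_zero (star x) = adjmx (uact_zero x)].
Proof. by split=> [x y|x y|c|x]; apply/matrixP=> -[]. Qed.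
Definition uzero : urep q g :=
  let: And4 h1 h2 h3 h4 := uact_zero_prop in URep h1 h2 h3 h4.

(* A highest weight vector [z] of a unitary representation whose weight is that
   of the irreducible V is annihilated by whatever annihilates the highest weight
   vector of V: the submodule generated by (hvec, z) in the direct sum meets
   0 + W in a submodule orthogonal to [z], hence to the module it generates. *)
Lemma uhw_annihilator (m : P) (V : hwrep q m) (W : urep q g) z T :
  @uhw R q g W z m -> hact V T *m hvec V = 0 -> uact W T *m z = 0.
Proof.
move=> [zm zE] T0.
pose V' := urep_of V; pose h : 'cV_(udim (usum V' W)) := col_mx (hvec V) z.
have hh : @uhw R q g (usum V' W) h m.
  split=> [x|r]; rewrite uact_sum_col.
    by rewrite zm (hvec_wt V) /h scale_col_mx.
  by rewrite zE (hvec_hw V) col_mx0.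
have gw s : gword (V := usum V' W) s h =
    col_mx (gword (V := V') s (hvec V)) (gword (V := W) s z).
  elim: s => [//|r s IH].
  rewrite -[LHS]/(uact (usum V' W) (star (EU r)) *m gword (V := usum V' W) s h) IH.
  exact: uact_sum_col.
have key (u : 'cV_(udim (usum V' W))) : gwords h u ->
    dot z (dsubmx u) = dot (hvec V) (usubmx u) * dot z z.
  elim=> [|a u1 u2 [s ->] _ IH].
    by rewrite -[0]col_mx0 col_mxKu col_mxKd !dot0r mul0r.
  rewrite !linearP /= !dotDr !dotZr IH mulrDl gw col_mxKu col_mxKd.
  congr (_ + _); rewrite -mulrA; congr (_ * _).
  case: s => [|r s]; first by rewrite hvec_unit mul1r.
  rewrite (dot_gword_cons r s (conj zm zE)).
  have [um uE] := hvec_uhw V.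
  by rewrite (dot_gword_cons (V := V') r s (conj um uE)) mul0r.
apply: dot_eq0; rewrite -dot_starr -uactMv.
(* Under [key] this vector has vanishing component in V, so the inner product of z with T^* T z, the
   squared norm of T z, is zero. *)
have hTh : gwords h (uact (usum V' W) (star T * T) *m h).
  apply: (gwords_stable hq _ hh); apply: lspan_gen; by exists [::].
have := key _ hTh; rewrite uact_sum_col col_mxKu col_mxKd => ->.
by rewrite uactMv /= T0 mulmx0 dot0r mul0r.
Qed.

End DirectSum.

(** * Highest weight elements of Pol_q(K) *)

Section PolHighest.
Variables (R : realType) (q : R) (g : lie_datum).
Hypothesis hq : 0 < q < 1.
Notation C := R[i].
Notation P := (wt g).
Notation I := (node g).
Notation U := (Uqk q g).
Notation KU := (@KU R q g).
Notation EU := (@EU R q g).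
Notation FU := (@FU R q g).
Variables (HU : Uqk_hopf q g) (V : forall w : domwt g, hwrep q (val w)).
Variable Pol : PolqK V HU.
Notation vec w := 'cV[C]_(hdim (V w)).
Notation hact w := (hact (V w)).
Notation xi w := (hvec (V w)).

(** A sum of coefficients is a single coefficient of the direct sum. *)
Lemma pol_urep (y : Pol) : exists (W : urep q g) (u v : 'cV[C]_(udim W)),
  forall Z, pair y Z = dot u (uact W Z *m v).
Proof.
elim/pol_ind: y => [|x y [W1 [u1 [v1 h1]]] [W2 [u2 [v2 h2]]]|w u v].
- by exists (uzero q g), 0, 0 => Z; rewrite pair0 dot0l.
- exists (usum W1 W2), (col_mx u1 u2), (col_mx v1 v2) => Z.
  by rewrite uact_sum_col dot_col_mx pairD h1 h2.
- by exists (urep_of (V w)), u, v => Z; rewrite pair_coef.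
Qed.

Lemma hwrep_gen w (v : vec w) : exists T, v = hact w T *m xi w.
Proof.
elim: (hwrep_span hq v) => [|a u v' [s ->] _ [T ->]].
  by exists 0; rewrite hact0 mul0mx.
have [S ->] : exists S, gword (V := urep_of (V w)) s (xi w) = hact w S *m xi w.
  elim: s => [|r s [S IH]]; first by exists 1; rewrite hact1 mul1mx.
  by exists (star (EU r) * S); rewrite /= -/(gword _ _) IH hactM mulmxA.
by exists (a%:S * S + T); rewrite hactD hactM hact_scal mul_scalar_mx mulmxDl scalemxAl.
Qed.

(** Write y as a coefficient with left vector z and right vector z', and project z onto the cyclic
    module of z'. The projection z2 is determined by its inner products with that module, that is by
    y, so the conditions on y make z2 a highest weight vector. By [uhw_annihilator], T xi_w -> T z2
    is then well defined on V_w. *)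
Lemma pol_highest w (y : Pol) : (forall r, ract y (FU r) = 0) ->
  (forall l, ract y (KU l) = (qpow q (ip l (val w)))%:S * y) ->
  exists rho : vec w, y = coef Pol (xi w) rho.
Proof.
move=> yF yK; have [W [z [z' yE]]] := pol_urep y.
pose N (u : 'cV[C]_(udim W)) := exists Z, u = uact W Z *m z'.
have [|||z2 [Z2 z2E] z2P] := @riesz_proj R _ N z.
- by exists 0; rewrite uact0 mul0mx.
- by move=> _ _ [Z ->] [Z' ->]; exists (Z + Z'); rewrite uactDv.
- by move=> a _ [Z ->]; exists (a%:S * Z); rewrite uactZv.
have {}yE Z : pair y Z = dot z2 (uact W Z *m z').
  by rewrite z2P ?yE //; exists Z.
have z2hw : @uhw R q g W z2 (val w).
  split=> [l|r].
    apply/eqP; rewrite -subr_eq0; apply/eqP/dot_eq0.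
    set t := _ - _; suff h Z : dot t (uact W Z *m z') = 0.
      have [Z tE] : N t; last by rewrite {2}tE h.
      exists ((KU l - (qpow q (ip l (val w)))%:S) * Z2).
      by rewrite uactMv -z2E uactBv uact_scal mul_scalar_mx.
    rewrite /t dotDl dotNl dotZl qpow_conj -{1}(KU_star q l) dot_star -uactMv -!yE.
    by rewrite -pair_ract yK pair_scal subrr.
  apply: dot_eq0; rewrite {2}z2E -[in X in dot _ X]uactMv.
  rewrite -{1}(starK (EU r)) dot_star -uactMv -yE EU_star -!mulrA.
  by rewrite -pair_ract yF pair0.
have [Tb TbE] := choice (fun i => hwrep_gen (delta_mx i 0 : vec w)).
(* The image of z' under the adjoint of the map T xi_w -> T z2, in coordinates. *)
pose rho : vec w := \col_i dot (uact W (Tb i) *m z2) z'.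
exists rho; apply: pair_inj => Z; rewrite yE pair_coef.
rewrite -dot_star -(@dot_star _ _ _ (urep_of (V w))) /=.
set T := star Z; set t := hact w T *m xi w.
have T0 : hact w (T - \sum_i (t i 0)%:S * Tb i) *m xi w = 0.
  rewrite (@uactBv _ _ _ (urep_of (V w))) /= -/t {1}(cV_sum_delta t).
  rewrite (big_morph _ (@hactD _ _ _ _ (V w)) (hact0 V w)) mulmx_suml -sumrB big1 // => i _.
  by rewrite hactM hact_scal mul_scalar_mx -scalemxAl -TbE subrr.
have := uhw_annihilator hq z2hw T0.
rewrite uactBv => /eqP; rewrite subr_eq0 => /eqP ->.
rewrite (big_morph _ (@uactD _ _ _ W) (uact0 W)) mulmx_suml dot_suml dotE.
by apply: eq_bigr => i _; rewrite uactZv dotZl; congr (_ * _); rewrite [RHS]mxE.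
Qed.

End PolHighest.

(** * The commutation of b with Pol_q(K) *)

Section QCommutation.
Variables (R : realType) (q : R) (g : lie_datum).
Hypothesis hq : 0 < q < 1.
Notation C := R[i].
Notation P := (wt g).
Notation I := (node g).
Notation U := (Uqk q g).
Notation KU := (@KU R q g).
Notation EU := (@EU R q g).
Notation FU := (@FU R q g).
Notation posQ := (in_posQ (cartan g)).
Variables (HU : Uqk_hopf q g) (V : forall w : domwt g, hwrep q (val w)).
Variable Pol : PolqK V HU.
Notation vec w := 'cV[C]_(hdim (V w)).
Notation hact w := (hact (V w)).
Notation xi w := (hvec (V w)).
Notation uwt_ w u m := (@uwt R q g (urep_of (V w)) u m).

Definition zmx m n (c : C) (M : 'M[Pol]_(m, n)) := map_mx (fun x => c%:S * x) M.

Lemma mulmx_zmx m n k c (N : 'M[Pol]_(m, n)) (M : 'M_(n, k)) :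
  N *m zmx c M = zmx c (N *m M).
Proof.
apply/matrixP=> i j; rewrite !mxE mulr_sumr; apply: eq_bigr => t _.
by rewrite !mxE scalAC.
Qed.
Lemma zmx_mulmx m n k c (N : 'M[Pol]_(m, n)) (M : 'M_(n, k)) :
  zmx c N *m M = zmx c (N *m M).
Proof.
apply/matrixP=> i j; rewrite !mxE mulr_sumr; apply: eq_bigr => t _.
by rewrite !mxE mulrA.
Qed.
Lemma smx_zmx m n c (M : 'M[C]_(m, n)) : smx Pol (c *: M) = zmx c (smx Pol M).
Proof. by apply/matrixP=> i j; rewrite !mxE scalM. Qed.
Lemma scalar_zmx n k c x (M : 'M[Pol]_(n, k)) :
  (c%:S * x)%:M *m M = zmx c (x%:M *m M).
Proof. by apply/matrixP=> i j; rewrite scalar_mulmx [RHS]mxE scalar_mulmx mulrA. Qed.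
Lemma smx_scalarA m n k x (A : 'M[C]_(m, n)) (M : 'M[Pol]_(n, k)) :
  smx Pol A *m (x%:M *m M) = x%:M *m (smx Pol A *m M).
Proof. by rewrite !mulmxA scalar_smx. Qed.
Lemma smx_mulA m n k l (A : 'M[C]_(m, n)) (B : 'M_(n, k)) (M : 'M[Pol]_(k, l)) :
  smx Pol A *m (smx Pol B *m M) = smx Pol (A *m B) *m M.
Proof. by rewrite mulmxA smxM. Qed.

Lemma pairM_1 (x y : Pol) : pair (x * y) 1 = pair x 1 * pair y 1.
Proof.
rewrite pairM; case: (copU_hom HU) => _ _ /(_ 1); rewrite !scal1 => ->.
rewrite -[1]/(pure 1 1) tlift_pure // => [b u v|a u v|c a b] /=.
- by rewrite pairDr mulrDl.
- by rewrite pairDr mulrDr.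
- by rewrite !pair_scalr mulrCA mulrA.
Qed.

Section Pair.
Variables w w' : domwt g.
Notation e a := (delta_mx a 0 : vec w').

(* [rho] is the image of [b (x) v] under an intertwiner V_w (x) V_w' -> V_w' (x) V_w,
   expanded in the standard basis of V_w'. *)
Definition rtt (b : vec w) (v : vec w') (rho : 'I_(hdim (V w')) -> vec w) : Prop :=
  forall d : vec w', \sum_a coef Pol d (e a) * coef Pol (xi w) (rho a) =
    coef Pol (xi w) b * coef Pol (hact w' (KU (- val w)) *m d) v.

Lemma rtt_exists b v : exists rho, rtt b v rho.
Proof.
set l := val w.
pose x0 := coef Pol (xi w) b; pose k := hact w' (KU (- l)).
pose N := x0%:M *m (smx Pol k *m cmx Pol v).
pose Y := Smx Pol w' *m N.
have x0F r : ract x0 (FU r) = 0.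
  by rewrite ract_coef FU_star hactM -mulmxA (hvec_hw (V w)) mulmx0 coef0l.
have x0K m : ract x0 (KU m) = (qpow q (ip m l))%:S * x0.
  by rewrite ract_coef KU_star (hvec_wt (V w)) coefZl qpow_conj.
have NF r : rmx N (FU r) = zmx (qpow q (ip (- alpha r) l))
    (x0%:M *m (smx Pol (k *m hact w' (FU r)) *m cmx Pol v)).
  rewrite rmx_mulF !rmx_scalar x0F x0K rmx_smxM rmx_cmx scalar_zmx smx_mulA.
  rewrite [0%:M](_ : _ = 0) ?mul0mx ?add0r //.
  by apply/matrixP=> i j; rewrite !mxE mul0rn.
(* This is the reason for the factor K_{-l}: moved past F_r it yields the scalar by which
   K_{-alpha_r} acts on [x0], and the two terms of Y <| F_r cancel. *)
have kF r : hact w' (KU (alpha r) * FU r) *m k =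
    qpow q (ip (- alpha r) l) *: (hact w' (KU (alpha r)) *m (k *m hact w' (FU r))).
  have e : KU (alpha r) * FU r * KU (- l) =
      (qpow q (ip (- alpha r) l))%:S * (KU (alpha r) * (KU (- l) * FU r)).
    rewrite (KUF q (- l) r) scalAC scalMA ipNl [ip (alpha r) l]ip_sym ipNl opprK.
    by rewrite qpowNM // scal1 mul1r mulrA.
  by rewrite -!hactM e [LHS]hactM hact_scal mul_scalar_mx.
have YF r : rmx Y (FU r) = 0.
  rewrite rmx_mulF rmx_SmxF rmx_SmxK NF opprK mulNmx -!mulmxA.
  rewrite mulmx_zmx !smx_scalarA !smx_mulA kF smx_zmx zmx_mulmx mulmx_zmx.
  by rewrite addNr.
have YK m : rmx Y (KU m) = zmx (qpow q (ip m l)) Y.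
  rewrite rmx_mulK rmx_SmxK rmx_mulK rmx_scalar x0K rmx_smxM rmx_cmx.
  rewrite scalar_zmx -!mulmxA mulmx_zmx smx_scalarA !smx_mulA mulmx_zmx.
  suff -> : hact w' (KU (- m)) *m k *m hact w' (KU m) = k by [].
  rewrite /k -!hactM -!KUD; congr (hact w' (KU _)).
  by apply/rowP=> t; rewrite !mxE; ring.
have Yxi a : exists rho : vec w, Y a 0 = coef Pol (xi w) rho.
  apply: pol_highest => // [r|m].
    by have /matrixP/(_ a 0) := YF r; rewrite !mxE.
  by have /matrixP/(_ a 0) := YK m; rewrite !mxE.
have [rho rhoE] := choice Yxi.
exists rho.
have XY : Xmx Pol w' *m Y = x0%:M *m (smx Pol k *m cmx Pol v).
  by rewrite /Y mulmxA XSmx mul1mx.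
have base i : \sum_a coef Pol (e i) (e a) * coef Pol (xi w) (rho a) =
    x0 * coef Pol (hact w' (KU (- l)) *m e i) v.
  have /matrixP/(_ i 0) := XY; rewrite scalar_mulmx -rmx_cmx.
  rewrite mxE => E; rewrite -[x0 * _]/(x0 * _).
  have -> : coef Pol (hact w' (KU (- l)) *m e i) v = (rmx (cmx Pol v) (KU (- l))) i 0.
    by rewrite !mxE ract_coef KU_star.
  rewrite -E; apply: eq_bigr => a _; by rewrite rhoE mxE.
move=> d; rewrite [d in RHS]cV_sum_delta mulmx_sumr coef_suml mulr_sumr.
under eq_bigr => a _ do rewrite coef_expand mulr_suml.
rewrite exchange_big; apply: eq_bigr => i _ /=.
rewrite -scalemxAr coefZl scalAC -base mulr_sumr; apply: eq_bigr => a _.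
by rewrite mulrA.
Qed.

(* [tau b v] is to be thought of as the matrix coefficient of V_w (x) V_w' between
   some t and [b (x) v], with t in the sum of the (V_w)_m (x) V_w' over
   m in l + Q^+ \ {0}. *)
Definition triangular (l : P) (tau : vec w -> vec w' -> Pol) : Prop :=
  (forall b v Z r, pair (tau b v) (Z * EU r) =
     pair (tau (hact w (EU r) *m b) (hact w' (KU (alpha r)) *m v)) Z
     + pair (tau b (hact w' (EU r) *m v)) Z) /\
  (forall b v m, uwt_ w b m -> (forall x, posQ x -> x != 0 -> m != l + x) ->
     pair (tau b v) 1 = 0).

Lemma triangularD l t1 t2 : triangular l t1 -> triangular l t2 ->
  triangular l (fun b v => t1 b v + t2 b v).
Proof.
move=> [h1 k1] [h2 k2]; split=> [b v Z r|b v m bm lm]; rewrite !pairD.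
  by rewrite h1 h2 addrACA.
by rewrite (k1 _ _ _ bm lm) (k2 _ _ _ bm lm) addr0.
Qed.

Lemma triangularZ l c t : triangular l t -> triangular l (fun b v => c%:S * t b v).
Proof.
move=> [h k]; split=> [b v Z r|b v m bm lm]; rewrite !pair_scal.
  by rewrite h mulrDr.
by rewrite (k _ _ _ bm lm) mulr0.
Qed.

Lemma posQ_root_neq0 x r : posQ x -> x + alpha r != 0.
Proof.
move=> xQ; apply/eqP=> e; have /eqP := simple_root_neq0 (cartanP g) r; apply.
apply: (in_posQ_anti (cartanP g)); first exact: in_posQ_root.
suff -> : - simple_root (cartan g) r = x by [].
by apply/eqP; rewrite eq_sym -addr_eq0 e.
Qed.

Lemma triangular_shift l r m : (forall x, posQ x -> x != 0 -> m != l - alpha r + x) ->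
  forall x, posQ x -> m != l + x.
Proof.
move=> h x xQ; have := h (x + alpha r); rewrite addrA addrAC subrK; apply.
  by apply: in_posQD xQ _; exact: in_posQ_root.
exact: posQ_root_neq0.
Qed.

Lemma triangular_mono l r t : triangular l t -> triangular (l - alpha r) t.
Proof.
move=> [h k]; split=> [//|b v m bm lm].
by apply: k bm _ => x xQ _; apply: triangular_shift lm _ xQ.
Qed.

Lemma triangular_coef l r u d : uwt_ w u l ->
  triangular (l - alpha r) (fun b v => coef Pol u b * coef Pol d v).
Proof.
move=> ul; split=> [b v Z s|b v m bm lm]; first exact: pairM_E.
rewrite pairM_1 !pair_coef !hact1 !mul1mx (uwt_orth hq ul bm) ?mul0r //.
have := triangular_shift lm (in_posQ0 _).
by rewrite addr0 eq_sym.
Qed.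

(** Evaluation at 1 after acting by E_r becomes evaluation of [t] at E_r b and at E_r v; the first
    raises the weight of b by alpha_r, which the passage from l to l - alpha_r compensates. *)
Lemma triangular_ract l r t : triangular l t ->
  triangular (l - alpha r) (fun b v => ract (t b v) (EU r)).
Proof.
move=> [h k]; split=> [b v Z s|b v m bm lm]; rewrite !pair_ract.
  by rewrite mulrA h.
rewrite mulr1 -[EU r]mul1r h.
rewrite (k _ _ _ (uwt_E hq r bm)) ?(k _ _ _ bm) ?addr0 // => x xQ x0.
  by apply: triangular_shift lm _ xQ.
apply: contra (lm x xQ x0) => /eqP e.
by rewrite addrAC -e addrK.
Qed.

(** To pass from a word to a longer one, act by E_r on the identity for the vector u1 of the shorter
    word. On the left this gives the wanted sum with E_r^* u1, and c times the sum in which E_r^* is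
    applied to d instead; the latter is eliminated by the induction hypothesis. All that remains
    besides the main term is triangular. *)
Lemma rtt_descent s d : let u := gword (V := urep_of (V w)) s (xi w) in
  let l := val w - wsum s in
  exists2 tau, triangular l tau & forall b v rho, rtt b v rho ->
    \sum_a coef Pol d (e a) * coef Pol u (rho a) =
    coef Pol u b * coef Pol (hact w' (KU (- l)) *m d) v + tau b v.
Proof.
elim: s d => [|r s IH] d.
  exists (fun _ _ => 0) => [|b v rho h]; last by rewrite /wsum big_nil subr0 addr0; apply: h.
  by split=> [b v Z r|b v m _ _]; rewrite !pair0 ?addr0.
move=> u l; set u1 := gword (V := urep_of (V w)) s (xi w) in IH.
set l1 := val w - wsum s in IH.
have lE : l = l1 - alpha r by rewrite /l /l1 /wsum big_cons opprD addrCA addrC.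
have uE : u = hact w (star (EU r)) *m u1 by [].
have u1l : uwt_ w u1 l1 by apply: uwt_gword => //; exact: hvec_wt.
have [tau tauT tauE] := IH d.
have [tau' tau'T tau'E] := IH (hact w' (star (EU r)) *m d).
pose c := qpow q (ip (alpha r) l1).
pose k := hact w' (KU (- l1)).
exists (fun b v => ract (tau b v) (EU r)
  + coef Pol u1 b * coef Pol (hact w' (star (EU r)) *m (k *m d)) v
  + (- c)%:S * (coef Pol u1 b * coef Pol (k *m (hact w' (star (EU r)) *m d)) v)
  + (- c)%:S * tau' b v).
  rewrite lE; apply: triangularD; last by apply/triangularZ/triangular_mono.
  apply: triangularD; last by apply/triangularZ/triangular_coef.
  by apply: triangularD; [exact: triangular_ract|exact: triangular_coef].
move=> b v rho h.
have := congr1 (fun x => ract x (EU r)) (tauE b v rho h).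
rewrite ractD ract_mulE !ract_coef ract_sum KU_star -uE.
under eq_bigr => a _ do
  rewrite ract_mulE !ract_coef KU_star (u1l (alpha r)) coefZl qpow_conj -/c scalAC -uE.
rewrite big_split /= -mulr_sumr (tau'E b v rho h) -/k => E.
have -> : hact w' (KU (- l)) *m d = hact w' (KU (alpha r)) *m (k *m d).
  rewrite mulmxA -hactM -KUD; congr (hact _ (KU _) *m _).
  by rewrite lE opprB.
have zmodE (G : zmodType) (a1 a2 x y y1 y2 : G) :
    a1 + a2 + x = y + y1 + y2 -> x = y + (y2 + y1 - a1 - a2).
  move=> h'; apply: (addrI (a1 + a2)); rewrite h' addrCA -[y2 + y1 - _ - _]addrA.
  by rewrite -opprD [a1 + a2 + _]addrC subrK [y2 + y1]addrC addrA.
rewrite !scalN !mulNr; apply: zmodE.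
by rewrite -mulrDr E.
Qed.

Lemma coef_lowest_commute (eta : vec w) (d v : vec w') : uwt_ w eta (w0 (val w)) ->
  coef Pol (xi w) eta * coef Pol d v =
  coef Pol (hact w' (KU (val w)) *m d) (hact w' (KU (- w0 (val w))) *m v)
    * coef Pol (xi w) eta.
Proof.
move=> etaw; have [rho h] := rtt_exists eta v.
set k := hact w' (KU (- w0 (val w))).
(* Evaluating the descended identity at 1 turns coefficients into inner products and isolates that
   of u with rho_a. The [tau] term drops out: w_0 varpi = l + x with x in Q^+ nonzero would
   contradict that l lies above w_0 varpi. *)
have rhoE a : rho a = dot (k *m e a) v *: eta.
  apply: (dot_gwords_ext hq) => s.
  set u := gword _ _; set l := val w - wsum s.
  have [u0|u0] := eqVneq u 0; first by rewrite u0 !dot0l.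
  have ul : uwt_ w u l by apply: uwt_gword => //; exact: hvec_wt.
  have [tau [_ tau0] tauE] := rtt_descent s (e a).
  have := congr1 (fun x => pair x 1) (tauE _ _ _ h).
  rewrite pairD (tau0 _ _ _ etaw) ?addr0; last first.
    move=> x xQ x0; apply: contraNneq x0 => ex.
    apply/eqP/(in_posQ_anti (cartanP g) xQ).
    have := hwrep_lowest hq u0 ul.
    by rewrite ex opprD addrA subrr sub0r.
  rewrite pairM_1 pair_sum (bigD1 a) //= big1 ?addr0 => [|a' a'a].
    rewrite pairM_1 !pair_coef !hact1 !mul1mx dot_delta_l mxE !eqxx mul1r => ->.
    rewrite dotZr mulrC -/l; have [lw|lw] := eqVneq l (w0 (val w)); first by rewrite lw.
    by rewrite (uwt_orth hq ul etaw lw) !mulr0.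
  by rewrite pairM_1 !pair_coef !hact1 !mul1mx dot_delta_l mxE eq_sym (negPf a'a) mul0r.
have {}h d' : coef Pol (xi w) eta * coef Pol (hact w' (KU (- val w)) *m d') v =
    coef Pol d' (k *m v) * coef Pol (xi w) eta.
  rewrite -h [k *m v]cV_sum_delta.
  have -> : coef Pol d' (\sum_i (k *m v) i 0 *: e i) = \sum_i ((k *m v) i 0)%:S * coef Pol d' (e i).
    by apply: pair_inj => X; rewrite pair_sum pair_coef mulmx_sumr dot_sumr;
      apply: eq_bigr => i _; rewrite pair_scal pair_coef -scalemxAr dotZr.
  rewrite mulr_suml; apply: eq_bigr => a _.
  rewrite rhoE coefZr scalAC -mulrA; congr (_%:S * _).
  rewrite -dot_delta_l /k -{2}(KU_star q (- w0 _)).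
  by rewrite (@dot_starr _ _ _ (urep_of (V w'))).
rewrite -h; congr (_ * coef Pol _ _).
by rewrite mulmxA -hactM KUN hact1 mul1mx.
Qed.

End Pair.
End QCommutation.

Section StarCoef.
Variables (R : realType) (q : R) (g : lie_datum).
Notation C := R[i].
Notation KU := (@KU R q g).
Notation EU := (@EU R q g).
Variables (HU : Uqk_hopf q g) (V : forall w : domwt g, hwrep q (val w)).
Variable Pol : PolqK V HU.
Variable w : domwt g.
Notation n := (hdim (V w)).

(** The case of antimultiplicativity of the antipode that is needed for stars of coefficients, read
    off from the action of E_r on [Smx]. *)
Lemma antU_actE r X : hact (V w) (antU HU (EU r * X)) =
  - (hact (V w) (antU HU X) *m hact (V w) (EU r * KU (- alpha r))).
Proof.
have pS i j Z : pair (Smx Pol w i j) Z = hact (V w) (antU HU Z) i j.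
  by rewrite mxE pair_star dot_delta_l -colE mxE.
apply/matrixP=> i j; rewrite -pS -pair_ract.
have /matrixP/(_ i j) := rmx_SmxE Pol w r; rewrite [LHS]mxE => ->.
rewrite !mxE pairN pair_sum; congr (- _); apply: eq_bigr => k _.
by rewrite [smx _ _ _ _]mxE -scalC pair_scal pS mulrC.
Qed.

Lemma ract_star_coefE (d v : 'cV[C]_n) r : ract (star (coef Pol d v)) (EU r) =
  - star (coef Pol (hact (V w) (EU r * KU (- alpha r)) *m d) v).
Proof.
apply: pair_inj => X; rewrite pair_ract pairN !pair_star antU_actE.
by rewrite mulNmx dotNr mulmxA.
Qed.

End StarCoef.

(** * The two actions *)

Section FAKTheory.
Variables (R : realType) (q : R) (g : lie_datum).
Hypothesis hq : 0 < q < 1.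
Notation C := R[i].
Notation P := (wt g).
Notation I := (node g).
Notation KU := (@KU R q g).
Notation EU := (@EU R q g).
Notation FU := (@FU R q g).
Variables (HU : Uqk_hopf q g) (V : forall w : domwt g, hwrep q (val w)).
Variables (T : forall w : domwt g, I -> 'M[C]_(hdim (V w))) (Pol : PolqK V HU).
Notation A := (FAKext T Pol).
Notation jfun := (jfun T Pol).
Notation jpol := (@jpol R q g V HU T Pol).
Notation ju := (ju T Pol).
Notation hact w := (hact (V w)).
Implicit Types (f h : P -> C) (x y : Pol).

Definition jext (y : Polext T Pol) : A := pgen _ (GExt y).
Definition jb (w : P) : A := jext (pgen _ (Xb _ w)).

Lemma jfunM f h : jfun (fun z => f z * h z) = jfun f * jfun h.
Proof. by have := pclass_rel (AK_fmul T Pol f h); rewrite !pclassE. Qed.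
Lemma jfun_const c : jfun (fun _ => c) = c%:S.
Proof. by have := pclass_rel (AK_fscal T Pol c); rewrite !pclassE. Qed.
Lemma jfun_star f : star (jfun f) = jfun (fun z => Num.conj (f z)).
Proof. by have := pclass_rel (AK_fstar T Pol f); rewrite !pclassE. Qed.
Lemma jfunZ c f : c%:S * jfun f = jfun (fun z => c * f z).
Proof. by rewrite -jfun_const -jfunM. Qed.

Lemma jextD (y z : Polext T Pol) : jext (y + z) = jext y + jext z.
Proof. by have := pclass_rel (AK_xadd  y z); rewrite !pclassE. Qed.
Lemma jextM (y z : Polext T Pol) : jext (y * z) = jext y * jext z.
Proof. by have := pclass_rel (AK_xmul y z); rewrite !pclassE. Qed.
Lemma jext_scal c : jext c%:S = c%:S.
Proof. by have := pclass_rel (AK_xscal T Pol c); rewrite !pclassE. Qed.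
Lemma jext_star (y : Polext T Pol) : jext (star y) = star (jext y).
Proof. by have := pclass_rel (AK_xstar y); rewrite !pclassE. Qed.

Lemma jpolD x y : jpol (x + y) = jpol x + jpol y.
Proof.
rewrite -jextD; congr jext.
by have := pclass_rel (ext_add T x y); rewrite !pclassE.
Qed.
Lemma jpolM x y : jpol (x * y) = jpol x * jpol y.
Proof.
rewrite -jextM; congr jext.
by have := pclass_rel (ext_mul T x y); rewrite !pclassE.
Qed.
Lemma jpol_scal c : jpol c%:S = c%:S.
Proof.
rewrite -jext_scal; congr jext.
by have := pclass_rel (ext_scal T Pol c); rewrite !pclassE.
Qed.
Lemma jpol_star x : jpol (star x) = star (jpol x).
Proof.
rewrite -jext_star; congr jext.
by have := pclass_rel (ext_star T x); rewrite !pclassE.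
Qed.
Lemma jpolZ c x : jpol (c%:S * x) = c%:S * jpol x.
Proof. by rewrite jpolM jpol_scal. Qed.
Lemma jpolN x : jpol (- x) = - jpol x.
Proof. by rewrite -mulN1r -(@scal1 C Pol) -scalN jpolZ scalN scal1 mulN1r. Qed.
Lemma jpol0 : jpol 0 = 0.
Proof. by rewrite -(@scal0 C Pol) jpol_scal scal0. Qed.

Lemma ju0 : ju 0 = 1.
Proof.
rewrite -(@scal1 C A) -jext_scal; congr jext.
by have := pclass_rel (ext_u0 T Pol); rewrite !pclassE.
Qed.
Lemma juD w z : ju (w + z) = ju w * ju z.
Proof.
rewrite -jextM; congr jext.
by have := pclass_rel (ext_uM T Pol w z); rewrite !pclassE.
Qed.
Lemma jb0 : jb 0 = 1.
Proof.
rewrite -(@scal1 C A) -jext_scal; congr jext.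
by have := pclass_rel (ext_b0 T Pol); rewrite !pclassE.
Qed.
Lemma jbD w z : jb (w + z) = jb w * jb z.
Proof.
rewrite -jextM; congr jext.
by have := pclass_rel (ext_bM T Pol w z); rewrite !pclassE.
Qed.
Lemma ju_jpol w x : ju w * jpol x = jpol x * ju w.
Proof.
rewrite -!jextM; congr jext.
by have := pclass_rel (ext_ucentral T w (XPol x)); rewrite !pclassE.
Qed.
Lemma jpol_bw w : jpol (bw T Pol w) = ju (val w) * jb (val w).
Proof.
rewrite -jextM; congr jext.
by have := pclass_rel (ext_polar T Pol w); rewrite !pclassE.
Qed.

Lemma jfun_jpol f v (xi eta : 'cV[C]_(hdim (V v))) l : has_wt xi l ->
  jfun f * jpol (coef Pol xi eta) = jpol (coef Pol xi eta) * jfun (shift l f).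
Proof. by move=> h; have := pclass_rel (AK_pol T Pol f eta h); rewrite !pclassE. Qed.
Lemma jfun_ju f w : jfun f * ju w = ju w * jfun (shift w f).
Proof. by have := pclass_rel (AK_u T Pol f w); rewrite !pclassE. Qed.

Lemma shift_shift a b f : shift a (shift b f) = shift (a + b) f.
Proof.
apply: funext => x; rewrite /shift; congr f.
by rewrite opprD addrA.
Qed.
Lemma shift0 f : shift 0 f = f.
Proof. by apply: funext => x; rewrite /shift subr0. Qed.

Lemma alg_invP (B : pzAlgType C) (x y : B) : x * y = 1 -> y * x = 1 -> alg_inv x = y.
Proof.
move=> xy yx; rewrite /alg_inv; apply: xget_unique => //= z [xz zx].
by rewrite -[z]mulr1 -xy mulrA zx mul1r.
Qed.

(** The polar decomposition b = u |b| has invertible factors, so the default value of [alg_inv] does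
    not occur here. *)
Lemma bw_inv w : let b := jpol (bw T Pol w) in
  b * alg_inv b = 1 /\ alg_inv b * b = 1.
Proof.
move=> b; set l : P := val w.
have ub : b * (jb (- l) * ju (- l)) = 1.
  by rewrite /b jpol_bw mulrA -(mulrA (ju l)) -jbD addrN jb0 mulr1 -juD addrN ju0.
have bu : jb (- l) * ju (- l) * b = 1.
  by rewrite /b jpol_bw mulrA -(mulrA (jb (- l))) -juD addNr ju0 mulr1 -jbD addNr jb0.
by rewrite (alg_invP ub bu).
Qed.

(** The words applied to the highest weight vector are weight vectors and span; weight vectors are
    needed for commuting functions past coefficients. *)
Lemma pol_wt_ind (Q : Pol -> Prop) : Q 0 -> (forall x y, Q x -> Q y -> Q (x + y)) ->
  (forall c x, Q x -> Q (c%:S * x)) ->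
  (forall w (u v : 'cV[C]_(hdim (V w))) l, has_wt u l -> Q (coef Pol u v)) ->
  forall x, Q x.
Proof.
move=> Q0 QD QZ Qc; apply: pol_ind => // w u v.
elim: (hwrep_span hq u) => [|a u1 u2 [s ->] _ IH]; first by rewrite coef0l.
rewrite coefDl coefZl; apply: QD => //; apply: QZ.
exact: Qc (uwt_gword (V := urep_of (V w)) hq s (hvec_wt (V w))).
Qed.

(** Each term of T_r shifts the weight m by (a - b + c) alpha_r, and the summation condition makes
    this -m_r alpha_r, the shift of s_r. *)
Lemma eta_w0_wt (hT : is_lusztig T) w : has_wt (eta_w0 T w) (w0 (val w)).
Proof.
rewrite /eta_w0 /w0; apply: (uwt_Z (V := urep_of (V w))).
elim: (w0word g) => [|r s IH]; first exact: hvec_wt.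
rewrite weyl_cons /=; set v := foldr _ _ s in IH *; set m := weyl _ s _ in IH *.
rewrite (hT _ _ _ _ IH).
have sumP J (t : seq J) (Q : pred J) (F : J -> 'cV[C]_(hdim (V w))) n :
    (forall j, Q j -> uwt (V := urep_of (V w)) (F j) n) ->
    uwt (V := urep_of (V w)) (\sum_(j <- t | Q j) F j) n.
  move=> h; elim/big_ind: _ => //; first exact: uwt_0.
  by move=> ? ?; apply: uwt_D.
apply: (sumP) => a _; apply: (sumP) => b _; apply: (sumP) => c /eqP abc.
apply: uwt_Z.
have wX (X : Uqk q g) (z : P) k (u : 'cV[C]_(hdim (V w))) n :
    (forall u n, uwt (V := urep_of (V w)) u n ->
       uwt (V := urep_of (V w)) (hact w X *m u) (n + z)) ->
    uwt (V := urep_of (V w)) u n ->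
    uwt (V := urep_of (V w)) (hact w (X ^+ k) *m u) (n + k%:Z *: z).
  move=> hX un; elim: k => [|k IHk].
    by rewrite expr0 hact1 mul1mx scale0r addr0.
  rewrite exprS hactM -mulmxA -[k.+1]addn1 PoszD scalerDl scale1r addrA.
  exact: hX IHk.
have wE := wX (EU r) (alpha r) _ _ _ (@uwt_E _ _ _ hq (urep_of (V w)) r).
have wF := wX (FU r) (- alpha r) _ _ _ (@uwt_F _ _ _ hq (urep_of (V w)) r).
rewrite !hactM -!mulmxA.
have := wE a _ _ (wF b _ _ (wE c _ _ IH)); congr (uwt _ _).
rewrite /simple_refl -abc; apply/rowP=> t; rewrite !mxE; ring.
Qed.

End FAKTheory.

Section AlgHomTheory.
Variables (C : numClosedFieldType) (A B : pzAlgType C) (f : A -> B).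
Hypothesis fh : alg_hom f.

Lemma alg_homD x y : f (x + y) = f x + f y. Proof. by case: fh. Qed.
Lemma alg_homM x y : f (x * y) = f x * f y. Proof. by case: fh. Qed.
Lemma alg_hom_scal c : f c%:S = c%:S. Proof. by case: fh. Qed.
Lemma alg_homZ c x : f (c%:S * x) = c%:S * f x.
Proof. by rewrite alg_homM alg_hom_scal. Qed.
Lemma alg_hom0 : f 0 = 0.
Proof. by rewrite -(@scal0 C A) alg_hom_scal scal0. Qed.
Lemma alg_hom1 : f 1 = 1.
Proof. by rewrite -(@scal1 C A) alg_hom_scal scal1. Qed.
Lemma alg_homN x : f (- x) = - f x.
Proof. by apply/eqP; rewrite -addr_eq0 -alg_homD addNr alg_hom0. Qed.
End AlgHomTheory.

Section TensPure.
Variables (C : numClosedFieldType) (A B : pzAlgType C).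
Implicit Types (a : A) (b : B).

Lemma pureM a a' b b' : pure a b * pure a' b' = pure (a * a') (b * b').
Proof. exact: tmul_pure. Qed.
Lemma pure0r a : pure a 0 = 0 :> tens A B.
Proof. by apply: (@addrI _ (pure a (0 : B))); rewrite -pureDr !addr0. Qed.
Lemma pure_scalE (c : C) : pure c%:S 1 = c%:S :> tens A B.
Proof. by []. Qed.
End TensPure.

(** * The Galois object and the adjoint action on generators *)

Section Galois.
Variables (R : realType) (q : R) (g : lie_datum).
Notation C := R[i].
Notation U0 := (U0 q g).
Notation Up := (Up q g).
Notation P := (wt g).
Notation I := (node g).
Notation K0 := (@K0 R q g).
Notation L0 := (@L0 R q g).
Notation E0 := (@E0 R q g).
Notation F0 := (@F0 R q g).
Notation KP := (@KP R q g).
Notation LP := (@LP R q g).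
Notation EP := (@EP R q g).
Notation FP := (@FP R q g).

Lemma K0_0 : K0 0 = 1.
Proof. by have := pclass_rel (U0_borel (B_K0 q g)); rewrite !pclassE. Qed.
Lemma K0_D w x : K0 (w + x) = K0 w * K0 x.
Proof. by have := pclass_rel (U0_borel (B_KK q w x)); rewrite !pclassE. Qed.
Lemma L0_0 : L0 0 = 1.
Proof. by have := pclass_rel (U0_borel (B_L0 q g)); rewrite !pclassE. Qed.
Lemma L0_D w x : L0 (w + x) = L0 w * L0 x.
Proof. by have := pclass_rel (U0_borel (B_LL q w x)); rewrite !pclassE. Qed.
Lemma L0_F w r : L0 w * F0 r = (qpow q (- ip w (alpha r)))%:S * (F0 r * L0 w).
Proof. by have := pclass_rel (U0_borel (B_LF q w r)); rewrite !pclassE. Qed.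
Lemma K0_star w : star (K0 w) = L0 w.
Proof. by have := pclass_rel (U0_borel (B_Kstar q w)); rewrite !pclassE. Qed.
Lemma E0_star r : star (E0 r) = F0 r * L0 (alpha r).
Proof. by have := pclass_rel (U0_borel (B_Estar q r)); rewrite !pclassE. Qed.
Lemma LP_0 : LP 0 = 1.
Proof. by have := pclass_rel (Up_borel (B_L0 q g)); rewrite !pclassE. Qed.
Lemma LP_D w x : LP (w + x) = LP w * LP x.
Proof. by have := pclass_rel (Up_borel (B_LL q w x)); rewrite !pclassE. Qed.
Lemma KP_star w : star (KP w) = LP w.
Proof. by have := pclass_rel (Up_borel (B_Kstar q w)); rewrite !pclassE. Qed.
Lemma EP_star r : star (EP r) = FP r * LP (alpha r).
Proof. by have := pclass_rel (Up_borel (B_Estar q r)); rewrite !pclassE. Qed.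

Lemma Up_ind (Q : Up -> Prop) : (forall w, Q (KP w)) -> (forall w, Q (LP w)) ->
  (forall r, Q (EP r)) -> (forall r, Q (FP r)) -> (forall c, Q c%:S) ->
  (forall X Y, Q X -> Q Y -> Q (X + Y)) -> (forall X Y, Q X -> Q Y -> Q (X * Y)) ->
  forall X, Q X.
Proof.
move=> QK QL QE QF Qc QD QM.
have FE r : FP r = star (EP r) * LP (- alpha r).
  by rewrite EP_star -mulrA -LP_D addrN LP_0 mulr1.
apply: presented_ind => //; case=> [w|w|r|r].
- exact: QK.
- exact: QL.
- exact: QE.
- exact: QF.
- by rewrite -/(KP w) KP_star.
- by rewrite -/(LP w) -KP_star starK.
- by rewrite -/(EP r) EP_star; apply: QM.
- by rewrite -/(FP r) FE starM starK -KP_star starK; apply: QM.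
Qed.

Lemma UCP_0 : UCP R (0 : P) = 1.
Proof. by have := pclass_rel (CP_0 R g); rewrite !pclassE. Qed.
Lemma UCP_D (w x : P) : UCP R (w + x) = UCP R w * UCP R x.
Proof. by have := pclass_rel (CP_M R w x); rewrite !pclassE. Qed.

Variables (coact : U0 -> tens U0 Up) (hcoact : is_coaction coact).
Variable caninv : tens U0 Up -> tens U0 U0.
Hypothesis hcan : cancel (can coact) caninv.
Hypothesis hcan' : cancel caninv (can coact).

Let coact_hom : alg_hom coact. Proof. by case: hcoact. Qed.

Let can_lin :
  [/\ forall b : U0, {morph (fun a : U0 => pure a 1 * coact b) : x y / x + y},
      forall a : U0, {morph (fun b : U0 => pure a 1 * coact b) : x y / x + y}
    & forall (c : C) (a b : U0), pure (c%:S * a) 1 * coact b = pure a 1 * coact (c%:S * b)].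
Proof.
split=> [b x y|a x y|c a b].
- by rewrite pureDl mulrDl.
- by rewrite (alg_homD coact_hom) mulrDr.
rewrite (alg_homZ coact_hom) scalAC mulrA; congr (_ * _).
by rewrite -pure_scalE pureM mulr1.
Qed.

Lemma canD x y : can coact (x + y) = can coact x + can coact y.
Proof. by have [h1 h2 h3] := can_lin; exact: tliftD. Qed.
Lemma can_pure a b : can coact (pure a b) = pure a 1 * coact b.
Proof. by have [h1 h2 h3] := can_lin; exact: tlift_pure. Qed.
Lemma can0 : can coact 0 = 0.
Proof. by have [h1 h2 h3] := can_lin; exact: tlift0. Qed.
Lemma caninvD x y : caninv (x + y) = caninv x + caninv y.
Proof. by rewrite -[RHS]hcan canD !hcan'. Qed.

Lemma caninv_K w : caninv (pure 1 (KP w)) = pure (K0 (- w)) (K0 w).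
Proof.
rewrite -[RHS]hcan can_pure; case: hcoact => _ /(_ w)[-> _] _ _.
by rewrite pureM -K0_D addNr K0_0 mul1r.
Qed.
Lemma caninv_L w : caninv (pure 1 (LP w)) = pure (L0 (- w)) (L0 w).
Proof.
rewrite -[RHS]hcan can_pure; case: hcoact => _ /(_ w)[_ ->] _ _.
by rewrite pureM -L0_D addNr L0_0 mul1r.
Qed.
(** In the coaction of E_r the term E_r (x) K_{alpha_r} must be removed; its preimage under [can] is
    E_r K_{-alpha_r} (x) K_{alpha_r}. *)
Lemma caninv_E r : caninv (pure 1 (EP r)) =
  pure (- (E0 r * K0 (- alpha r))) (K0 (alpha r)) + pure 1 (E0 r).
Proof.
rewrite -[RHS]hcan canD !can_pure.
case: hcoact => _ /(_ (alpha r))[-> _] /(_ r) -> _.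
rewrite mulrDr !pureM !mul1r mulNr -mulrA -K0_D addNr K0_0 mulr1.
by rewrite addrA -pureDl addNr pure0l add0r.
Qed.
Lemma caninv_F r : caninv (pure 1 (FP r)) =
  pure (- (L0 (alpha r) * F0 r)) 1 + pure (L0 (alpha r)) (F0 r).
Proof.
rewrite -[RHS]hcan canD !can_pure (alg_hom1 coact_hom) mulr1.
case: hcoact => _ _ _ /(_ r) ->.
rewrite mulrDr !pureM !mul1r -L0_D addrN L0_0.
by rewrite addrA -pureDl addNr pure0l add0r.
Qed.
Lemma caninv_scal c : caninv (pure 1 c%:S) = pure c%:S 1.
Proof.
rewrite -[RHS]hcan can_pure (alg_hom1 coact_hom) mulr1; congr caninv.
by have := pure_scal c (1 : U0) (1 : Up); rewrite !mulr1.
Qed.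

(* (h k)^[1] (x) (h k)^[2] = k^[1] h^[1] (x) h^[2] k^[2] *)
Lemma caninv_M h k : caninv (pure 1 (h * k)) =
  tlift (fun a' b' => tlift (fun a b => pure (a' * a) (b * b')) (caninv (pure 1 h)))
        (caninv (pure 1 k)).
Proof.
rewrite -[RHS]hcan; congr caninv.
set t := caninv (pure 1 h); set t' := caninv (pure 1 k).
(* For s = h^[1] (x) h^[2] the middle factor is 1 (x) h, which commutes with a' (x) 1; it can thus
   be pulled to the left, leaving [can] of k^[1] (x) k^[2]. *)
have canM_pure a' b' (s : tens U0 U0) :
    can coact (tlift (fun a b => pure (a' * a) (b * b')) s) =
    pure a' 1 * can coact s * coact b'.
  have l1 b : {morph (fun a => pure (a' * a) (b * b')) : x y / x + y}.
    by move=> x y; rewrite mulrDr pureDl.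
  have l2 a : {morph (fun b => pure (a' * a) (b * b')) : x y / x + y}.
    by move=> x y; rewrite mulrDl pureDr.
  have l3 (c : C) a b : pure (a' * (c%:S * a)) (b * b') = pure (a' * a) (c%:S * b * b').
    by rewrite scalAC -mulrA pure_scal.
  elim/tens_ind: s => [a b||x y IHx IHy].
  - rewrite tlift_pure // !can_pure (alg_homM coact_hom) !mulrA pureM mulr1.
    by [].
  - by rewrite tlift0 // can0 mulr0 mul0r.
  - by rewrite tliftD // !canD IHx IHy mulrDr mulrDl.
rewrite (tlift_morph (phi := can coact)); [|exact: can0|exact: canD].
rewrite (eq_tlift (h := fun a b => pure 1 h * (pure a 1 * coact b))); last first.
  move=> a b; rewrite canM_pure hcan' pureM mulr1 mul1r.
  by rewrite mulrA pureM mulr1 mul1r.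
rewrite -(tlift_morph (phi := fun z => pure 1 h * z)); first last.
- by move=> x y; rewrite mulrDr.
- by rewrite mulr0.
by rewrite -/(can coact t') hcan' pureM mulr1.
Qed.

Section Adjoint.
Variables (HU : Uqk_hopf q g) (V : forall w : domwt g, hwrep q (val w)).
Variables (T : forall w : domwt g, I -> 'M[C]_(hdim (V w))) (Pol : PolqK V HU).
Notation A := (FAKext T Pol).
Variable p : U0 -> A.
Hypothesis hp : star_hom p.
Notation adj := (adjoint p caninv).

Let ph : alg_hom p. Proof. by case: hp. Qed.

Let adj_lin (y : A) :
  [/\ forall b : U0, {morph (fun a : U0 => p a * y * p b) : u v / u + v},
      forall a : U0, {morph (fun b : U0 => p a * y * p b) : u v / u + v}
    & forall (c : C) (a b : U0), p (c%:S * a) * y * p b = p a * y * p (c%:S * b)].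
Proof.
split=> [b u v|a u v|c a b].
- by rewrite (alg_homD ph) !mulrDl.
- by rewrite (alg_homD ph) !mulrDr.
- by rewrite !(alg_homZ ph) scalAC !mulrA.
Qed.

Lemma adjDl y z h : adj (y + z) h = adj y h + adj z h.
Proof.
rewrite /adjoint /tlift -big_split; apply: eq_bigr => t _.
by rewrite mulrDr mulrDl.
Qed.
Lemma adj0l h : adj 0 h = 0.
Proof. by apply: (@addrI _ (adj 0 h)); rewrite -adjDl !addr0. Qed.
Lemma adjZl c y h : adj (c%:S * y) h = c%:S * adj y h.
Proof.
rewrite /adjoint /tlift mulr_sumr; apply: eq_bigr => t _.
by rewrite scalAC !mulrA.
Qed.
Lemma adj_suml J (s : seq J) (F : J -> A) h :
  adj (\sum_(j <- s) F j) h = \sum_(j <- s) adj (F j) h.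
Proof. by apply: (big_morph (fun y => adj y h)); [move=> ? ?; exact: adjDl|exact: adj0l]. Qed.
Lemma adjDr y h k : adj y (h + k) = adj y h + adj y k.
Proof.
have [h1 h2 h3] := adj_lin y.
by rewrite /adjoint pureDr caninvD tliftD.
Qed.
Lemma adjM y h k : adj y (h * k) = adj (adj y h) k.
Proof.
rewrite /adjoint caninv_M.
have [h1 h2 h3] := adj_lin y.
rewrite (tlift_morph (phi := tlift (fun a b => p a * y * p b))); first last.
- by move=> u v; rewrite tliftD.
- by rewrite tlift0.
apply: eq_tlift => a' b'.
rewrite (tlift_morph (phi := tlift (fun a b => p a * y * p b))); first last.
- by move=> u v; rewrite tliftD.
- by rewrite tlift0.
rewrite (tlift_morph (phi := fun z => p a' * z * p b')); first last.
- by move=> u v; rewrite mulrDr mulrDl.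
- by rewrite mulr0 mul0r.
apply: eq_tlift => a b; rewrite tlift_pure // !(alg_homM ph).
by rewrite !mulrA.
Qed.
Lemma adj_K y w : adj y (KP w) = p (K0 (- w)) * y * p (K0 w).
Proof. by have [h1 h2 h3] := adj_lin y; rewrite /adjoint caninv_K tlift_pure. Qed.
Lemma adj_L y w : adj y (LP w) = p (L0 (- w)) * y * p (L0 w).
Proof. by have [h1 h2 h3] := adj_lin y; rewrite /adjoint caninv_L tlift_pure. Qed.
Lemma adj_E y r : adj y (EP r) = y * p (E0 r) - p (E0 r) * adj y (KP (alpha r)).
Proof.
have [h1 h2 h3] := adj_lin y.
rewrite adj_K /adjoint caninv_E tliftD // !tlift_pure // (alg_hom1 ph) mul1r.
by rewrite (alg_homN ph) (alg_homM ph) !mulNr addrC !mulrA.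
Qed.
Lemma adj_F y r : adj y (FP r) =
  p (L0 (alpha r)) * y * p (F0 r) - p (L0 (alpha r)) * p (F0 r) * y.
Proof.
have [h1 h2 h3] := adj_lin y.
rewrite /adjoint caninv_F tliftD // !tlift_pure // (alg_hom1 ph) mulr1.
by rewrite (alg_homN ph) (alg_homM ph) !mulNr addrC.
Qed.
Lemma adj_scal y c : adj y c%:S = c%:S * y.
Proof.
have [h1 h2 h3] := adj_lin y.
by rewrite /adjoint caninv_scal tlift_pure // (alg_hom1 ph) mulr1 (alg_hom_scal ph).
Qed.

End Adjoint.
End Galois.

(** * Comparison of the two actions *)

Section Main.
Variables (R : realType) (q : R).
Hypothesis hq : 0 < q < 1.
Variable g : lie_datum.
Notation C := R[i].
Notation P := (wt g).
Notation I := (node g).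
Notation U0 := (U0 q g).
Notation Up := (Up q g).
Notation Uqk := (Uqk q g).
Notation KU := (@KU R q g).
Notation EU := (@EU R q g).
Notation FU := (@FU R q g).
Notation K0 := (@K0 R q g).
Notation L0 := (@L0 R q g).
Notation E0 := (@E0 R q g).
Notation F0 := (@F0 R q g).
Notation KP := (@KP R q g).
Notation LP := (@LP R q g).
Notation EP := (@EP R q g).
Notation FP := (@FP R q g).
Variable HU : Uqk_hopf q g.
Variable V : forall w : domwt g, hwrep q (val w).
Variable T : forall w : domwt g, I -> 'M[C]_(hdim (V w)).
Hypothesis hT : is_lusztig T.
Variable Pol : PolqK V HU.
Variables (D : Up -> tens Up Up) (hD : is_copUp D).
Variables (pik : Up -> Uqk) (hpik : is_pik pik).
Variables (pia : Up -> CP R g) (hpia : is_pia pia).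
Variables (coact : U0 -> tens U0 Up) (hcoact : is_coaction coact).
Variable caninv : tens U0 Up -> tens U0 U0.
Hypothesis hcan : cancel (can coact) caninv.
Hypothesis hcan' : cancel caninv (can coact).
Variable tr : FAKext T Pol -> Up -> FAKext T Pol.
Hypothesis htr : is_translation D pik pia tr.
Variables (p : U0 -> FAKext T Pol) (hp : is_pi tr p).
Notation A := (FAKext T Pol).
Notation jfun := (jfun T Pol).
Notation jpol := (@jpol R q g V HU T Pol).
Notation ju := (ju T Pol).
Notation hact w := (hact (V w)).
Notation adj := (adjoint p caninv).

Let p_star : star_hom p. Proof. by case: hp. Qed.
Let p_hom : alg_hom p. Proof. by case: p_star. Qed.
Let D_hom : alg_hom D. Proof. by case: hD. Qed.
Let pik_hom : alg_hom pik. Proof. by case: hpik. Qed.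
Let pia_hom : alg_hom pia. Proof. by case: hpia. Qed.

(** The premise under which [is_translation] prescribes the values of [tr] at X. *)
Definition decomposes (X : Up) (Y : seq (Uqk * P)) : Prop :=
  tlift (fun a b => pure (pik a) (pia b)) (D X) = \sum_(y <- Y) pure y.1 (UCP R y.2).

Let dec_lin :
  [/\ forall b : Up, {morph (fun a : Up => pure (pik a) (pia b)) : x y / x + y},
      forall a : Up, {morph (fun b : Up => pure (pik a) (pia b)) : x y / x + y}
    & forall (c : C) (a b : Up), pure (pik (c%:S * a)) (pia b) = pure (pik a) (pia (c%:S * b))].
Proof.
split=> [b x y|a x y|c a b].
- by rewrite (alg_homD pik_hom) pureDl.
- by rewrite (alg_homD pia_hom) pureDr.
- by rewrite (alg_homZ pik_hom) (alg_homZ pia_hom) pure_scal.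
Qed.

Lemma decomposesD X1 X2 Y1 Y2 : decomposes X1 Y1 -> decomposes X2 Y2 ->
  decomposes (X1 + X2) (Y1 ++ Y2).
Proof.
have [h1 h2 h3] := dec_lin; move=> d1 d2.
by rewrite /decomposes (alg_homD D_hom) tliftD // d1 d2 big_cat.
Qed.

Lemma decomposesM X1 X2 Y1 Y2 : decomposes X1 Y1 -> decomposes X2 Y2 ->
  decomposes (X1 * X2) [seq (y1.1 * y2.1, y1.2 + y2.2) | y1 <- Y1, y2 <- Y2].
Proof.
have [h1 h2 h3] := dec_lin; move=> d1 d2.
rewrite /decomposes (alg_homM D_hom) big_allpairs_dep /=.
transitivity (tlift (fun a b => pure (pik a) (pia b)) (D X1)
    * tlift (fun a b => pure (pik a) (pia b)) (D X2)); last first.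
  rewrite d1 d2 mulr_suml; apply: eq_bigr => y1 _.
  rewrite mulr_sumr; apply: eq_bigr => y2 _.
  by rewrite pureM UCP_D.
elim/tens_ind: (D X1) => [a b||x y IHx IHy].
- elim/tens_ind: (D X2) => [a' b'||x y IHx IHy].
  + by rewrite pureM !tlift_pure // (alg_homM pik_hom) (alg_homM pia_hom) pureM.
  + by rewrite mulr0 !tlift0 // mulr0.
  + by rewrite mulrDr !tliftD // IHx IHy mulrDr.
- by rewrite mul0r !tlift0 // mul0r.
- by rewrite mulrDl !tliftD // IHx IHy mulrDl.
Qed.

Lemma decomposes_scal c : decomposes c%:S [:: (c%:S, 0)].
Proof.
have [h1 h2 h3] := dec_lin.
rewrite /decomposes big_seq1 (alg_hom_scal D_hom) -pure_scalE tlift_pure //.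
by rewrite (alg_hom_scal pik_hom) (alg_hom1 pia_hom) UCP_0.
Qed.

Lemma decomposesK w : decomposes (KP w) [:: (KU w, w)].
Proof.
have [h1 h2 h3] := dec_lin; case: hpik => _ kK _ _ _; case: hpia => _ aK _ _ _.
rewrite /decomposes big_seq1; case: hD => _ /(_ w)[-> _] _ _.
by rewrite tlift_pure // kK aK.
Qed.
Lemma decomposesL w : decomposes (LP w) [:: (KU w, - w)].
Proof.
have [h1 h2 h3] := dec_lin; case: hpik => _ _ kL _ _; case: hpia => _ _ aL _ _.
rewrite /decomposes big_seq1; case: hD => _ /(_ w)[_ ->] _ _.
by rewrite tlift_pure // kL aL.
Qed.
Lemma decomposesE r : decomposes (EP r) [:: (EU r, alpha r)].
Proof.
have [h1 h2 h3] := dec_lin; case: hpik => _ _ _ kE _; case: hpia => _ aK _ aE _.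
rewrite /decomposes big_seq1; case: hD => _ _ /(_ r) -> _.
by rewrite tliftD // !tlift_pure // kE aK aE pure0r addr0.
Qed.
Lemma decomposesF r : decomposes (FP r) [:: (FU r, 0)].
Proof.
have [h1 h2 h3] := dec_lin; case: hpik => _ _ _ _ kF; case: hpia => ah _ _ _ aF.
rewrite /decomposes big_seq1; case: hD => _ _ _ /(_ r) ->.
by rewrite tliftD // !tlift_pure // kF (alg_hom1 ah) aF pure0r addr0 UCP_0.
Qed.

Definition translate (Y : seq (Uqk * P)) (x : Pol) (f : P -> C) : A :=
  \sum_(y <- Y) jpol (ract x y.1) * jfun (shift (- y.2) f).

Lemma jpol_jfun1 x : jpol x = jpol x * jfun (fun _ => 1).
Proof. by rewrite jfun_const scal1 mulr1. Qed.

Lemma pE0 r : let b := jpol (bw T Pol (fundw r)) in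
  p (E0 r) = (toC (1 - qr q r ^+ 2)^-1)%:S * alg_inv b * jpol (ract (bw T Pol (fundw r)) (EU r)).
Proof.
case: hp => _ _ _ /(_ r) -> _; rewrite /er; congr (_ * _).
(* [tr] is prescribed on products x f, so b is taken with the constant function 1, which shifts
   leave unchanged. *)
have := htr (decomposesE r) (fun _ : 'I_1 => bw T Pol (fundw r)) (fun _ _ => 1).
by rewrite !big_ord1 big_seq1 -jpol_jfun1 => ->; rewrite /shift -jpol_jfun1.
Qed.

Lemma translate0 Y f : translate Y 0 f = 0.
Proof. by rewrite /translate big1 // => y _; rewrite ract0 jpol0 mul0r. Qed.
Lemma translateD Y x y f : translate Y (x + y) f = translate Y x f + translate Y y f.
Proof.
rewrite /translate -big_split; apply: eq_bigr => z _.
by rewrite ractD jpolD mulrDl.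
Qed.
Lemma translateZ Y c x f : translate Y (c%:S * x) f = c%:S * translate Y x f.
Proof.
rewrite /translate mulr_sumr; apply: eq_bigr => z _.
by rewrite ract_scal jpolZ mulrA.
Qed.

Lemma translate_wt X Y f :
  (forall v (d e : 'cV[C]_(hdim (V v))) l, has_wt d l ->
     adj (jpol (coef Pol d e) * jfun f) X = translate Y (coef Pol d e) f) ->
  forall x, adj (jpol x * jfun f) X = translate Y x f.
Proof.
move=> h; apply: (pol_wt_ind hq) => [|x y hx hy|c x hx|//].
- by rewrite jpol0 mul0r adj0l translate0.
- by rewrite jpolD mulrDl adjDl hx hy translateD.
- by rewrite jpolZ -mulrA adjZl hx translateZ.
Qed.

(* The factor q^(w, w) that arises from moving u_w past z_w cancels the
   normalizations q^(- (w, w) / 2) of k_w and k_(- w). *)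
Lemma adj_KP x f w : adj (jpol x * jfun f) (KP w) = translate [:: (KU w, w)] x f.
Proof.
move: x; apply: translate_wt => v d e l dl; set x := coef Pol d e.
rewrite /translate big_seq1 /= (adj_K hcoact hcan p_star).
case: hp => _ pK _ _ _; rewrite !pK {pK}.
rewrite ract_coef KU_star dl coefZl qpow_conj jpolZ -/x.
rewrite /kw ipNl ipNr !opprK.
set c := qpow q (- (ip w w / 2)).
have -> : c%:S * jfun (zw q (- w)) * ju w * (jpol x * jfun f)
    * (c%:S * jfun (zw q w) * ju (- w)) =
    (c * c)%:S * (jpol x * (jfun (shift l (zw q (- w)))
      * jfun (shift (- w) (fun y => f y * zw q w y)))).
  rewrite -!mulrA !scalAC scalMA; congr (_ * _).
  rewrite (mulrA (jfun f)) -jfunM (mulrA (ju w)) ju_jpol.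
  rewrite jfun_ju -!mulrA (mulrA (ju w)) -juD addrN ju0 mul1r.
  by rewrite !mulrA (jfun_jpol _ _ _ _ dl).
rewrite -jfunM -scalAC jfunZ -mulrA -scalAC jfunZ.
congr (_ * Defs.jfun _ _ _); apply: funext => y.
rewrite /shift /zw opprK.
suff <- : c * c * qpow q (ip (- w) (y - l)) * qpow q (ip w (y + w)) =
    qpow q (ip w l) by ring.
rewrite /c -!(qpowD hq); congr qpow.
by rewrite !(ipNl, ipNr, ipDl, ipDr); lra.
Qed.

Lemma adj_LP x f w : adj (jpol x * jfun f) (LP w) = translate [:: (KU w, - w)] x f.
Proof.
move: x; apply: translate_wt => v d e l dl; set x := coef Pol d e.
rewrite /translate big_seq1 /= (adj_L hcoact hcan p_star) opprK.
case: hp => _ _ pL _ _; rewrite !pL {pL}.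
rewrite ract_coef KU_star dl coefZl qpow_conj jpolZ -/x.
rewrite /lw ipNl ipNr !opprK.
set c := qpow q (- (ip w w / 2)).
have -> : c%:S * ju (- w) * jfun (zw q (- w)) * (jpol x * jfun f)
    * (c%:S * ju w * jfun (zw q w)) =
    (c * c)%:S * (jpol x * (jfun (shift w (shift l (zw q (- w))))
      * (jfun (shift w f) * jfun (zw q w)))).
  rewrite -!mulrA !scalAC scalMA; congr (_ * _).
  rewrite (mulrA (jfun f)) jfun_ju (mulrA (jfun (zw q (- w)))) (jfun_jpol _ _ _ _ dl).
  rewrite -!mulrA (mulrA (jfun _) (ju w)) jfun_ju !mulrA ju_jpol.
  by rewrite -(mulrA (jpol x) (ju _)) -juD addNr ju0 mulr1.
rewrite -!jfunM -scalAC jfunZ -mulrA -scalAC jfunZ.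
congr (_ * Defs.jfun _ _ _); apply: funext => y.
rewrite /shift /zw.
suff <- : c * c * qpow q (ip (- w) (y - w - l)) * qpow q (ip w y) =
    qpow q (ip w l) by ring.
rewrite /c -!(qpowD hq); congr qpow.
by rewrite !(ipNl, ipNr, ipDl, ipDr); lra.
Qed.

(** Acting by E_r on sx b = b x yields (sx <| E_r)(b <| K_{alpha_r}) on the left, besides the term
    sought. This equals q_r^2 b (x <| E_r), one q_r coming from K_{alpha_r} on b and one from moving
    E_r^* past K_{varpi_r}; against the term b (x <| E_r) on the right it leaves the factor 1 -
    q_r^2 that e_r is normalized by. *)
Lemma bw_ract r v (d e : 'cV[C]_(hdim (V v))) l (b := bw T Pol (fundw r))
    (sx := coef Pol (hact v (KU (fund r)) *m d) (hact v (KU (- w0 (fund r))) *m e)) :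
  has_wt d l ->
  sx * b = b * coef Pol d e /\
  sx * ract b (EU r) = (qpow q (ip (alpha r) l))%:S * (ract b (EU r) * coef Pol d e)
    + (1 - toC (qr q r) ^+ 2)%:S * (b * ract (coef Pol d e) (EU r)).
Proof.
move=> dl; set x := coef Pol d e.
have comm v' (d' e' : 'cV[C]_(hdim (V v'))) : b * coef Pol d' e' =
    coef Pol (hact v' (KU (fund r)) *m d') (hact v' (KU (- w0 (fund r))) *m e') * b.
  exact: (coef_lowest_commute hq Pol d' e' (eta_w0_wt hq hT (fundw r))).
split; first by rewrite comm.
have ra : ip (fund r) (alpha r) = ip (alpha r) (alpha r) / 2 by exact: ip_fund_alpha.
have q2 : toC (qr q r) ^+ 2 = qpow q (ip (fund r) (alpha r)) * qpow q (ip (fund r) (alpha r)).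
  by rewrite ra -qr_qpow expr2.
have xK : ract x (KU (alpha r)) = (qpow q (ip (alpha r) l))%:S * x.
  by rewrite ract_coef KU_star dl coefZl qpow_conj.
have bK : ract b (KU (alpha r)) = (qpow q (ip (fund r) (alpha r)))%:S * b.
  rewrite ract_coef KU_star (hvec_wt (V (fundw r))) coefZl qpow_conj.
  by rewrite ip_sym.
have sxE : ract sx (EU r) * b = (qpow q (ip (fund r) (alpha r)))%:S
    * (b * ract x (EU r)).
  rewrite [ract x _]ract_coef comm ract_coef.
  have -> : hact v (star (EU r)) *m (hact v (KU (fund r)) *m d) =
      qpow q (ip (fund r) (alpha r)) *:
        (hact v (KU (fund r)) *m (hact v (star (EU r)) *m d)).
    have e1 : star (EU r) * KU (fund r) =
        (qpow q (ip (fund r) (alpha r)))%:S * (KU (fund r) * star (EU r)).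
      rewrite EU_star (mulrA (KU (fund r))) KUF -!mulrA scalMA [_ * qpow _ _]mulrC -!KUD.
      by rewrite (qpowNM hq) scal1 mul1r addrC.
    by rewrite !mulmxA -!hactM e1 [in LHS]hactM hact_scal mul_scalar_mx -scalemxAl.
  by rewrite coefZl qpow_conj mulrA.
have := congr1 (fun z => ract z (EU r)) (comm v d e).
rewrite !ract_mulE -/sx -/x xK bK scalAC => E.
have -> : sx * ract b (EU r) = (qpow q (ip (alpha r) l))%:S * (ract b (EU r) * x)
    + b * ract x (EU r) - ract sx (EU r) * ((qpow q (ip (fund r) (alpha r)))%:S * b).
  by rewrite E addrAC subrr add0r.
rewrite scalAC sxE scalMA -q2 -addrA scalD scalN scal1 mulrDl mul1r mulNr.
by [].
Qed.

Lemma adj_EP x f r : adj (jpol x * jfun f) (EP r) = translate [:: (EU r, alpha r)] x f.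
Proof.
move: x; apply: translate_wt => v d e l dl; set x := coef Pol d e.
rewrite (adj_E hcoact hcan p_star) adj_KP /translate !big_seq1 /=.
rewrite [ract x (KU _)]ract_coef KU_star dl coefZl qpow_conj jpolZ -/x.
rewrite pE0; set b := bw T Pol (fundw r); set B := alg_inv (jpol b).
set c := (toC _)%:S; set bE := ract b (EU r).
have [bB Bb] := bw_inv T Pol (fundw r); rewrite -/b -/B in bB Bb.
(* The inverse of b contributes weight -varpi_r and b <| E_r contributes varpi_r - alpha_r, so e_r
   has weight -alpha_r. *)
have fe : jfun f * (c * B * jpol bE) = c * B * jpol bE * jfun (shift (- alpha r) f).
  have bwt : has_wt (hvec (V (fundw r))) (fund r) by exact: hvec_wt.
  have bEwt : has_wt (hact (fundw r) (star (EU r)) *m hvec (V (fundw r)))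
      (fund r - alpha r).
    exact: (uwt_G hq (V := urep_of (V (fundw r)))).
  have fB : jfun f * B = B * jfun (shift (- fund r) f).
    have := jfun_jpol T Pol (shift (- fund r) f) (eta_w0 T (fundw r)) bwt.
    rewrite shift_shift addrN shift0 -/(bw T Pol (fundw r)) -/b => e1.
    rewrite -[jfun f]mul1r -Bb -!mulrA; congr (_ * _).
    by rewrite mulrA -e1 -mulrA bB mulr1.
  rewrite -!mulrA /c scalAC; congr (_ * _).
  rewrite (mulrA (jfun f)) fB -mulrA; congr (_ * _).
  rewrite /bE ract_coef (jfun_jpol T Pol _ _ bEwt) shift_shift.
  by rewrite addrAC subrr add0r.
have [sxb sxE] := bw_ract r e dl; rewrite -/b -/x -/bE in sxb sxE.
set sx := coef _ _ _ in sxb sxE.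
have Bsx : B * jpol sx = jpol x * B.
  have := congr1 jpol sxb; rewrite !jpolM => e1.
  rewrite -[LHS]mulr1 -bB mulrA -(mulrA B) e1 mulrA Bb mul1r.
  by [].
have c1 : c * (1 - toC (qr q r) ^+ 2)%:S = 1.
  have -> : c = ((1 - toC (qr q r) ^+ 2)^-1)%:S.
    by rewrite /c /toC fmorphV rmorphB rmorph1 rmorphXn.
  rewrite -scalM mulVf ?scal1 // subr_eq0 eq_sym qr_qpow (qpow_expr_neq1 hq) //.
  by rewrite gt_eqF // divr_gt0 ?ip_alpha_gt0.
have key : jpol x * (c * B * jpol bE) =
    (qpow q (ip (alpha r) l))%:S * (c * B * jpol bE * jpol x) + jpol (ract x (EU r)).
  have -> : jpol x * (c * B * jpol bE) = c * (B * (jpol sx * jpol bE)).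
    by rewrite -mulrA /c scalAC; congr (_ * _); rewrite !mulrA Bsx.
  rewrite -jpolM sxE jpolD !jpolZ !jpolM mulrDr mulrDr; congr (_ + _).
    by rewrite (scalAC _ B) /c scalCA !mulrA.
  by rewrite (scalAC _ B) (mulrA c) c1 mul1r mulrA Bb mul1r.
move: (c * B * jpol bE) fe key => E fe key.
have -> : E * ((qpow q (ip (alpha r) l))%:S * jpol x * jfun (shift (- alpha r) f)) =
    (qpow q (ip (alpha r) l))%:S * (E * jpol x) * jfun (shift (- alpha r) f).
  by rewrite -!mulrA scalAC.
by rewrite -(mulrA (jpol x)) fe (mulrA (jpol x)) key mulrDl addrAC subrr add0r.
Qed.

(* The image under the involution of [adj_EP] for [star x]. *)
Lemma adj_FP x f r : adj (jpol x * jfun f) (FP r) = translate [:: (FU r, 0)] x f.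
Proof.
move: x; apply: translate_wt => v d e l dl; set x := coef Pol d e.
rewrite /translate big_seq1 /= oppr0 shift0 ract_coef FU_star.
set a := qpow q (ip (alpha r) (alpha r)).
have a_neq0 : a != 0 by exact: qpow_neq0.
pose fl := shift (- l) (fun y => Num.conj (f y)).
have star_y : star (jpol x * jfun f) = jpol (star x) * jfun fl.
  have := congr1 (@star _ A) (jfun_jpol T Pol (shift (- l) f) e dl).
  rewrite !starM !jfun_star -jpol_star shift_shift addrN shift0 => e1.
  exact: esym e1.
have := congr1 (@star _ A) (adj_EP (star x) fl r).
rewrite -star_y (adj_E hcoact hcan p_star) (adj_K hcoact hcan p_star).
rewrite /translate big_seq1 /= ract_star_coefE jpolN mulNr starN !starM starD starN !starM starK.
have [_ ps] := p_star.
rewrite -!ps !K0_star E0_star (alg_homM p_hom).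
rewrite -jpol_star !starK jfun_star.
set X := coef Pol (hact v (EU r * KU (- alpha r)) *m d) e.
have Xwt : has_wt (hact v (EU r * KU (- alpha r)) *m d) (l + alpha r).
  rewrite hactM -mulmxA dl -scalemxAr.
  exact: (uwt_Z (V := urep_of (V v)) _ (uwt_E hq (V := urep_of (V v)) r dl)).
rewrite (jfun_jpol T Pol _ e Xwt) -/X.
have -> : shift (l + alpha r) (fun z => Num.conj (shift (- alpha r) fl z)) = f.
  apply: funext => z; rewrite /fl /shift conjCK; congr f.
  by apply/rowP=> t; rewrite !mxE; ring.
have KE : coef Pol (hact v (KU (- alpha r) * EU r) *m d) e = (a^-1)%:S * X.
  rewrite KUE hactM hact_scal mul_scalar_mx -scalemxAl coefZl qpow_conj.
  by rewrite ipNl (qpowN hq).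
rewrite KE jpolZ (adj_F hcoact hcan p_star).
have LF : p (F0 r) * p (L0 (alpha r)) = a%:S * (p (L0 (alpha r)) * p (F0 r)).
  rewrite -!(alg_homM p_hom) L0_F (alg_homZ p_hom) scalMA (qpowN hq) -/a.
  by rewrite mulfV // scal1 mul1r.
have NF : p (L0 (- alpha r)) * p (F0 r) = a%:S * (p (F0 r) * p (L0 (- alpha r))).
  by rewrite -!(alg_homM p_hom) L0_F (alg_homZ p_hom) ipNl opprK.
have NL : p (L0 (- alpha r)) * p (L0 (alpha r)) = 1.
  by rewrite -(alg_homM p_hom) -L0_D addNr L0_0 (alg_hom1 p_hom).
move: (jpol x * jfun f) (p (F0 r)) (p (L0 (alpha r))) (p (L0 (- alpha r))) LF NF NL.
move=> y phi lam mu LF NF NL.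
(* Together with [LF] this makes the star of the E_r side equal to -a times the adjoint action of
   F_r. The sign cancels with the one from the antipode, and a with the factor in [KE]. *)
have -> : lam * (y * mu) * (phi * lam) = a%:S * (lam * y * phi).
  rewrite -!mulrA (mulrA mu) NF -!mulrA !scalAC; congr (_ * _).
  by rewrite NL mulr1 !mulrA.
rewrite LF -(mulrA a%:S) -mulrBr => e1.
by rewrite -[RHS]mulrA -[jpol X * _]opprK -e1 mulrN scalMA mulVf // scal1 mul1r opprB.
Qed.

Lemma translateM Y1 Y2 x f :
  translate [seq (y1.1 * y2.1, y1.2 + y2.2) | y1 <- Y1, y2 <- Y2] x f =
  \sum_(y1 <- Y1) translate Y2 (ract x y1.1) (shift (- y1.2) f).
Proof.
rewrite /translate big_allpairs_dep; apply: eq_bigr => y1 _; apply: eq_bigr => y2 _ /=.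
by rewrite ractM shift_shift opprD addrC.
Qed.

(** The decomposition is quantified existentially because one is enough to evaluate [tr] at X. The
    multiplicativity needed on the translation side is that of the explicit sums [translate], so no
    action property of [tr] enters. *)
Lemma adj_translate X : exists2 Y, decomposes X Y &
  forall x f, adj (jpol x * jfun f) X = translate Y x f.
Proof.
elim/Up_ind: X => [w|w|r|r|c|X1 X2 [Y1 d1 h1] [Y2 d2 h2]|X1 X2 [Y1 d1 h1] [Y2 d2 h2]].
- by eexists; [exact: decomposesK|move=> x f; exact: adj_KP].
- by eexists; [exact: decomposesL|move=> x f; exact: adj_LP].
- by eexists; [exact: decomposesE|move=> x f; exact: adj_EP].
- by eexists; [exact: decomposesF|move=> x f; exact: adj_FP].
- eexists; first exact: decomposes_scal.
  move=> x f; rewrite (adj_scal hcoact hcan p_star) /translate big_seq1 /= oppr0 shift0.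
  by rewrite -[X in ract _ X]mulr1 ract_scalr ract_1 jpolZ mulrA.
- eexists; first exact: decomposesD d1 d2.
  move=> x f; rewrite (adjDr hcoact hcan hcan' p_star) h1 h2.
  by rewrite /translate big_cat.
- eexists; first exact: decomposesM d1 d2.
  move=> x f; rewrite (adjM hcoact hcan hcan' p_star) h1 translateM.
  by rewrite /translate adj_suml; apply: eq_bigr => y1 _; rewrite h2.
Qed.

Lemma translation_adjoint x X : in_FAKc x -> tr x X = adj x X.
Proof.
move=> [k [y [f [_ ->]]]]; have [Y dY h] := adj_translate X.
by rewrite (htr dY) adj_suml; apply: eq_bigr => i _; rewrite h.
Qed.

End Main.

Theorem corollary7p19
  (R : realType) (q : R) (hq : 0 < q < 1) (L : lie_datum)
  (HU : Uqk_hopf q L)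
  (V : forall w : domwt L, hwrep q (val w))
  (T : forall (w : domwt L), node L -> 'M[R[i]]_(hdim (V w)))
  (hT : is_lusztig T)
  (Pol : PolqK V HU)
  (D : Up q L -> tens (Up q L) (Up q L)) (hD : is_copUp D)
  (pik : Up q L -> Uqk q L) (hpik : is_pik pik)
  (pia : Up q L -> CP R L) (hpia : is_pia pia)
  (coact : U0 q L -> tens (U0 q L) (Up q L)) (hcoact : is_coaction coact)
  (caninv : tens (U0 q L) (Up q L) -> tens (U0 q L) (U0 q L))
  (hcan : cancel (can coact) caninv) (hcan' : cancel caninv (can coact))
  (tr : FAKext T Pol -> Up q L -> FAKext T Pol)
  (htr : is_translation D pik pia tr)
  (p : U0 q L -> FAKext T Pol) (hp : is_pi tr p) :
  forall (x : FAKext T Pol) (X : Up q L), in_FAKc x ->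
    tr x X = adjoint p caninv x X.
Proof.
move=> x X; exact: (translation_adjoint hq hT hD hpik hpia hcoact hcan hcan' htr hp).
Qed.
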